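(* Let $G$ be a graph, $\mathcal{T}$ its associated matrix (one of the graph matrices $T$, $A_d$, $T_d$ described in the context), of order $D$. For $i\ge 1$ define $$d_{\pm}(i)=\sum_{m=1}^{i}\lambda_{\pm}(m)\sum_{\substack{a_1+2a_2+\dots+ia_i=i\\ a_1+\dots+a_i=m}}\ \prod_{k=1}^{i}\frac{(\mathrm{Tr}\,\mathcal{T}^k)^{a_k}}{a_k!\,k^{a_k}},\qquad \lambda_+(m)=(-1)^{m+1},\quad \lambda_-(m)=+1,$$ the inner sum being over nonnegative integers $a_1,\dots,a_i$. These are the coefficients in $$\det(I-z\mathcal{T})=1-\sum_{N=1}^{D}d_+(N)z^N,\qquad \det(I-z\mathcal{T})^{-1}=1+\sum_{N=1}^{\infty}d_-(N)z^N .$$ Let $\mathcal{V}=\bigoplus_{N=1}^{D}\mathcal{V}_N$ be a $\mathbb{Z}_{>0}$-graded superspace with finite dimensions $\dim\mathcal{V}_N=|d_+(N)|$ and superdimensions $\mathrm{Dim}\,\mathcal{V}_N=d_+(N)$, and let $\mathcal{L}=\bigoplus_{N=1}^{\infty}\mathcal{L}_N$ be the free Lie superalgebra generated by $\mathcal{V}$, with the $\mathbb{Z}_{>0}$-gradation induced by that of $\mathcal{V}$. Then: (1) The superdimension of $\mathcal{L}_N$ is $$\mathrm{Dim}\,\mathcal{L}_N=\mathcal{C}(N,\mathcal{T})=\frac1N\sum_{g\mid N}\mu(g)\,\mathrm{Tr}\,\mathcal{T}^{N/g}.$$ This means that the equivalence classes of nonperiodic cycles of length $N$ in $G$ form a basis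 of $\mathcal{L}_N$. (2) The algebra $\mathcal{L}$ has denominator (or generalized Witt) identity $$\prod_{N=1}^{\infty}(1-z^N)^{\mathcal{C}(N,\mathcal{T})}=\det(I-z\mathcal{T}).$$ (3) The zeta function $\zeta_G(z)=\det(I-z\mathcal{T})^{-1}$ of $G$ (the Ihara zeta function if $\mathcal{T}=T$, the Bowen-Lanford zeta function if $\mathcal{T}=A_d$ or $T_d$) is the generating function for the dimensions $\mathrm{Dim}\,U(\mathcal{L})_N=d_-(N)$ of the homogeneous subspaces of the enveloping algebra $U(\mathcal{L})$ of the Lie superalgebra $\mathcal{L}$ generated by $G$.
   Context: A superspace is a $\mathbb{Z}/2$-graded vector space $W=W_{\bar 0}\oplus W_{\bar 1}$; $\dim W=\dim W_{\bar 0}+\dim W_{\bar 1}$ and $\mathrm{Dim}\,W=\dim W_{\bar 0}-\dim W_{\bar 1}$ is its superdimension. $\mathcal{L}_N$ and $U(\mathcal{L})_N$ are the $N$-th homogeneous subspaces for the gradation induced by that of $\mathcal{V}$. $\mu$ is the Möbius function, $g\mid N$ ranges over the positive divisors of $N$, and $z$ is a formal variable. Graph matrices. $\mathcal{T}$ stands for any one of $T$, $A_d$, $T_d$ below. Graphs may have multiple edges and loops. (i) $G=(V,E)$ a finite connected undirected graph with no 1-degree vertices. Orient the edges $e_1,\dots,e_{|E|}$ arbitrarily and add the oppositely oriented edges $e_{|E|+i}=(e_i)^{-1}$, $1\le i\le|E|$ (for a loop $e_i$, $e_{|E|+i}$ is an additional oriented loop at the same vertex). The edge adjacency matrix $T$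 is the $2|E|\times2|E|$ matrix with $T_{ij}=1$ if the end vertex of edge $i$ is the start vertex of edge $j$ and edge $j$ is not the inverse of edge $i$, and $T_{ij}=0$ otherwise. Here $D=2|E|$. (ii) $G=(V,E)$ a finite, strongly connected directed graph with no 1-degree vertices. The directed vertex adjacency matrix $A_d$ is the $|V|\times|V|$ matrix whose $(i,j)$ entry is the number of edges directed from vertex $i$ to vertex $j$; here $D=|V|$. The directed edge adjacency matrix $T_d$ is the $|E|\times|E|$ matrix with $(T_d)_{ij}=1$ if the end vertex of edge $i$ is the start vertex of edge $j$, and $0$ otherwise; here $D=|E|$. Cycles. A path of length $N$ is a sequence $(e_{i_1},\dots,e_{i_N})$ of oriented edges (from $e_1,\dots,e_{2|E|}$ in case (i), from the directed edges of $G$ in case (ii)) such that the end of $e_{i_k}$ is the origin of $e_{i_{k+1}}$. A cycle is a closed path (the end of $e_{i_N}$ is the origin of $e_{i_1}$) which, in case (i), is also non-backtracking ($e_{i_{k+1}}\neq (e_{i_k})^{-1}$) and tail-less ($e_{i_1}\neq (e_{i_N})^{-1}$). A cycle is nonperiodic if it is not the repetition $q^r$, $r>1$, of a simpler cycle $q$. Cycles that are circular permutations of each other are equivalent; in case (i) a cycle and its inverse are taken as distinct.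
   Formalization: In (1), ''form a basis of L_N'' fails when L_N has a nonzero odd part; it is replaced by: even elements of L_N indexed by the classes form a basis of L_N modulo a graded subspace of superdimension 0 (an ordinary basis if the odd part vanishes), and the number of classes equals C(N,T). *)

(* Defs.v *)
From HB Require Import structures.
From mathcomp Require Import all_boot all_order all_algebra.

Set Implicit Arguments.
Unset Strict Implicit.
Unset Printing Implicit Defensive.

Import Order.TTheory GRing.Theory Num.Theory.
Local Open Scope ring_scope.

(* Multiple edges and loops are allowed.  The same data serve for directed
   graphs and for undirected graphs: in the latter case [source] and [target]
   record the arbitrarily chosen orientation of each edge. *)
Record multigraph := Multigraph {
  vertex : finType;
  edge : finType;
  source : edge -> vertex;
  target : edge -> vertex }.

(* A loop contributes 2 to the degree of its vertex; for a directed graph this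
   is the in-degree plus the out-degree. *)
Definition degree (G : multigraph) (v : vertex G) : nat :=
  (#|[set e : edge G | source e == v]| + #|[set e : edge G | target e == v]|)%N.

Definition dir_adjacent (G : multigraph) : rel (vertex G) :=
  fun x y => [exists e : edge G, (source e == x) && (target e == y)].

Definition undir_adjacent (G : multigraph) : rel (vertex G) :=
  fun x y => dir_adjacent x y || dir_adjacent y x.

Definition connected_graph (G : multigraph) : Prop :=
  forall x y : vertex G, connect (@undir_adjacent G) x y.

Definition strongly_connected_graph (G : multigraph) : Prop :=
  forall x y : vertex G, connect (@dir_adjacent G) x y.

(* The matrices T (undirected case), A_d and T_d (directed cases). *)
Inductive matrix_kind := MatT | MatAd | MatTd.

Definition admissible (k : matrix_kind) (G : multigraph) : Prop :=
  (if k is MatT then connected_graph G else strongly_connected_graph G)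
  /\ forall v : vertex G, degree v <> 1%N.

(* The oriented edges out of which cycles are made.  In the undirected case,
   [inl e] is the edge [e] with its chosen orientation and [inr e] is the
   oppositely oriented edge. *)
Definition oedge (k : matrix_kind) (G : multigraph) : finType :=
  if k is MatT then (edge G + edge G)%type : finType else edge G.

Definition start_of (k : matrix_kind) (G : multigraph) :
    oedge k G -> vertex G :=
  match k return oedge k G -> vertex G with
  | MatT => fun x => match x with inl e => source e | inr e => target e end
  | MatAd => @source G
  | MatTd => @source G
  end.

Definition end_of (k : matrix_kind) (G : multigraph) :
    oedge k G -> vertex G :=
  match k return oedge k G -> vertex G with
  | MatT => fun x => match x with inl e => target e | inr e => source e end
  | MatAd => @target G
  | MatTd => @target G
  end.

(* [is_inverse x y] : y is the inverse of x; no edge of a directed graph has an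
   inverse. *)
Definition is_inverse (k : matrix_kind) (G : multigraph) : rel (oedge k G) :=
  match k return rel (oedge k G) with
  | MatT => fun x y => y == (match x with inl e => inr e | inr e => inl e end)
  | MatAd => fun _ _ => false
  | MatTd => fun _ _ => false
  end.

Definition feeds (k : matrix_kind) (G : multigraph) : rel (oedge k G) :=
  fun x y => end_of x == start_of y.

Definition edge_matrix (G : multigraph) : 'M[rat]_#|oedge MatT G| :=
  \matrix_(i, j) (feeds (enum_val i) (enum_val j)
                  && ~~ is_inverse (enum_val i) (enum_val j))%:R.

Definition dir_vertex_matrix (G : multigraph) : 'M[rat]_#|vertex G| :=
  \matrix_(i, j) #|[set e : edge G | (source e == enum_val i)
                                     && (target e == enum_val j)]|%:R.

Definition dir_edge_matrix (G : multigraph) : 'M[rat]_#|edge G| :=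
  \matrix_(i, j) (target (enum_val i) == source (enum_val j))%:R.

Definition matrix_order (k : matrix_kind) (G : multigraph) : nat :=
  match k with
  | MatT => #|oedge MatT G|
  | MatAd => #|vertex G|
  | MatTd => #|edge G|
  end.

Definition graph_matrix (k : matrix_kind) (G : multigraph) :
    'M[rat]_(matrix_order k G) :=
  match k return 'M[rat]_(matrix_order k G) with
  | MatT => edge_matrix G
  | MatAd => dir_vertex_matrix G
  | MatTd => dir_edge_matrix G
  end.

Section Cycles.
Variables (k : matrix_kind) (G : multigraph).

Definition closed_path (p : seq (oedge k G)) : bool := cycle (@feeds k G) p.

Definition non_backtracking (p : seq (oedge k G)) : bool :=
  sorted (fun x y => ~~ is_inverse x y) p.

Definition tailless (p : seq (oedge k G)) : bool :=
  if p is x :: p' then ~~ is_inverse (last x p') x else true.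

(* In the directed cases the last two conditions hold trivially. *)
Definition is_cycle (p : seq (oedge k G)) : bool :=
  [&& closed_path p, non_backtracking p & tailless p].

(* A sequence of N edges equal to q^r with r > 1 has size q < N and r <= N. *)
Definition periodic (N : nat) (p : N.-tuple (oedge k G)) : bool :=
  [exists d : 'I_N, exists q : d.-tuple (oedge k G), exists r : 'I_N.+1,
    [&& (1 < r)%N, is_cycle q & tval p == flatten (nseq r (tval q))]].

Definition nonperiodic_cycles (N : nat) : {set N.-tuple (oedge k G)} :=
  [set p : N.-tuple (oedge k G) | is_cycle p && ~~ periodic p].

Definition circular_equiv (N : nat) : rel (N.-tuple (oedge k G)) :=
  fun p q => [exists i : 'I_N, tval q == rot i (tval p)].

Definition cycle_classes (N : nat) : {set {set N.-tuple (oedge k G)}} :=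
  equivalence_partition (@circular_equiv N) (nonperiodic_cycles N).

End Cycles.

(* A formal power series in z over the rationals, given by its coefficients. *)
Definition fps := nat -> rat.

Definition fps_one : fps := fun n => (n == 0%N)%:R.

Definition fps_mul (a b : fps) : fps :=
  fun n => \sum_(i < n.+1) a i * b (n - i)%N.

Definition fps_of_poly (p : {poly rat}) : fps := fun n => p`_n.

(* The first n coefficients of 1 / a, for a with nonzero constant term. *)
Fixpoint fps_inv_seq (a : fps) (n : nat) : seq rat :=
  if n is m.+1 then
    let s := fps_inv_seq a m in
    rcons s ((a 0%N)^-1 * ((m == 0%N)%:R - \sum_(i < m) a (m - i)%N * s`_i))
  else [::].

Definition fps_inv (a : fps) : fps := fun n => (fps_inv_seq a n.+1)`_n.

Lemma size_fps_inv_seq a n : size (fps_inv_seq a n) = n.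
Proof. by elim: n => //= n IH; rewrite size_rcons IH. Qed.

Lemma nth_fps_inv_seq a n i : (i < n)%N -> (fps_inv_seq a n)`_i = fps_inv a i.
Proof.
elim: n => // n IH; rewrite ltnS leq_eqVlt => /predU1P[-> // | lt_in] /=.
by rewrite nth_rcons size_fps_inv_seq lt_in IH.
Qed.

Lemma fps_mulV (a : fps) :
  a 0%N != 0 -> forall n, fps_mul a (fps_inv a) n = fps_one n.
Proof.
move=> a0 n; rewrite /fps_mul big_ord_recl /= subn0 {1}/fps_inv /=.
rewrite nth_rcons size_fps_inv_seq ltnn eqxx mulrA divff // mul1r /fps_one.
rewrite [X in _ + X](reindex_inj rev_ord_inj) /=.
rewrite [X in _ + X](_ : _ = \sum_(i < n) a (n - i)%N * (fps_inv_seq a n)`_i).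
  by rewrite subrK.
apply: eq_bigr => i _; rewrite nth_fps_inv_seq // /bump leq0n add1n.
by rewrite subnSK // subKn // ltnW.
Qed.

Definition gen_binomial (c : rat) (m : nat) : rat :=
  (\prod_(i < m) (c - i%:R)) / (m`!)%:R.

(* (1 - z^N)^c for N > 0, expanded by the binomial series. *)
Definition one_minus_pow (N : nat) (c : rat) : fps :=
  fun n => if (N %| n)%N
           then (-1) ^+ (n %/ N)%N * gen_binomial c (n %/ N)%N else 0.

(* prod_{N >= 1} F N = P : every coefficient of the partial products is
   eventually that of P. *)
Definition fps_infprod (F : nat -> fps) (P : fps) : Prop :=
  forall n, exists M0 : nat, forall M : nat, (M0 <= M)%N ->
    (\big[fps_mul/fps_one]_(1 <= N < M.+1) F N) n = P n.

Definition mobius (n : nat) : rat :=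
  if all (fun p => logn p n == 1%N) (primes n)
  then (-1) ^+ size (primes n) else 0.

Section MatrixData.
Variables (D : nat) (A : 'M[rat]_D).

Definition trace_pow (m : nat) : rat := \tr (A ^+ m).

(* In both sums below the index i : 'I_n stands for k = i + 1, and the bound
   a_k <= n is implied by the constraint on the weighted sum. *)
Definition d_coef (lambda : nat -> rat) (n : nat) : rat :=
  \sum_(1 <= m < n.+1) lambda m *
    \sum_(a : {ffun 'I_n -> 'I_n.+1}
          | (\sum_(i < n) i.+1 * a i == n)%N && (\sum_(i < n) a i == m)%N)
      \prod_(i < n)
        (trace_pow i.+1 ^+ a i / ((a i)`!%:R * i.+1%:R ^+ a i)).

Definition d_plus : nat -> rat := d_coef (fun m => (-1) ^+ m.+1).

Definition d_minus : nat -> rat := d_coef (fun=> 1).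

Definition cycle_number (N : nat) : rat :=
  N%:R^-1 * \sum_(g <- divisors N) mobius g * trace_pow (N %/ g)%N.

Definition det_poly : {poly rat} :=
  \det (1%:M - 'X *: map_mx (@polyC rat) A).

Definition zeta_fps : fps := fps_inv (fps_of_poly det_poly).

End MatrixData.

Section Superspaces.
Variables (K : fieldType) (W : lmodType K).

Definition is_subspace (P : W -> Prop) : Prop :=
  P 0 /\ forall (a : K) (x y : W), P x -> P y -> P (a *: x + y).

(* [par false] and [par true] are the even and the odd part. *)
Definition is_superspace (par : bool -> W -> Prop) : Prop :=
  [/\ forall p, is_subspace (par p),
      forall x, exists x0 x1, [/\ par false x0, par true x1 & x = x0 + x1]
    & forall x, par false x -> par true x -> x = 0].

Definition is_graded_subspace (par : bool -> W -> Prop) (P : W -> Prop) :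
    Prop :=
  is_subspace P /\
  forall x, P x -> exists x0 x1,
    [/\ P x0 /\ par false x0, P x1 /\ par true x1 & x = x0 + x1].

Definition has_dim (P : W -> Prop) (n : nat) : Prop :=
  exists b : 'I_n -> W,
    (forall c : 'I_n -> K, \sum_i c i *: b i = 0 -> forall i, c i = 0) /\
    (forall x, P x <-> exists c : 'I_n -> K, x = \sum_i c i *: b i).

(* The graded subspace P is finite-dimensional, of superdimension s. *)
Definition has_sdim (par : bool -> W -> Prop) (P : W -> Prop) (s : rat) :
    Prop :=
  exists n0 n1 : nat,
    [/\ has_dim (fun x => P x /\ par false x) n0,
        has_dim (fun x => P x /\ par true x) n1 & s = n0%:R - n1%:R].

(* The family b, indexed by A, consists of even elements of P and is a basis
   of P modulo a graded subspace of superdimension 0; when the odd part of P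
   vanishes, this says that b is a basis of P. *)
Definition is_superbasis (par : bool -> W -> Prop) (P : W -> Prop)
    (I : finType) (A : {set I}) (b : I -> W) : Prop :=
  (forall i, i \in A -> P (b i) /\ par false (b i)) /\
  exists Z : W -> Prop,
    [/\ is_graded_subspace par Z,
        has_sdim par Z 0,
        forall x, P x <->
          exists (c : I -> K) z, Z z /\ x = \sum_(i in A) c i *: b i + z
      & forall (c : I -> K) z, Z z -> \sum_(i in A) c i *: b i + z = 0 ->
          forall i, i \in A -> c i = 0].

End Superspaces.

(* V = \bigoplus_{N = 1}^D V_N, each V_N being a superspace; V_ n p is the part
   of parity p of the component of degree N = n + 1. *)
Definition is_graded_superspace (K : fieldType) (V : vectType K) (D : nat)
    (V_ : 'I_D -> bool -> {vspace V}) : Prop :=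
  (\sum_(np : 'I_D * bool) V_ np.1 np.2)%VS = fullv
  /\ directv (\sum_(np : 'I_D * bool) V_ np.1 np.2)%VS.

(* This set of axioms is the standard one away from characteristics 2 and 3. *)
Record lieSuperalgebra (K : fieldType) := LieSuperalgebra {
  lie_sort :> lmodType K;
  lie_par : bool -> lie_sort -> Prop;
  lie_br : lie_sort -> lie_sort -> lie_sort;
  lie_superspace : is_superspace lie_par;
  lie_linearl : forall (a : K) x y z,
    lie_br (a *: x + y) z = a *: lie_br x z + lie_br y z;
  lie_linearr : forall (a : K) x y z,
    lie_br z (a *: x + y) = a *: lie_br z x + lie_br z y;
  lie_br_par : forall p q x y,
    lie_par p x -> lie_par q y -> lie_par (p (+) q) (lie_br x y);
  lie_skew : forall p q x y, lie_par p x -> lie_par q y ->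
    lie_br x y = - ((-1) ^+ (p && q) *: lie_br y x);
  lie_jacobi : forall p q x y z, lie_par p x -> lie_par q y ->
    lie_br x (lie_br y z) =
      lie_br (lie_br x y) z + (-1) ^+ (p && q) *: lie_br y (lie_br x z) }.

Definition lie_hom (K : fieldType) (L M : lieSuperalgebra K)
    (f : {linear L -> M}) : Prop :=
  (forall p x, lie_par p x -> lie_par p (f x)) /\
  (forall x y, f (lie_br x y) = lie_br (f x) (f y)).

Section FreeLie.
Variables (K : fieldType) (V : vectType K) (D : nat).
Variable V_ : 'I_D -> bool -> {vspace V}.

Definition par_preserving (L : lieSuperalgebra K) (f : {linear V -> L}) :
    Prop :=
  forall n p v, v \in V_ n p -> lie_par p (f v).

Definition is_free_lie (L : lieSuperalgebra K) (iota : {linear V -> L}) :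
    Prop :=
  par_preserving iota /\
  forall (M : lieSuperalgebra K) (f : {linear V -> M}), par_preserving f ->
    exists g : {linear L -> M},
      [/\ lie_hom g, forall v, g (iota v) = f v
        & forall h : {linear L -> M}, lie_hom h ->
            (forall v, h (iota v) = f v) -> forall x, h x = g x].

(* The induced gradation: the least family of subspaces L_N such that
   V_N <= L_N and [L_M, L_N] <= L_(M+N). *)
Inductive lie_deg (L : lieSuperalgebra K) (iota : {linear V -> L}) :
    nat -> L -> Prop :=
  | lie_deg_gen (n : 'I_D) v :
      v \in (V_ n false + V_ n true)%VS -> lie_deg iota n.+1 (iota v)
  | lie_deg_0 N : lie_deg iota N 0
  | lie_deg_lin N (a : K) x y :
      lie_deg iota N x -> lie_deg iota N y -> lie_deg iota N (a *: x + y)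
  | lie_deg_br M N x y : lie_deg iota M x -> lie_deg iota N y ->
      lie_deg iota (M + N) (lie_br x y).

End FreeLie.

Section Enveloping.
Variables (K : fieldType) (L : lieSuperalgebra K).

Definition enveloping_map (A : algType K) (f : {linear L -> A}) : Prop :=
  forall p q x y, lie_par p x -> lie_par q y ->
    f (lie_br x y) = f x * f y - (-1) ^+ (p && q) *: (f y * f x).

Definition is_enveloping (U : algType K) (j : {linear L -> U}) : Prop :=
  enveloping_map j /\
  forall (A : algType K) (f : {linear L -> A}), enveloping_map f ->
    exists g : {lrmorphism U -> A},
      (forall x, g (j x) = f x) /\
      forall h : {lrmorphism U -> A},
        (forall x, h (j x) = f x) -> forall u, h u = g u.

Inductive env_par (U : algType K) (j : {linear L -> U}) : bool -> U -> Prop :=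
  | env_par_gen p x : lie_par p x -> env_par j p (j x)
  | env_par_1 : env_par j false 1
  | env_par_0 p : env_par j p 0
  | env_par_lin p (a : K) u v :
      env_par j p u -> env_par j p v -> env_par j p (a *: u + v)
  | env_par_mul p q u v :
      env_par j p u -> env_par j q v -> env_par j (p (+) q) (u * v).

Inductive env_deg (deg : nat -> L -> Prop) (U : algType K)
    (j : {linear L -> U}) : nat -> U -> Prop :=
  | env_deg_gen N x : deg N x -> env_deg deg j N (j x)
  | env_deg_1 : env_deg deg j 0 1
  | env_deg_0 N : env_deg deg j N 0
  | env_deg_lin N (a : K) u v :
      env_deg deg j N u -> env_deg deg j N v -> env_deg deg j N (a *: u + v)
  | env_deg_mul M N u v : env_deg deg j M u -> env_deg deg j N v ->
      env_deg deg j (M + N) (u * v).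

End Enveloping.

(* Main.v *)
Require Import Defs.
From HB Require Import structures.
From mathcomp Require Import all_boot all_order all_algebra.
From mathcomp Require Import perm finmap ring.
From mathcomp.multinomials Require Import monalg.
From Stdlib Require Import Classical FunctionalExtensionality.

Set Implicit Arguments.
Unset Strict Implicit.
Unset Printing Implicit Defensive.

Import Order.TTheory GRing.Theory Num.Theory.
Local Open Scope ring_scope.

(** The proof compares logarithmic derivatives z f'/f of power series. Write t_n
    for the trace of the n-th power of the matrix A of the graph.

    Newton's identities ([log_der_det_poly]) say that the series - sum_n t_n z^n
    is the logarithmic derivative of det (I - zA); the expansion of exp (- sum_k
    t_k z^k / k) and of its inverse gives the formulas for d_+ and d_-, and
    Moebius inversion in the form sum_(d | n) d C(d) = t_n gives the product
    formula ([generalized_witt_identity]). The number t_n also counts the cycles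
    of length n; sorting them by their period shows that C(N) is the number of
    classes of nonperiodic cycles of length N ([card_cycle_classesE]).

    For the Lie superalgebra, fix a homogeneous basis of V, whose elements are
    called letters. The free associative algebra T on the letters is a Lie
    superalgebra for the supercommutator, so there is a morphism g from L to T,
    which extends to a morphism psi from U to T. Words in the letters span U in
    each degree and psi sends them to the basis of words of T, so they are a
    basis of U; counting them with the sign of their parity gives 1 / (1 - sum
    d_+(N) z^N), the zeta function ([env_sdim], [signed_count_letters]).

    The superdimension of L_N needs two more facts, for which characteristic
    0 is essential. First, g is injective, because Dynkin's operator from T
    to L, composed with g, multiplies L_N by N ([dynkin_rbr]). Secondly, the
    ordered monomials in a homogeneous basis of g(L) are a basis of T
    ([size_monomials]). They span T by the usual straightening. They are
    independent because elements of g(L) are primitive: a linear form on T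
    that is dual to one basis element acts on T through the coproduct, as a
    skew derivation which removes that basis element from ordered monomials
    ([der_mono]). Counted with signs, the ordered monomials have the
    generating function prod_N (1 - z^N)^(- Dim L_N), where an odd basis
    element contributes 1 - z^N and an even one its inverse. Comparing
    logarithmic derivatives with the count of words yields sum_(d | n) d Dim
    L_d = t_n, the relation which characterizes C ([cycle_number_uniq]). *)

(** * Formal power series and logarithmic derivatives *)

Lemma fps_mul_coef (a b : fps) (p q : {poly rat}) n :
  (forall i, (i <= n)%N -> p`_i = a i) ->
  (forall i, (i <= n)%N -> q`_i = b i) ->
  forall i, (i <= n)%N -> (p * q)`_i = fps_mul a b i.
Proof.
move=> pa qb i le_in; rewrite coefM; apply: eq_bigr => j _.
by rewrite pa ?qb //; [apply: leq_trans le_in; apply: leq_subr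
  | apply: leq_trans le_in; rewrite -ltnS].
Qed.

Definition fps_trunc n (a : fps) : {poly rat} := \poly_(i < n.+1) a i.

Lemma fps_truncE n a i : (i <= n)%N -> (fps_trunc n a)`_i = a i.
Proof. by move=> le_in; rewrite coef_poly ltnS le_in. Qed.

Lemma fps_mulC : commutative fps_mul.
Proof.
move=> a b; apply: functional_extensionality => n.
have ta := @fps_truncE n a; have tb := @fps_truncE n b.
by rewrite -(fps_mul_coef ta tb) // mulrC (fps_mul_coef tb ta).
Qed.

Lemma fps_mulA : associative fps_mul.
Proof.
move=> a b c; apply: functional_extensionality => n.
have ta := @fps_truncE n a; have tb := @fps_truncE n b.
have tc := @fps_truncE n c.
rewrite -(fps_mul_coef ta (fps_mul_coef tb tc)) //.
by rewrite mulrA (fps_mul_coef (fps_mul_coef ta tb) tc).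
Qed.

Lemma fps_mul1l : left_id fps_one fps_mul.
Proof.
move=> a; apply: functional_extensionality => n.
rewrite /fps_mul big_ord_recl subn0 /fps_one mul1r big1 ?addr0 // => i _.
by rewrite mul0r.
Qed.

HB.instance Definition _ :=
  Monoid.isComLaw.Build fps fps_one fps_mul fps_mulA fps_mulC fps_mul1l.

Lemma fps_mulDl (a b c : fps) n :
  fps_mul (fun i => a i + b i) c n = fps_mul a c n + fps_mul b c n.
Proof. by rewrite -big_split; apply: eq_bigr => i _; rewrite mulrDl. Qed.

Lemma fps_bigmul_coef (J : Type) (r : seq J) (F : J -> fps)
    (p : J -> {poly rat}) n :
  (forall j i, (i <= n)%N -> (p j)`_i = F j i) ->
  (\prod_(j <- r) p j)`_n = (\big[fps_mul/fps_one]_(j <- r) F j) n.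
Proof.
move=> pF; suff H i : (i <= n)%N ->
  (\prod_(j <- r) p j)`_i = (\big[fps_mul/fps_one]_(j <- r) F j) i by apply: H.
elim: r i => [|j r IH] i le_in; first by rewrite !big_nil coef1.
by rewrite !big_cons (fps_mul_coef (pF j) IH).
Qed.

Lemma fps_inv_uniq (a b : fps) : a 0%N != 0 -> fps_mul a b = fps_one ->
  b = fps_inv a.
Proof.
move=> a0 ab1; have aV : fps_mul a (fps_inv a) = fps_one.
  by apply: functional_extensionality => n; apply: fps_mulV.
by rewrite -[RHS]fps_mul1l -ab1 (fps_mulC a) -fps_mulA aV fps_mulC fps_mul1l.
Qed.

(** With theta = z d/dz, this says theta f = h f: the series h is the
    logarithmic derivative of f. *)
Definition log_der (h f : fps) := forall n, n%:R * f n = fps_mul h f n.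

Lemma log_der_one : log_der (fun=> 0) fps_one.
Proof.
move=> n; rewrite /fps_mul big1 => [|i _]; last by rewrite mul0r.
by case: n => [|n]; rewrite ?mul0r // /fps_one mulr0.
Qed.

Lemma log_der_mul h1 h2 f1 f2 : log_der h1 f1 -> log_der h2 f2 ->
  log_der (fun n => h1 n + h2 n) (fps_mul f1 f2).
Proof.
move=> d1 d2 n; rewrite fps_mulDl.
have t1 : (fun m => m%:R * f1 m) = fps_mul h1 f1.
  by apply: functional_extensionality.
have t2 : (fun m => m%:R * f2 m) = fps_mul h2 f2.
  by apply: functional_extensionality.
have -> : fps_mul h2 (fps_mul f1 f2) = fps_mul f1 (fps_mul h2 f2).
  by rewrite fps_mulA (fps_mulC h2) -fps_mulA.
rewrite fps_mulA -t1 -t2.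
rewrite -big_split mulr_sumr /=; apply: eq_bigr => i _.
have le_in : (i <= n)%N by rewrite -ltnS.
by rewrite -{1}(subnKC le_in) natrD; ring.
Qed.

Lemma log_der_big (J : Type) (r : seq J) (P : pred J) (h F : J -> fps) :
  (forall j, P j -> log_der (h j) (F j)) ->
  log_der (fun n => \sum_(j <- r | P j) h j n)
    (\big[fps_mul/fps_one]_(j <- r | P j) F j).
Proof.
move=> hF; elim: r => [|j r IH].
  rewrite big_nil (_ : (fun _ => _) = fun=> 0); first exact: log_der_one.
  by apply: functional_extensionality => n; rewrite big_nil.
rewrite big_cons; case: ifP => Pj.
  rewrite (_ : (fun _ => _) = fun n => h j n + \sum_(i <- r | P i) h i n).
    exact: log_der_mul (hF _ Pj) IH.
  by apply: functional_extensionality => n; rewrite big_cons Pj.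
rewrite (_ : (fun _ => _) = fun n => \sum_(i <- r | P i) h i n) //.
by apply: functional_extensionality => n; rewrite big_cons Pj.
Qed.

(** Comparing coefficients in theta f = h f gives n f_n in terms of h_k and
    f_(n-k) with 0 < k <= n: the series f is determined by h and f_0. *)
Lemma log_der_uniq h1 h2 f1 f2 N : h1 0%N = 0 -> h2 0%N = 0 ->
  f1 0%N = f2 0%N -> log_der h1 f1 -> log_der h2 f2 ->
  (forall n, (n <= N)%N -> h1 n = h2 n) ->
  forall n, (n <= N)%N -> f1 n = f2 n.
Proof.
move=> h10 h20 f0 d1 d2 h12; elim/ltn_ind=> -[|n] IH le_nN //.
have n0 : n.+1%:R != 0 :> rat by rewrite pnatr_eq0.
apply: (mulfI n0); rewrite d1 d2 /fps_mul big_ord_recl [RHS]big_ord_recl.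
rewrite h10 h20 !mul0r !add0r.
apply: eq_bigr => i _; have lt_in := ltn_ord i.
rewrite lift0 h12 ?IH //; last exact: leq_trans lt_in le_nN.
  by rewrite subSS ltnS leq_subr.
by rewrite subSS (leq_trans (leq_subr _ _)) // ltnW.
Qed.

(** Conversely f determines h: since f_0 = 1, the coefficient of index n of
    theta f = h f contains h_n with coefficient 1. *)
Lemma log_der_inj h1 h2 f1 f2 N : f1 0%N = 1 ->
  log_der h1 f1 -> log_der h2 f2 ->
  (forall n, (n <= N)%N -> f1 n = f2 n) ->
  forall n, (n <= N)%N -> h1 n = h2 n.
Proof.
move=> f10 d1 d2 f12; have f20 : f2 0%N = 1 by rewrite -f12.
elim/ltn_ind=> n IH le_nN.
have := d1 n; rewrite f12 // d2 /fps_mul !big_ord_recr /= subnn f10 f20 !mulr1.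
under eq_bigr => i _.
  rewrite -IH ?(leq_trans (ltnW (ltn_ord i))) //.
  rewrite -f12 ?(leq_trans (leq_subr _ _)) //.
  over.
by move/addrI.
Qed.

(** The series c (z^d + z^(2d) + z^(3d) + ...). *)
Definition geom (d : nat) (c : rat) : fps :=
  fun n => if (0 < n)%N && (d %| n)%N then c else 0.

Lemma sum_multiples (R : nmodType) (d m : nat) (F : nat -> R) : (0 < d)%N ->
  (forall i, ~~ (d %| i)%N -> F i = 0) ->
  \sum_(0 <= i < (m * d).+1) F i = \sum_(0 <= j < m.+1) F (j * d)%N.
Proof.
move=> d0 F0; elim: m => [|m IH]; first by rewrite mul0n !big_nat1.
rewrite (@big_cat_nat _ _ _ (m * d).+1) //=; last first.
  by rewrite ltnS leq_mul2r leqnSn orbT.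
rewrite IH [RHS]big_nat_recr //=; congr (_ + _).
rewrite big_nat_recr /= ?mulSn; last by rewrite -{1}[(m * d)%N]add0n ltn_add2r.
rewrite big_nat_cond big1 ?add0r // => i; rewrite andbT => /andP[lt_mi lt_im].
apply: F0; apply/negP => /dvdnP[k ik]; move: lt_mi lt_im; rewrite ik.
rewrite -mulSn !ltn_mul2r d0 /= => lt_mk; rewrite ltnS leqNgt.
by rewrite lt_mk.
Qed.

Lemma gen_binomialS c m :
  m.+1%:R * gen_binomial c m.+1 = (c - m%:R) * gen_binomial c m.
Proof.
rewrite /gen_binomial big_ord_recr /= factS natrM.
have f0 : (m`!)%:R != 0 :> rat by rewrite pnatr_eq0 -lt0n fact_gt0.
have n0 : m.+1%:R != 0 :> rat by rewrite pnatr_eq0.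
by field; rewrite f0 nat1r n0.
Qed.

(** The coefficients a_m of (1 - x)^c satisfy m a_m = -c (a_0 + ... +
    a_(m-1)), which is theta f = - c x / (1 - x) f. *)
Lemma log_der_one_minus_pow d c : (0 < d)%N ->
  log_der (geom d (- (c * d%:R))) (one_minus_pow d c).
Proof.
move=> d0 n; rewrite /fps_mul.
pose G (i : nat) := geom d (- (c * d%:R)) i * one_minus_pow d c (n - i)%N.
rewrite (_ : \sum_(i < n.+1) _ = \sum_(0 <= i < n.+1) G i); last first.
  by rewrite big_mkord.
case: (boolP (d %| n)%N) => [/dvdnP[m n_md]|ndn]; last first.
  rewrite /one_minus_pow (negPf ndn) mulr0 big_nat_cond big1 // => i.
  rewrite andbT => lt_in; rewrite /G /geom; case: ifP; last by rewrite mul0r.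
  case/andP=> _ di; rewrite /one_minus_pow.
  have le_in : (i <= n)%N by rewrite -ltnS.
  by rewrite (dvdn_subl le_in di) (negPf ndn) mulr0.
subst n; rewrite sum_multiples //; last first.
  by move=> i ndi; rewrite /G /geom (negPf ndi) andbF mul0r.
pose a j : rat := (-1) ^+ j * gen_binomial c j.
have omp j : one_minus_pow d c (j * d) = a j.
  by rewrite /one_minus_pow dvdn_mull // mulnK.
have Ga j : (j < m)%N -> G (j.+1 * d)%N = - (c * d%:R) * a (m - j.+1)%N.
  by move=> ltjm; rewrite /G /geom dvdn_mull // muln_gt0 d0 /= -mulnBl omp.
rewrite big_nat_recl // {1}/G /geom mul0n /= mul0r add0r omp natrM.
transitivity (\sum_(0 <= j < m) (- (c * d%:R) * a (m - j.+1)%N)); last first.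
  by apply: eq_big_nat => j /andP[_ /Ga].
rewrite -mulr_sumr big_nat_rev /= add0n.
rewrite (_ : \sum_(0 <= i < m) _ = \sum_(0 <= i < m) a i); last first.
  by apply: eq_big_nat => j /andP[_ jm]; rewrite subnSK // subKn // ltnW.
suff H : m%:R * a m = - c * \sum_(0 <= i < m) a i by rewrite mulrAC H; ring.
rewrite {Ga omp G}; elim: m => [|m IH]; first by rewrite big_geq // mul0r mulr0.
rewrite big_nat_recr //= mulrDr -IH /a exprS.
transitivity (- (-1) ^+ m * (m.+1%:R * gen_binomial c m.+1)); first by ring.
by rewrite gen_binomialS; ring.
Qed.

(** * Exponential formulas and Newton's identities *)

(** The series exp(y z^k). *)
Definition fps_exp (k : nat) (y : rat) : fps :=
  fun n => if (k %| n)%N then y ^+ (n %/ k) / ((n %/ k)`!)%:R else 0.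

Lemma log_der_exp k y : (0 < k)%N ->
  log_der (fun n => if n == k then k%:R * y else 0) (fps_exp k y).
Proof.
move=> k0 n; rewrite /fps_mul; case: (leqP k n) => [le_kn|lt_nk]; last first.
  rewrite big1 => [|i _]; last first.
    by rewrite ltn_eqF ?mul0r // (leq_ltn_trans _ lt_nk) // -ltnS.
  rewrite /fps_exp; case: n lt_nk => [|n] lt_nk; first by rewrite mul0r.
  by rewrite gtnNdvd // mulr0.
have lt_k : (k < n.+1)%N by rewrite ltnS.
rewrite (bigD1 (Ordinal lt_k)) //= eqxx big1 ?addr0 => [|i]; last first.
  by rewrite -val_eqE /= => /negPf->; rewrite mul0r.
rewrite /fps_exp (dvdn_subl le_kn) //; case: ifP => [/dvdnP[m nE]|]; last first.
  by rewrite !mulr0.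
case: m nE => [|m] nE; first by move: le_kn; rewrite nE leqNgt k0.
rewrite nE (_ : (m.+1 * k - k = m * k)%N); last by rewrite mulSn addKn.
have f0 : (m`!)%:R != 0 :> rat by rewrite pnatr_eq0 -lt0n fact_gt0.
have n0 : m.+1%:R != 0 :> rat by rewrite pnatr_eq0.
by rewrite !mulnK // exprS factS !natrM; field; rewrite f0 nat1r n0.
Qed.

Section ExpSum.
Variable t : nat -> rat.

Definition pos_part : fps := fun n => if (0 < n)%N then t n else 0.

(** The product of the exp(t_k z^k / k) for k <= M; its coefficients of index
    at most M do not depend on M. *)
Definition exp_prod (M : nat) : fps :=
  \big[fps_mul/fps_one]_(1 <= k < M.+1) fps_exp k (t k / k%:R).

Lemma log_der_exp_prod M :
  log_der (fun n => if (n <= M)%N then pos_part n else 0) (exp_prod M).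
Proof.
rewrite /exp_prod big_nat.
pose h (k n : nat) := if n == k then k%:R * (t k / k%:R) else 0.
rewrite (_ : (fun _ => _) =
  fun n => \sum_(1 <= k < M.+1 | (1 <= k < M.+1)%N) h k n).
  by apply: log_der_big => k /andP[k0 _]; apply: log_der_exp.
apply: functional_extensionality => n; rewrite -big_nat /pos_part /h.
case: (posnP n) => [->|n0].
  by rewrite big_nat_cond big1 ?if_same // => -[] // k.
case: leqP => le_nM; last first.
  rewrite big_nat_cond big1 // => k; rewrite andbT ltnS => /andP[_ le_kM].
  by rewrite gtn_eqF // (leq_ltn_trans le_kM).
rewrite (bigD1_seq n) ?mem_index_iota ?iota_uniq ?n0 //= eqxx.
rewrite big1 => [|k]; last by rewrite eq_sym => /negPf->.
by rewrite addr0 mulrCA divff ?mulr1 // pnatr_eq0 -lt0n.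
Qed.

Lemma fps_bigmul0 (J : Type) (r : seq J) (P : pred J) (F : J -> fps) :
  (\big[fps_mul/fps_one]_(j <- r | P j) F j) 0%N = \prod_(j <- r | P j) F j 0%N.
Proof.
by apply: (big_morph (fun f : fps => f 0%N)) => // a b;
  rewrite /fps_mul big_ord1.
Qed.

Lemma exp_prod0 M : exp_prod M 0%N = 1.
Proof.
rewrite /exp_prod fps_bigmul0 big1 // => k _.
by rewrite /fps_exp dvdn0 div0n expr0 invr1 mulr1.
Qed.

Lemma log_der_exp_diag : log_der pos_part (fun n => exp_prod n n).
Proof.
move=> n; rewrite log_der_exp_prod; apply: eq_bigr => i _.
have le_in : (i <= n)%N by rewrite -ltnS.
rewrite le_in; congr (_ * _).
apply: (log_der_uniq _ _ _ (log_der_exp_prod n)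
  (log_der_exp_prod (n - i))) (leqnn (n - i)) => //;
    first by rewrite !exp_prod0.
by move=> j le_j; rewrite le_j (leq_trans le_j) // leq_subr.
Qed.

(** In the expansion of the product, a_k is the exponent of z^k chosen in the
    k-th factor; only the factors with k <= n matter for the coefficient of
    z^n. *)
Lemma exp_prod_coef n : exp_prod n n =
  \sum_(a : {ffun 'I_n -> 'I_n.+1} | (\sum_(i < n) i.+1 * a i == n)%N)
    \prod_(i < n) (t i.+1 ^+ a i / ((a i)`!%:R * i.+1%:R ^+ a i)).
Proof.
rewrite /exp_prod big_add1 /= big_mkord.
pose c (i : 'I_n) (a : 'I_n.+1) : rat := (t i.+1 / i.+1%:R) ^+ a / (a`!)%:R.
pose q (i : 'I_n) : {poly rat} := \sum_(a < n.+1) c i a *: 'X^(i.+1 * a).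
rewrite -(@fps_bigmul_coef _ _ _ q n) => [|i j le_jn]; last first.
  rewrite /q coef_sum /fps_exp; case: ifP => [/dvdnP[m jE]|ndj]; last first.
    rewrite big1 // => a _; rewrite coefZ coefXn; case: eqP => [jE|];
      last first.
      by rewrite mulr0.
    by move: ndj; rewrite jE dvdn_mulr.
  have lt_m : (m < n.+1)%N.
    by rewrite ltnS (leq_trans _ le_jn) // jE leq_pmulr.
  rewrite (bigD1 (Ordinal lt_m)) //= big1 => [|a]; last first.
    rewrite -val_eqE /= coefZ coefXn jE mulnC eqn_pmul2l // eq_sym => /negPf->.
    by rewrite mulr0.
  by rewrite coefZ coefXn jE mulnC eqxx mulr1 addr0 mulKn.
rewrite /q bigA_distr_bigA coef_sum [RHS]big_mkcond; apply: eq_bigr => a _.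
rewrite (eq_bigr (fun i => (c i (a i))%:P * 'X^(i.+1 * a i))); last first.
  by move=> i _; rewrite mul_polyC.
rewrite big_split /= -rmorph_prod prodrXr mul_polyC coefZ coefXn eq_sym.
case: eqP => _; rewrite ?mulr0 // mulr1; apply: eq_bigr => i _.
by rewrite /c expr_div_n -mulrA -invfM; congr (_ / _); rewrite mulrC.
Qed.

End ExpSum.

Section TraceSeries.
Variables (D : nat) (A : 'M[rat]_D).

(** A weight lambda(m) = s x^m depends on m = sum a_k multiplicatively, so it
    can be distributed over the factors, where it replaces t_k by x t_k. *)
Lemma d_coefE (lambda : nat -> rat) (s x : rat) n : (0 < n)%N ->
  (forall m, lambda m = s * x ^+ m) ->
  d_coef A lambda n = s * exp_prod (fun k => x * trace_pow A k) n n.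
Proof.
move=> n0 lamE; rewrite exp_prod_coef /d_coef.
under eq_bigr => m _ do rewrite mulr_sumr big_mkcondr.
rewrite exchange_big mulr_sumr /=; apply: eq_bigr => a /eqP an.
have sum_le : (\sum_(i < n) a i <= n)%N.
  by apply: leq_trans (eq_leq an); apply: leq_sum => i _; apply: leq_pmull.
have sum_gt : (0 < \sum_(i < n) a i)%N.
  rewrite lt0n; apply: contraTneq n0 => s0; rewrite -leqNgt leqn0.
  rewrite -[X in X == _]an; move/eqP: s0; rewrite !sum_nat_eq0 => /forallP s0;
    apply/forallP => i.
  by move: (s0 i) => /= /eqP->; rewrite muln0.
rewrite (bigD1_seq (\sum_(i < n) a i)%N) ?iota_uniq //=; last first.
  by rewrite mem_index_iota sum_gt ltnS sum_le.
rewrite eqxx [X in _ + X]big1 ?addr0 => [|m]; last first.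
  by rewrite eq_sym => /negPf->.
rewrite lamE -mulrA -prodrXr -big_split /=; congr (_ * _).
by apply: eq_bigr => i _; rewrite exprMn mulrA.
Qed.


Local Notation P := (det_poly A).
Local Notation M := (1%:M - 'X *: map_mx (@polyC rat) A).

Lemma coef_det_poly0 : P`_0 = 1.
Proof.
rewrite -horner_coef0 -[LHS]/(horner_eval 0 P) /det_poly -det_map_mx.
rewrite (_ : map_mx _ _ = 1%:M) ?det1 //; apply/matrixP => i j.
by rewrite !mxE /= /horner_eval; case: (i == j); rewrite !hornerE.
Qed.

Lemma size_det_poly : (size P <= D.+1)%N.
Proof.
rewrite /det_poly /determinant; apply: (leq_trans (size_sum _ _ _)).
apply/bigmax_leqP => s _; rewrite mulr_sign; set p := \prod_(i < D) _.
suff le_p : (size p <= D.+1)%N by case: ifP => _; rewrite ?size_polyN.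
apply: (leq_trans (size_poly_prod_leq _ _)).
rewrite leq_subLR card_ord addnS ltnS; apply: (@leq_trans (\sum_(i < D) 2)%N).
  2: by rewrite sum_nat_const card_ord muln2 addnn.
apply: leq_sum => i _; rewrite !mxE (leq_trans (size_polyD _ _)) // geq_max.
rewrite size_polyN (leq_trans (size_polyMleq _ _)); last first.
  by rewrite size_polyX /= size_polyC; case: (_ == _).
by case: (i == s i); rewrite ?mulr1n ?mulr0n ?size_poly1 ?size_poly0.
Qed.

(** Jacobi's formula: differentiating the Leibniz expansion one entry at a time
    leaves the cofactors of I - zA. *)
Lemma deriv_det_poly :
  P^`() = - \tr (map_mx (@polyC rat) A *m \adj M).
Proof.
pose dM i j : {poly rat} := - (A i j)%:P.
have dE i j : (M i j)^`() = dM i j.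
  rewrite !mxE derivB derivM derivX derivC mulr0 addr0 mul1r -polyC_natr.
  by rewrite derivC sub0r.
have prodD (s : 'S_D) : (\prod_(i < D) M i (s i))^`() =
    \sum_(i < D) dM i (s i) * \prod_(k < D | i != k) M k (s k).
  have H (r : seq 'I_D) : uniq r -> (\prod_(i <- r) M i (s i))^`() =
      \sum_(i <- r) dM i (s i) * \prod_(k <- r | i != k) M k (s k).
    elim: r => [|i r IH] /=; first by rewrite !big_nil derivC.
    case/andP=> ir /IH{}IH; rewrite !big_cons derivM dE IH eqxx /=;
      congr (_ + _).
      congr (_ * _); rewrite [RHS]big_seq_cond [LHS]big_seq.
      apply: eq_bigl => k; rewrite andb_idr // => kr.
      by apply: contraNneq ir => ->.
    rewrite big_distrr /= [LHS]big_seq [RHS]big_seq; apply: eq_bigr => k kr.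
    rewrite big_cons ifT; first by rewrite mulrCA.
    by apply: contraNneq ir => <-.
  by apply: H; rewrite index_enum_uniq.
rewrite {1}/det_poly /determinant raddf_sum /=.
transitivity (\sum_(i < D) \sum_(j < D) dM i j * cofactor M i j); last first.
  rewrite /mxtrace -sumrN; apply: eq_bigr => i _; rewrite mxE -sumrN.
  by apply: eq_bigr => j _; rewrite !mxE mulNr.
under [RHS]eq_bigr => i _ do under eq_bigr => j _ do
  rewrite expand_cofactor big_distrr /=.
under [RHS]eq_bigr => i _.
  rewrite (exchange_big_dep predT) //=.
  under eq_bigr => s _ do rewrite (big_pred1 (s i)) //.
  over.
rewrite exchange_big /=; apply: eq_bigr => s _.
rewrite mulr_sign; case: ifP => _.
  rewrite derivN prodD -sumrN; apply: eq_bigr => i _.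
  by rewrite expr1 mulN1r mulrN.
by rewrite prodD; apply: eq_bigr => i _; rewrite expr0 mul1r.
Qed.

(** Newton's identities.  As adj M is the power series (det M) (I - zA)^-1,
    its coefficient at z^n is the sum of the p_k A^(n-k). *)
Lemma log_der_det_poly :
  log_der (pos_part (fun k => (-1) * trace_pow A k)) (fps_of_poly P).
Proof.
(* The adjugate is generalized: rewriting with mxE would otherwise expand its
   entries into cofactors. *)
have [N adjE] : exists N, N = \adj M by exists (\adj M).
pose B n : 'M[rat]_D := \matrix_(i, j) (N i j)`_n.
have BS n : B n = (P`_n)%:M + (if n is m.+1 then B m *m A else 0).
  have H : N - 'X *: (N *m map_mx (@polyC rat) A) = P%:M.
    by rewrite -mul_adj_mx mulmxBr mulmx1 -scalemxAr adjE.
  apply/matrixP => i j; have /matrixP/(_ i j) := H.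
  move/(congr1 (fun p : {poly rat} => p`_n)).
  rewrite !mxE coefD coefN coefMn coefXM => /(canRL (subrK _)) ->.
  congr (_ + _); case: n => [|n] /=; rewrite !mxE // coef_sum.
  by apply: eq_bigr => k _; rewrite !mxE coefMC.
have BE n : B n = \sum_(k < n.+1) P`_k *: A ^+ (n - k).
  elim: n => [|n IH]; rewrite BS; first by rewrite addr0 big_ord1 scalemx1.
  rewrite big_ord_recr /= subnn expr0 scalemx1 addrC IH mulmx_suml.
  congr (_ + _); apply: eq_bigr => k _.
  by rewrite subSn -1?ltnS // exprSr -scalemxAl.
have tr_coef n : (\tr (map_mx (@polyC rat) A *m N))`_n = \tr (A *m B n).
  rewrite /mxtrace coef_sum; apply: eq_bigr => i _; rewrite !mxE coef_sum.
  by apply: eq_bigr => j _; rewrite !mxE coefCM.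
move=> [|n].
  by rewrite mul0r /fps_mul big_ord1 /pos_part mul0r.
rewrite /fps_of_poly mulr_natl -coef_deriv deriv_det_poly -adjE coefN tr_coef
  BE.
have -> : \tr (A *m \sum_(k < n.+1) P`_k *: A ^+ (n - k)) =
    \sum_(k < n.+1) P`_k * trace_pow A (n - k).+1.
  rewrite mulmx_sumr (linear_sum (mxtrace (n := D))); apply: eq_bigr => k _.
  by rewrite -scalemxAr linearZ /= /trace_pow exprS.
rewrite fps_mulC /fps_mul [RHS]big_ord_recr /= subnn mulr0 addr0 -sumrN.
apply: eq_bigr => k _.
by rewrite /pos_part subn_gt0 ltn_ord subSn -1?ltnS // mulN1r mulrN.
Qed.

Lemma det_poly_exp n :
  P`_n = exp_prod (fun k => (-1) * trace_pow A k) n n.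
Proof.
apply: (log_der_uniq _ _ _ log_der_det_poly
  (log_der_exp_diag (fun k => (-1) * trace_pow A k)) _ (leqnn n)) => //.
by rewrite exp_prod0 /fps_of_poly coef_det_poly0.
Qed.

Lemma d_plus_coef n : (0 < n)%N -> d_plus A n = - P`_n.
Proof.
move=> n0; rewrite det_poly_exp /d_plus (d_coefE (s := -1) (x :=
  -1) n0) ?mulN1r //.
by move=> m; rewrite exprS.
Qed.

Lemma det_polyE : P = 1 - \sum_(1 <= N < D.+1) d_plus A N *: 'X^N.
Proof.

apply/polyP => n; rewrite [RHS]coefB coef1 [in RHS]coef_sum.
case: (posnP n) => [->|n0].
  rewrite coef_det_poly0 big_nat_cond big1 ?subr0 // => N; rewrite andbT.
  by case/andP=> N0 _; rewrite coefZ coefXn eq_sym gtn_eqF // mulr0.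
rewrite sub0r; case: (ltnP n D.+1) => [lt_nD|le_Dn]; last first.
  rewrite nth_default ?(leq_trans size_det_poly) // big_nat_cond big1 ?oppr0 //.
  move=> N; rewrite andbT => /andP[_ lt_ND]; rewrite coefZ coefXn.
  by rewrite gtn_eqF ?mulr0 // (leq_trans lt_ND).
rewrite (bigD1_seq n) ?mem_index_iota ?iota_uniq ?n0 //= big1 => [|N neN].
  by rewrite addr0 coefZ coefXn eqxx mulr1 d_plus_coef // opprK.
by rewrite coefZ coefXn eq_sym (negPf neN) mulr0.
Qed.

Lemma log_der_zeta : log_der (pos_part (trace_pow A)) (zeta_fps A).
Proof.
suff -> : zeta_fps A = fun n => exp_prod (trace_pow A) n n.
  exact: log_der_exp_diag.
symmetry; apply: fps_inv_uniq.
  by rewrite /fps_of_poly coef_det_poly0 oner_neq0.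
have d1 := log_der_mul log_der_det_poly (log_der_exp_diag (trace_pow A)).
apply: functional_extensionality => n.
apply: (log_der_uniq _ _ _ d1 log_der_one _ (leqnn n)) => //.
  by rewrite /fps_mul big_ord1 /fps_of_poly coef_det_poly0 exp_prod0 mul1r.
by move=> [|m] _ //; rewrite /pos_part /= mulN1r addNr.
Qed.

Lemma zeta_fps0 : zeta_fps A 0%N = 1.
Proof. by rewrite /zeta_fps /fps_inv /= big_ord0 subr0 mulr1 /fps_of_poly
  coef_det_poly0 invr1. Qed.

Lemma zeta_fps_d_minus n :
  zeta_fps A n = if n == 0%N then 1 else d_minus A n.
Proof.
case: posnP => [->|n0]; first exact: zeta_fps0.
rewrite /d_minus (d_coefE (s := 1) (x := 1) n0) => [|m]; last first.
  by rewrite expr1n mulr1.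
rewrite mul1r (_ : (fun k => 1 * _) = trace_pow A); last first.
  by apply: functional_extensionality => k; rewrite mul1r.
apply: (log_der_uniq _ _ _ log_der_zeta (log_der_exp_diag (trace_pow A)) _
  (leqnn n)) => //.
by rewrite exp_prod0 zeta_fps0.
Qed.

(** The defining recursion of the inverse of 1 - sum d_+(N) z^N. *)
Lemma zeta_fps_rec n : (0 < n)%N ->
  zeta_fps A n = \sum_(i < D | (i.+1 <= n)%N) d_plus A i.+1 * zeta_fps A (n -
    i.+1)%N.
Proof.
move=> n0; have P0 : fps_of_poly P 0%N != 0.
  by rewrite /fps_of_poly coef_det_poly0 oner_neq0.
have := fps_mulV P0 n; rewrite /fps_one gtn_eqF // /fps_mul big_ord_recl.
rewrite {1}/fps_of_poly coef_det_poly0 mul1r subn0 -/(zeta_fps A).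
move/(canRL (addrK _)); rewrite sub0r -sumrN => ->.
transitivity (\sum_(0 <= i < n) d_plus A i.+1 * zeta_fps A (n - i.+1)%N).
  rewrite big_mkord; apply: eq_bigr => i _.
  by rewrite lift0 d_plus_coef // -mulNr.
rewrite -(big_mkord (fun i => (i.+1 <= n)%N)
  (fun i => d_plus A i.+1 * zeta_fps A (n - i.+1)%N)).
have dD i : (D <= i)%N -> d_plus A i.+1 = 0.
  move=> le_Di; rewrite d_plus_coef // nth_default ?oppr0 //.
  exact: leq_trans size_det_poly _.
rewrite [LHS](@big_nat_widen _ _ _ _ _ (maxn n D)) ?leq_maxl //=.
rewrite [RHS](@big_nat_widen _ _ _ _ _ (maxn n D)) ?leq_maxr //=.
rewrite [LHS]big_mkcond [RHS]big_mkcond; apply: eq_bigr => i _.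
case: (ltnP i n) => //= _; case: ltnP => //= le_Di.
by rewrite dD // mul0r.
Qed.

End TraceSeries.

(** * Moebius inversion *)

Lemma mobius_mul_prime p g : prime p -> (0 < g)%N -> ~~ (p %| g)%N ->
  mobius (p * g) = - mobius g.
Proof.
move=> pp g0 pg; have p0 := prime_gt0 pp.
have pNg : p \notin primes g by rewrite mem_primes pp g0.
have pm : perm_eq (primes (p * g)) (p :: primes g).
  apply: uniq_perm; rewrite /= ?primes_uniq ?pNg // => q.
  by rewrite primesM // primes_prime // !inE.
rewrite /mobius (perm_size pm) (perm_all _ pm) /= lognM // logn_prime // eqxx.
rewrite lognE (negPf pg) !andbF addn0 eqxx /=.
rewrite (@eq_in_all _ _ (fun q => logn q g == 1%N)) => [|q qg]; last first.
  rewrite lognM // logn_prime // (_ : (q == p) = false) //.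
  by apply: contraNF pNg => /eqP<-.
by case: ifP => _; rewrite ?oppr0 // exprS mulN1r.
Qed.

Lemma mobius_mul_prime0 p g : prime p -> (0 < g)%N -> (p %| g)%N ->
  mobius (p * g) = 0.
Proof.
move=> pp g0 pg; have p0 := prime_gt0 pp.
rewrite /mobius ifF //; apply/negP => /allP/(_ p).
rewrite primesM // primes_prime // !inE eqxx lognM // logn_prime // eqxx.
move/(_ isT); rewrite add1n eqSS => /eqP lg.
by have := pg; rewrite -[p]expn1 pfactor_dvdn // lg.
Qed.

(** For a prime p dividing n = p m, the divisors g of m prime to p cancel
    against the divisors p g, and the remaining ones are not squarefree. *)
Lemma sum_mobius n : (0 < n)%N -> \sum_(g <- divisors n) mobius g =
  (n == 1%N)%:R.
Proof.
move=> n0; case: eqP => [->|/eqP n1].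
  by rewrite (_ : divisors 1 = [:: 1%N]) // big_seq1.
have pp : prime (pdiv n) by rewrite pdiv_prime // ltn_neqAle eq_sym n1.
move: (pdiv n) (pdiv_dvd n) pp => p /dvdnP[m nE] pp; rewrite {n1}mulnC in nE.
have p0 := prime_gt0 pp.
have m0 : (0 < m)%N by move: n0; rewrite nE muln_gt0 => /andP[].
rewrite (bigID (fun g => p %| g)%N) /=.
have Pdiv : perm_eq [seq g <- divisors n | (p %| g)%N] [seq (p * h)%N | h <-
  divisors m].
  apply: uniq_perm; rewrite ?filter_uniq ?divisors_uniq //.
    by rewrite map_inj_uniq ?divisors_uniq // => x y /eqP;
      rewrite eqn_pmul2l // => /eqP.
  move=> g; rewrite mem_filter -dvdn_divisors //; apply/andP/mapP => [[pg gn]|].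
    case/dvdnP: pg gn => h ->; rewrite mulnC nE dvdn_pmul2l // => hm.
    by exists h; rewrite // -dvdn_divisors.
  by case=> h; rewrite -dvdn_divisors // => hm ->;
    rewrite dvdn_mulr // nE dvdn_pmul2l.
have Ndiv : perm_eq [seq g <- divisors n | ~~ (p %| g)%N] [seq h <- divisors m |
  ~~ (p %| h)%N].
  apply: uniq_perm; rewrite ?filter_uniq ?divisors_uniq // => g.
  rewrite !mem_filter -!dvdn_divisors //; case: (boolP (p %| g)%N) => //= pg.
  by rewrite nE Gauss_dvdr // coprime_sym prime_coprime.
rewrite -[X in X + _]big_filter (perm_big _ Pdiv) big_map.
rewrite -[X in _ + X]big_filter (perm_big _ Ndiv) big_filter.
rewrite (bigID (fun g => p %| g)%N) /= [X in X + _ + _]big_seq_cond big1 =>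
  [|h]; last first.
  rewrite -dvdn_divisors // => /andP[hm ph].
  by rewrite mobius_mul_prime0 // (dvdn_gt0 m0).
rewrite add0r big_seq_cond [X in _ + X]big_seq_cond -big_split big1 //= => h.
rewrite -dvdn_divisors // => /andP[hm ph].
by rewrite mobius_mul_prime ?addNr // (dvdn_gt0 m0).
Qed.

(** Both sides sum F g e over the pairs with g e | n. *)
Lemma sum_divisors_pair (R : nmodType) (F : nat -> nat -> R) n : (0 < n)%N ->
  \sum_(d <- divisors n) \sum_(g <- divisors d) F g (d %/ g)%N =
  \sum_(e <- divisors n) \sum_(g <- divisors (n %/ e)%N) F g e.
Proof.
move=> n0.
pose s1 := [seq (g, d %/ g)%N | d <- divisors n, g <- divisors d].
pose s2 := [seq (g, e) | e <- divisors n, g <- divisors (n %/ e)%N].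
transitivity (\sum_(u <- s1) F u.1 u.2); first by rewrite big_allpairs_dep.
transitivity (\sum_(u <- s2) F u.1 u.2); last by rewrite big_allpairs_dep.
have dn0 d : d \in divisors n -> (0 < d)%N.
  by rewrite -dvdn_divisors // => /dvdn_gt0; apply.
apply: perm_big; apply: uniq_perm.
- apply: allpairs_uniq_dep => [|d _|]; rewrite ?divisors_uniq //.
  move=> [d g] [d' g'] /allpairsPdep[u [v [un vu ]]] [-> ->].
  move=> /allpairsPdep[u' [v' [un' vu' ]]] [-> ->] /= [vv].
  rewrite -{}vv in vu' *; move: vu vu'; rewrite -!dvdn_divisors ?dn0 // =>
    vu vu'.
  by move=> /(congr1 (muln v)); rewrite !(mulnC v) !divnK // => ->.
- apply: allpairs_uniq_dep => [|d _|]; rewrite ?divisors_uniq //.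
  by move=> [d g] [d' g'] _ _ /= [-> ->].
move=> [g e]; apply/allpairsPdep/allpairsPdep.
  move=> [d [h [dn hd [-> ->]]]]; have d0 := dn0 _ dn.
  move: dn hd; rewrite -!dvdn_divisors // => dn hd; exists (d %/ h)%N, h.
  have dh_n : (d %/ h %| n)%N by apply: dvdn_trans dn; apply: dvdn_div.
  have dh0 : (0 < d %/ h)%N by rewrite (dvdn_gt0 n0).
  have ndh0 : (0 < n %/ (d %/ h))%N by rewrite divn_gt0 // dvdn_leq.
  split=> //; rewrite -dvdn_divisors //.
  by rewrite dvdn_divRL // mulnC divnK.
move=> [e' [h [en hd [-> ->]]]]; have e0 := dn0 _ en.
move: en; rewrite -dvdn_divisors // => en.
have ne0 : (0 < n %/ e')%N by rewrite divn_gt0 // dvdn_leq.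
move: hd; rewrite -dvdn_divisors // dvdn_divRL // => hen.
have h0 : (0 < h)%N by have := dvdn_gt0 n0 hen; rewrite muln_gt0 => /andP[].
have he0 : (0 < h * e')%N by rewrite muln_gt0 h0.
exists (h * e')%N, h; split; rewrite -?dvdn_divisors // ?mulKn //.
exact: dvdn_mulr.
Qed.

Section CycleNumber.
Variables (D : nat) (A : 'M[rat]_D).

Lemma sum_cycle_number n : (0 < n)%N ->
  \sum_(d <- divisors n) d%:R * cycle_number A d = trace_pow A n.
Proof.
move=> n0.
transitivity (\sum_(d <- divisors n) \sum_(g <- divisors d)
   mobius g * trace_pow A (d %/ g)%N).
  rewrite big_seq [RHS]big_seq; apply: eq_bigr => d.
  rewrite -dvdn_divisors // => /(dvdn_gt0 n0) d0.
  by rewrite /cycle_number mulrA divff ?mul1r // pnatr_eq0 -lt0n.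
rewrite (sum_divisors_pair (fun g e => mobius g * trace_pow A e)) //.
rewrite (bigD1_seq n) ?divisors_uniq ?divisors_id //= divnn n0.
rewrite (_ : divisors 1 = [:: 1%N]) // big_seq1 (_ : mobius 1 = 1) // mul1r.
rewrite big_seq_cond big1 ?addr0 // => e; rewrite -dvdn_divisors // =>
  /andP[en ne].
have e0 := dvdn_gt0 n0 en; have ne0 : (0 < n %/ e)%N by rewrite divn_gt0 //
  dvdn_leq.
rewrite -mulr_suml sum_mobius //; case: eqP => [ne1|_]; last by rewrite mul0r.
by move: ne; rewrite -{1}(divnK en) ne1 mul1n eqxx.
Qed.

(** By induction along the divisors of N: in the relation for n the unknown c n
    has the nonzero coefficient n. *)
Lemma cycle_number_uniq (c : nat -> rat) N : (0 < N)%N ->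
  (forall n, (n %| N)%N ->
     \sum_(d <- divisors n) d%:R * c d = trace_pow A n) ->
  c N = cycle_number A N.
Proof.
move=> N0 cE; suff: forall n, (n %| N)%N -> c n = cycle_number A n by apply.
elim/ltn_ind=> n IH nN; have n0 := dvdn_gt0 N0 nN.
have := cE n nN; rewrite -sum_cycle_number //.
rewrite (bigD1_seq n) ?divisors_id ?divisors_uniq //=.
rewrite [RHS](bigD1_seq n) ?divisors_id ?divisors_uniq //=.
have nz : n%:R != 0 :> rat by rewrite pnatr_eq0 -lt0n.
suff -> : \sum_(d <- divisors n | d != n) d%:R * c d =
  \sum_(d <- divisors n | d != n) d%:R * cycle_number A d.
  by move/addIr/(mulfI nz).
rewrite big_seq_cond [RHS]big_seq_cond; apply: eq_bigr => d.
rewrite -dvdn_divisors // => /andP[dn ne].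
by rewrite IH ?(dvdn_trans dn) // ltn_neqAle ne dvdn_leq.
Qed.

(** The logarithmic derivative of the product up to M is, in degree n <= M,
    minus the sum of the d C(d) over the divisors d of n, that is -Tr A^n. *)
Lemma generalized_witt_identity :
  fps_infprod (fun N => one_minus_pow N (cycle_number A N))
    (fps_of_poly (det_poly A)).
Proof.
move=> n; exists n => M le_nM; rewrite big_nat.
have lp := @log_der_big _ (index_iota 1 M.+1) (fun N => (1 <= N < M.+1)%N)
  (fun N => geom N (- (cycle_number A N * N%:R)))
  (fun N => one_minus_pow N (cycle_number A N)).
have {}lp := lp (fun N N0 => log_der_one_minus_pow _ (proj1 (andP N0))).
apply: (log_der_uniq _ _ _ lp (log_der_det_poly A) _ le_nM) => //=.
- by rewrite big1 // => N _; rewrite /geom.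
- rewrite fps_bigmul0 /fps_of_poly coef_det_poly0 big1 // => N _.
  rewrite /one_minus_pow dvdn0 div0n expr0 mul1r /gen_binomial big_ord0.
  by rewrite fact0 divr1.
move=> m le_mM; rewrite -big_nat /pos_part; case: posnP => [->|m0].
  by rewrite big1 // => N _; rewrite /geom.
rewrite -sum_cycle_number // mulN1r -sumrN.
under eq_bigr => N _ do rewrite /geom m0 /=.
rewrite -big_mkcond /= -big_filter [LHS](perm_big (divisors m)) /=.
  by apply: eq_bigr => N _; rewrite mulrC.
apply: uniq_perm; rewrite ?filter_uniq ?iota_uniq ?divisors_uniq // => d.
rewrite mem_filter mem_index_iota -dvdn_divisors // andb_idr // => dm.
by rewrite (dvdn_gt0 m0) // ltnS (leq_trans _ le_mM) // dvdn_leq.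
Qed.

End CycleNumber.

(** * Counting cycles *)

Section ClosedWalks.
Variables (E : finType) (R : rel E).

Lemma sum_tupleS (S : nmodType) n (F : n.+1.-tuple E -> S) :
  \sum_(p : n.+1.-tuple E) F p = \sum_x \sum_(q :
    n.-tuple E) F [tuple of x :: q].
Proof.
rewrite pair_big /=; rewrite (reindex (fun u : E * n.-tuple E =>
  [tuple of u.1 :: u.2])) //=.
exists (fun p : n.+1.-tuple E => (thead p, [tuple of behead p])) =>
  [[x q] _|p _] /=.
  by rewrite theadE; congr (_, _); apply: val_inj.
by rewrite -tuple_eta.
Qed.

Definition rel_matrix : 'M[rat]_#|E| :=
  \matrix_(i, j) (R (enum_val i) (enum_val j))%:R.

Lemma rel_matrix_exp n i j : (rel_matrix ^+ n) i j =
  \sum_(p : n.-tuple E)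
    (path R (enum_val i) p && (last (enum_val i) p == enum_val j))%:R.
Proof.
elim: n i => [|n IH] i.
  rewrite expr0 mxE (bigD1 [tuple]) //= big1 ?addr0 => [|p];
    last by rewrite tuple0.
  by rewrite (inj_eq enum_val_inj).
rewrite exprS mxE sum_tupleS.
rewrite [RHS](eq_bigl (fun x => x \in E)) // [RHS]big_enum_val;
  apply: eq_bigr => k _.
rewrite mxE IH mulr_sumr; apply: eq_bigr => p _ /=.
by rewrite -natrM mulnb andbA.
Qed.

Lemma trace_rel_matrix n : (0 < n)%N ->
  trace_pow rel_matrix n = #|[set p : n.-tuple E | cycle R p]|%:R.
Proof.
case: n => // n _; rewrite /trace_pow /mxtrace.
under eq_bigr => i _ do rewrite rel_matrix_exp.
rewrite exchange_big -sum1_card natr_sum [RHS]big_mkcond /=.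
apply: eq_bigr => p _; rewrite inE.
rewrite -(big_enum_val (fun x => (path R x p && (last x p == x))%:R)) /=.
have lastE x : last x p = last (thead p) p by case/tupleP: p => y q.
rewrite (bigD1 (last (thead p) p)) //= big1 => [|x nx]; last first.
  by rewrite lastE eq_sym (negPf nx) andbF.
by rewrite (lastE (last _ _)) eqxx andbT addr0 (cycle_path (thead p));
  case: ifP.
Qed.

Lemma cycle_flatten_nseq r (q : seq E) :
  cycle R (flatten (nseq r.+1 q)) = cycle R q.
Proof.
case: q => [|x q]; first by rewrite (_ : flatten _ = [::]) //; elim: r.
set p := x :: q; have last_p y : last y p = last x p by [].
have fS n : flatten (nseq n.+1 p) = p ++ flatten (nseq n p) by [].
have last_f y n : last y (flatten (nseq n.+1 p)) = last x p.
  by elim: n y => [|n IH] y; rewrite fS last_cat ?IH // cats0.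
rewrite !(cycle_path x) last_f; elim: r => [|r IH].
  by rewrite fS cats0.
by rewrite fS cat_path last_p IH andbb.
Qed.

End ClosedWalks.

(** Commuting words are powers of a common word; here q itself can be peeled off
    from the left. *)
Lemma commute_cat_nseq (T : eqType) (q s : seq T) r :
  size s = (r * size q)%N -> q ++ s = s ++ q -> s = flatten (nseq r q).
Proof.
elim: r s => [|r IH] s; first by rewrite mul0n => /size0nil.
rewrite mulSn => sz com; have le_qs : (size q <= size s)%N by rewrite sz
  leq_addr.
have tq : take (size q) s = q.
  by rewrite -(takel_cat q le_qs) -com take_size_cat.
have sE : s = q ++ drop (size q) s by rewrite -{1}(cat_take_drop (size q) s) tq.
rewrite sE /=; congr (_ ++ _); apply: IH.
  by rewrite size_drop sz addKn.
by move: com; rewrite {1 2}sE -!catA => /eqP; rewrite eqseq_cat // eqxx => /eqP.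
Qed.

Lemma rot_fix_commute (T : eqType) (s : seq T) e :
  rot e s = s -> take e s ++ s = s ++ take e s.
Proof.
move=> fixs; have sE : s = drop e s ++ take e s by rewrite -{1}fixs.
by rewrite {2}sE catA cat_take_drop.
Qed.

Lemma rot_flatten_nseq (T : eqType) (q : seq T) r :
  rot (size q) (flatten (nseq r q)) = flatten (nseq r q).
Proof.
case: r => [|r] //=; rewrite rot_size_cat.
by elim: r => [|r IH] /=; rewrite ?cats0 // -catA IH.
Qed.

Lemma size_flatten_nseq (T : eqType) (q : seq T) r :
  size (flatten (nseq r q)) = (r * size q)%N.
Proof. by elim: r => //= r IH; rewrite size_cat IH. Qed.

Section Necklaces.
Variables (k : matrix_kind) (G : multigraph).
Local Notation E := (oedge k G).

Definition follows : rel E := fun x y => feeds x y && ~~ is_inverse x y.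

(** The absence of a tail is the non-backtracking condition at the base
    point, so being a cycle is one condition on cyclically consecutive edges. *)
Lemma is_cycleE (p : seq E) : is_cycle p = cycle follows p.
Proof.
case: p => [|x p]; rewrite /is_cycle /closed_path /non_backtracking /=;
  first by [].
rewrite (path_relI (@feeds k G) (fun x y => ~~ is_inverse x y)).
by rewrite [in RHS](rcons_path (fun x y => ~~ is_inverse x y)).
Qed.

Section Length.
Variables (N : nat) (N0 : (0 < N)%N).
Local Notation X := (N.-tuple E).

Definition shift (p : X) : X := [tuple of rot 1 p].

Lemma shift_inj : injective shift.
Proof. by move=> p q /(congr1 val) /= /rot_inj/val_inj. Qed.

Lemma iter_shift i (p : X) : (i <= N)%N -> val (iter i shift p) = rot i p.
Proof.
elim: i => [|i IH] le_iN; first by rewrite rot0.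
by rewrite iterS /= IH ?(ltnW le_iN) // -rotS ?size_tuple.
Qed.

Lemma iter_shift_fix i (p : X) : (iter i shift p == p) = (order shift p %| i)%N.
Proof.
have io := iter_order shift_inj p; set d := order shift p in io *.
have d0 : (0 < d)%N by rewrite /d -orderSpred.
have iterM j : iter (j * d) shift p = p.
  by elim: j => //= j IH; rewrite mulSn iterD IH.
rewrite {1}(divn_eq i d) addnC iterD iterM /dvdn.
have lt_d : (i %% d < order shift p)%N by rewrite ltn_mod.
apply/eqP/eqP => [fixp|->] //; move: (findex_iter lt_d).
by rewrite fixp findex0.
Qed.

Lemma order_shift_dvd (p : X) : (order shift p %| N)%N.
Proof.
rewrite -iter_shift_fix; apply/eqP/val_inj.
by rewrite iter_shift // -{1}(size_tuple p) rot_size.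
Qed.

Lemma circular_equivE (p q : X) : circular_equiv p q = fconnect shift p q.
Proof.
apply/existsP/idP => [[i /eqP qE]|pq].
  suff -> : q = iter i shift p by apply: fconnect_iter.
  by apply: val_inj; rewrite iter_shift // ltnW.
have lt_iN : (findex shift p q < N)%N.
  apply: (leq_trans (findex_max pq)); apply: dvdn_leq => //.
  exact: order_shift_dvd.
by exists (Ordinal lt_iN); rewrite -iter_shift ?(ltnW lt_iN) //= iter_findex.
Qed.

Definition cycles : {set X} := [set p : X | is_cycle p].

Lemma cycles_shift (p q : X) : fconnect shift p q ->
  (p \in cycles) = (q \in cycles).
Proof.
rewrite -circular_equivE => /existsP[i /eqP qE].
by rewrite !inE !is_cycleE qE rot_cycle.
Qed.

Lemma order_shift_connect (p q : X) :
  fconnect shift p q -> order shift p = order shift q.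
Proof.
move=> pq; apply: eq_card => x.
by rewrite !inE; apply: same_connect; rewrite ?pq //;
  apply: fconnect_sym shift_inj.
Qed.

(** A cycle fixed by the rotation by e | N is determined by its first e edges,
    which form a cycle. *)
Lemma card_cycles_fix e : (e %| N)%N ->
  #|[set p in cycles | (order shift p %| e)%N]| =
  #|[set q : e.-tuple E | cycle follows q]|.
Proof.
move=> eN; have e0 := dvdn_gt0 N0 eN; have le_eN := dvdn_leq N0 eN.
have [r rE] : exists r, (N %/ e = r.+1)%N.
  by exists (N %/ e).-1; rewrite prednK // divn_gt0.
have sz (q : e.-tuple E) : size (flatten (nseq (N %/ e) (tval q))) == N.
  by rewrite size_flatten_nseq size_tuple divnK.
pose rep q : X := Tuple (sz q).
have rep_inj : injective rep.
  move=> q q' /(congr1 val) /=; rewrite rE /= => /eqP.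
  by rewrite eqseq_cat ?size_tuple // => /andP[/eqP/val_inj].
rewrite -(card_imset _ rep_inj); apply: eq_card => p; rewrite !inE.
rewrite -iter_shift_fix is_cycleE; apply/andP/imsetP => [[cp]|[q qc ->]].
  rewrite -val_eqE /= iter_shift // => /eqP fixp.
  have szq : size (take e p) == e by rewrite size_takel // size_tuple.
  pose q := Tuple szq.
  have pE : val p = flatten (nseq (N %/ e) (take e p)).
    apply: commute_cat_nseq.
      by rewrite size_tuple (eqP szq) divnK.
    exact: rot_fix_commute.
  exists q; last by apply: val_inj.
  by rewrite inE -(cycle_flatten_nseq _ r) -rE -pE.
move: qc; rewrite inE => qc; split; first by rewrite /= rE cycle_flatten_nseq.
rewrite -val_eqE /= iter_shift //= -{1}(size_tuple q).
by rewrite rot_flatten_nseq.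
Qed.

(** A power of q is fixed by the rotation by the length of q; conversely, if the
    rotations of p have period d then p is a power of its first d edges. *)
Lemma nonperiodicE :
  nonperiodic_cycles k G N = [set p in cycles | order shift p == N].
Proof.
apply/setP => p; rewrite !inE; case cp: (is_cycle p) => //=.
have szp := size_tuple p; apply/idP/idP => [|/eqP oN].
  apply: contraNT => ne; have dN := order_shift_dvd p.
  set d := order shift p in ne dN.
  have lt_dN : (d < N)%N by rewrite ltn_neqAle ne dvdn_leq.
  have d0 := dvdn_gt0 N0 dN.
  have szq : size (take d p) == d by rewrite size_takel // szp ltnW.
  have lt_r : (N %/ d < N.+1)%N by rewrite ltnS leq_div.
  have r1 : (1 < N %/ d)%N.
    by rewrite -(ltn_pmul2r d0) mul1n divnK.
  have fixp : rot d p = p.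
    by rewrite -iter_shift ?(ltnW lt_dN) //; congr val; apply/eqP;
      rewrite iter_shift_fix.
  have pE : val p = flatten (nseq (N %/ d) (take d p)).
    apply: commute_cat_nseq; first by rewrite szp (eqP szq) divnK.
    exact: rot_fix_commute.
  apply/existsP; exists (Ordinal lt_dN); apply/existsP; exists (Tuple szq).
  apply/existsP; exists (Ordinal lt_r); rewrite r1 -pE eqxx andbT /=.
  move: cp; rewrite !is_cycleE {1}pE; case: (N %/ d)%N r1 => // r _.
  by rewrite cycle_flatten_nseq.
apply/negP => /existsP[d /existsP[q /existsP[r /and3P[r1 cq /eqP pE]]]].
have d0 : (0 < d)%N.
  rewrite lt0n; apply: contraTneq N0 => d0; rewrite -{1}szp pE.
  by rewrite size_flatten_nseq size_tuple d0 muln0.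
have : (order shift p %| d)%N.
  rewrite -iter_shift_fix -val_eqE /= iter_shift ?(ltnW (ltn_ord d)) //.
  by rewrite pE -{1}(size_tuple q) rot_flatten_nseq.
by rewrite oN => /(dvdn_leq d0); rewrite leqNgt ltn_ord.
Qed.

(** A nonperiodic cycle has N distinct rotations. *)
Lemma card_cycle_classes :
  #|nonperiodic_cycles k G N| = (#|cycle_classes k G N| * N)%N.
Proof.
have eqv : {in nonperiodic_cycles k G N & &, equivalence_rel (@circular_equiv k
  G N)}.
  move=> p q r _ _ _; rewrite !circular_equivE connect0; split=> // pq.
  by apply: same_connect; rewrite ?pq //; apply: fconnect_sym shift_inj.
apply: card_uniform_partition (equivalence_partitionP eqv) => B.
case/imsetP=> p; rewrite nonperiodicE inE => /andP[cp /eqP oN] ->.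
rewrite -[RHS]oN; apply: eq_card => q; rewrite !inE circular_equivE.
case pq: (fconnect shift p q); rewrite ?andbF // andbT.
move: cp; rewrite (cycles_shift pq) inE => ->.
by rewrite -(order_shift_connect pq) oN eqxx.
Qed.

End Length.

End Necklaces.

(** The matrix A_d is a product SE of incidence matrices, and T_d is ES. *)
Lemma trace_pow_swap (m n : nat) (S : 'M[rat]_(m, n)) (T : 'M[rat]_(n, m)) r :
  (0 < r)%N -> trace_pow (S *m T) r = trace_pow (T *m S) r.
Proof.
case: r => // r _; rewrite /trace_pow.
have -> : (S *m T) ^+ r.+1 = S *m ((T *m S) ^+ r *m T).
  elim: r => [|r IH]; first by rewrite expr1 expr0 (mul1mx T).
  by rewrite exprS IH [in RHS]exprS -!mulmxE -!mulmxA.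
by rewrite mxtrace_mulC -mulmxA exprSr.
Qed.

Lemma trace_graph_matrix k G n : (0 < n)%N ->
  trace_pow (graph_matrix k G) n = #|[set p : n.-tuple (oedge k G)
    | is_cycle p]|%:R.
Proof.
move=> n0.
have -> : [set p : n.-tuple (oedge k G) | is_cycle p] =
    [set p : n.-tuple (oedge k G) | cycle (@follows k G) p].
  by apply/setP => p; rewrite !inE is_cycleE.
rewrite -trace_rel_matrix //; case: k.
- have -> : graph_matrix MatT G = rel_matrix (@follows MatT G).
    by apply/matrixP => i j; rewrite !mxE.
  by [].
- pose S : 'M[rat]_(#|vertex G|, #|edge G|) :=
    \matrix_(v, e) (source (enum_val e) == enum_val v)%:R.
  pose T : 'M[rat]_(#|edge G|, #|vertex G|) :=
    \matrix_(e, v) (target (enum_val e) == enum_val v)%:R.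
  have -> : graph_matrix MatAd G = S *m T.
    apply/matrixP => x y; rewrite !mxE.
    rewrite -sum1_card natr_sum big_mkcond /=.
    rewrite [LHS](eq_bigl (fun e => e \in edge G)) // [LHS]big_enum_val.
    apply: eq_bigr => e _; rewrite !mxE inE -natrM mulnb.
    by case: ifP.
  rewrite trace_pow_swap //; have -> // : T *m S =
    rel_matrix (@follows MatAd G).
  apply/matrixP => e f.
  rewrite !mxE /follows /feeds andbT /=.
  rewrite (bigD1 (enum_rank (target (enum_val e))))
    //= !mxE enum_rankK eqxx mul1r.
  rewrite big1 ?addr0 1?eq_sym // => v ne; rewrite !mxE.
  case: eqP => [te|_]; last by rewrite mul0r.
  by rewrite te enum_valK eqxx in ne.
- have -> // : graph_matrix MatTd G = rel_matrix (@follows MatTd G).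
  by apply/matrixP => i j; rewrite !mxE /follows andbT.
Qed.

(** For n | N, the trace of the n-th power counts the cycles of length N which
    are fixed by the rotation by n; they are sorted by their period. *)
Lemma card_cycle_classesE k G N : (0 < N)%N ->
  #|cycle_classes k G N|%:R = cycle_number (graph_matrix k G) N.
Proof.
move=> N0; pose P d := #|[set p in cycles k G N | order (@shift k G N) p == d]|.
rewrite -(@cycle_number_uniq _ _ (fun d => d%:R^-1 * (P d)%:R) N) //.
  rewrite /P -nonperiodicE // card_cycle_classes // natrM mulrCA mulVf ?mulr1
    //.
  by rewrite pnatr_eq0 -lt0n.
move=> n nN; have n0 := dvdn_gt0 N0 nN.
rewrite trace_graph_matrix // (_ : [set p : n.-tuple (oedge k G) | is_cycle p] =
  [set p : n.-tuple (oedge k G) | cycle (@follows k G) p]); last first.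
  by apply/setP => p; rewrite !inE is_cycleE.
rewrite -(@card_cycles_fix k G N) //.
transitivity (\sum_(d <- divisors n) (P d)%:R : rat).
  rewrite big_seq [RHS]big_seq; apply: eq_bigr => d;
    rewrite -dvdn_divisors // => dn.
  by rewrite mulrA divff ?mul1r // pnatr_eq0 -lt0n (dvdn_gt0 n0).
rewrite -natr_sum; congr _%:R.
under eq_bigr => d _ do rewrite /P -sum1_card.
rewrite -[RHS]sum1_card.
under eq_bigr => d _ do under eq_bigl => p do rewrite inE.
under eq_bigr => d _ do rewrite big_mkcondr /=.
rewrite exchange_big /= [RHS](eq_bigl _ _ (fun p => in_set _ p)) big_mkcondr /=.
apply: eq_bigr => p _; case: ifP => [on|].
  rewrite (bigD1_seq (order (@shift k G N) p)) ?divisors_uniq //=; last first.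
    by rewrite -dvdn_divisors.
  by rewrite eqxx big1 ?addn0 // => d; rewrite eq_sym => /negPf->.
rewrite dvdn_divisors // => nd; rewrite big_seq big1 // => d dn.
by case: eqP => // oE; rewrite oE dn in nd.
Qed.

(** * Words in graded letters *)

Section Words.
Variables (I : finType) (deg : I -> nat) (par : I -> bool).

Definition wdeg (w : seq I) : nat := \sum_(a <- w) deg a.
Definition wpar (w : seq I) : bool := \big[addb/false]_(a <- w) par a.

Lemma wdeg_cons a w : wdeg (a :: w) = (deg a + wdeg w)%N.
Proof. exact: big_cons. Qed.

Lemma wdeg_cat u w : wdeg (u ++ w) = (wdeg u + wdeg w)%N.
Proof. exact: big_cat. Qed.

Lemma wpar_cons a w : wpar (a :: w) = par a (+) wpar w.
Proof. exact: big_cons. Qed.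

Lemma wpar_cat u w : wpar (u ++ w) = wpar u (+) wpar w.
Proof. exact: big_cat. Qed.

Lemma wdeg_nil : wdeg [::] = 0%N. Proof. exact: big_nil. Qed.
Lemma wpar_nil : wpar [::] = false. Proof. exact: big_nil. Qed.

(** The finitely many words of degree n: when letters have positive degree,
    such a word has at most n letters. *)
Definition words (n : nat) : seq (seq I) :=
  [seq val s | s <- [seq s <- enum {: n.-bseq I} | wdeg (val s) == n]].

Definition pwords (n : nat) (p : bool) : seq (seq I) :=
  [seq w <- words n | wpar w == p].

Hypothesis deg_gt0 : forall a, (0 < deg a)%N.

Lemma size_le_wdeg w : (size w <= wdeg w)%N.
Proof.
by rewrite -sum1_size; apply: leq_sum => a _; apply: deg_gt0.
Qed.

Lemma mem_words n w : (w \in words n) = (wdeg w == n).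
Proof.
apply/mapP/eqP => [[s]|wn]; first by rewrite mem_filter => /andP[/eqP sn _] ->.
have sz : (size w <= n)%N by rewrite -wn size_le_wdeg.
by exists (Bseq sz); rewrite // mem_filter mem_enum andbT /= wn.
Qed.

Lemma uniq_words n : uniq (words n).
Proof.
rewrite map_inj_uniq; first by rewrite filter_uniq // enum_uniq.
by move=> s t /val_inj.
Qed.

Lemma mem_pwords n p w : (w \in pwords n p) = (wdeg w == n) && (wpar w == p).
Proof. by rewrite mem_filter mem_words andbC. Qed.

Lemma uniq_pwords n p : uniq (pwords n p).
Proof. exact: filter_uniq (uniq_words n). Qed.

Lemma words0 : words 0 = [:: [::]].
Proof.
apply: perm_small_eq => //; apply: uniq_perm => //; first exact: uniq_words.
move=> w; rewrite mem_words inE; apply/eqP/eqP => [w0|->]; last exact: wdeg_nil.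
by apply: size0nil; apply/eqP; rewrite -leqn0 -w0 size_le_wdeg.
Qed.

Lemma sum_words_rec (R : nmodType) (F : seq I -> R) n : (0 < n)%N ->
  \sum_(w <- words n) F w =
  \sum_(a | (deg a <= n)%N) \sum_(w <- words (n - deg a)) F (a :: w).
Proof.
move=> n0; pose A := [seq a <- enum I | (deg a <= n)%N].
rewrite (perm_big [seq a :: w | a <- A, w <- words (n - deg a)]) /=.
  by rewrite big_allpairs_dep /= big_filter big_enum_cond.
apply: uniq_perm; first exact: uniq_words.
  apply: allpairs_uniq_dep => [|a _|]; first exact/filter_uniq/enum_uniq.
    exact: uniq_words.
  by move=> [a w] [a' w'] _ _ /= [-> ->].
move=> w; rewrite mem_words; apply/eqP/allpairsPdep => [wn|[a [v [Aa]]]].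
  case: w wn => [|a w]; first by rewrite wdeg_nil => nE; move: n0; rewrite -nE.
  rewrite wdeg_cons => nE; exists a, w; split=> //.
    by rewrite mem_filter mem_enum -nE leq_addr.
  by rewrite mem_words -nE addKn.
rewrite mem_words => /eqP vn ->; move: Aa; rewrite mem_filter => /andP[le_an _].
by rewrite wdeg_cons vn subnKC.
Qed.

Definition signed_count (n : nat) : rat := \sum_(w <- words n) (-1) ^+ wpar w.

Lemma signed_countE n :
  signed_count n = (size (pwords n false))%:R - (size (pwords n true))%:R.
Proof.
rewrite /signed_count /pwords !size_filter.
elim: (words n) => [|w s IH]; first by rewrite big_nil subr0.
by rewrite big_cons IH /= !natrD; case: (wpar w); rewrite ?expr1 ?expr0 /=;
  ring.
Qed.

End Words.

(** * Dimensions of subspaces given by a predicate *)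

Section Span.
Variables (K : fieldType) (W : lmodType K).

Inductive lspan (P : W -> Prop) : W -> Prop :=
  | lspan0 : lspan P 0
  | lspan_cons (a : K) x y : P x -> lspan P y -> lspan P (a *: x + y).

Lemma subspaceD (Q : W -> Prop) x y : is_subspace Q -> Q x -> Q y -> Q (x + y).
Proof. by case=> _ Qlin Qx Qy; rewrite -[x]scale1r; apply: Qlin. Qed.

Lemma subspaceZ (Q : W -> Prop) (a : K) x : is_subspace Q -> Q x -> Q (a *: x).
Proof. by case=> Q0 Qlin Qx; rewrite -[_ *: _]addr0; apply: Qlin. Qed.

Lemma subspaceN (Q : W -> Prop) x : is_subspace Q -> Q x -> Q (- x).
Proof. by move=> Qs Qx; rewrite -scaleN1r; apply: subspaceZ. Qed.

Lemma subspace_sum (Q : W -> Prop) (J : Type) (r : seq J) (F : J -> W) :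
  is_subspace Q -> (forall j, Q (F j)) -> Q (\sum_(j <- r) F j).
Proof.
move=> Qs QF; elim: r => [|j r IH]; first by rewrite big_nil; case: Qs.
by rewrite big_cons; apply: subspaceD.
Qed.

Lemma subspace_sum_seq (Q : W -> Prop) (J : eqType) (r : seq J) (F : J -> W) :
  is_subspace Q -> (forall j, j \in r -> Q (F j)) -> Q (\sum_(j <- r) F j).
Proof.
move=> Qs; elim: r => [|j r IH] QF; first by rewrite big_nil; case: Qs.
rewrite big_cons; apply: subspaceD => //; first by apply: QF; rewrite mem_head.
by apply: IH => i ir; apply: QF; rewrite inE ir orbT.
Qed.

Lemma lspan_subspace P : is_subspace (lspan P).
Proof.
split=> [|a x y Px Py]; first exact: lspan0.
elim: Px => [|b u v Pu _ IH]; first by rewrite scaler0 add0r.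
by rewrite scalerDr scalerA -addrA; apply: lspan_cons.
Qed.

Lemma lspan_gen (P : W -> Prop) x : P x -> lspan P x.
Proof. by move=> Px; rewrite -[x]scale1r -[_ *: _]addr0;
  apply: lspan_cons => //; apply: lspan0. Qed.

Lemma lspan_min (P Q : W -> Prop) : is_subspace Q -> (forall x, P x -> Q x) ->
  forall x, lspan P x -> Q x.
Proof.
move=> [Q0 Qlin] PQ x; elim=> [|a u v Pu _ Qv] //.
by apply: Qlin => //; apply: PQ.
Qed.

Definition family (X : eqType) (S : seq X) (F : X -> W) : W -> Prop :=
  fun y => exists2 s, s \in S & y = F s.

Lemma lspan_familyP (X : eqType) (S : seq X) (F : X -> W) x : uniq S ->
  lspan (family S F) x <-> exists c : X -> K, x = \sum_(s <- S) c s *: F s.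
Proof.
move=> uS; split=> [|[c ->]].
  elim=> [|a u v [s sS ->] _ [c ->]].
    by exists (fun=> 0); rewrite big1 // => s _; rewrite scale0r.
  exists (fun t => (if t == s then a else 0) + c t).
  under [RHS]eq_bigr => t _ do rewrite scalerDl.
  rewrite big_split /=; congr (_ + _); rewrite (bigD1_seq s) //= eqxx.
  by rewrite big1 ?addr0 // => t /negPf->; rewrite scale0r.
apply: subspace_sum_seq; first exact: lspan_subspace.
move=> s sS; apply: subspaceZ; first exact: lspan_subspace.
by apply: lspan_gen; exists s.
Qed.

Definition independent (X : eqType) (S : seq X) (F : X -> W) : Prop :=
  forall c : X -> K, \sum_(s <- S) c s *: F s = 0 -> forall s, s \in S ->
    c s = 0.

Lemma has_dim_family (X : eqType) (S : seq X) (F : X -> W) (P : W -> Prop) :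
  uniq S -> independent S F -> (forall x, P x <-> lspan (family S F) x) ->
  has_dim P (size S).
Proof.
move=> uS iS PS; exists (fun i => F (tnth (in_tuple S) i)).
have sumE (c : X -> K) : \sum_(s <- S) c s *: F s =
  \sum_(i < size S) c (tnth (in_tuple S) i) *: F (tnth (in_tuple S) i).
  by rewrite big_tnth.
have idx (s : X) : s \in S -> exists i, s = tnth (in_tuple S) i.
  by move=> sS; have /tnthP[i ->] : s \in in_tuple S by []; exists i.
have inj i j : tnth (in_tuple S) i = tnth (in_tuple S) j -> i = j.
  by have /tuple_uniqP inj : uniq (in_tuple S) by []; apply: inj.
have lift (c : 'I_(size S) -> K) : exists d : X -> K,
    forall i, d (tnth (in_tuple S) i) = c i.
  exists (fun s => \sum_(i | tnth (in_tuple S) i == s) c i) => i.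
  by rewrite (big_pred1 i) // => j; rewrite (eqtype.inj_eq inj).
split=> [c c0 i|x].
  have [d dE] := lift c; rewrite -dE; apply: iS; last exact: mem_tnth.
  by rewrite sumE -[RHS]c0; apply: eq_bigr => j _; rewrite dE.
rewrite PS lspan_familyP //; split=> [[c ->]|[c ->]].
  by exists (fun i => c (tnth (in_tuple S) i)).
have [d dE] := lift c; exists d; rewrite sumE.
by apply: eq_bigr => j _; rewrite dE.
Qed.

(** If m > n, the coefficient matrix of m vectors in terms of n spanning ones
    has a nonzero left kernel, which is a linear relation. *)
Lemma has_dim_le (P : W -> Prop) n m : has_dim P n -> has_dim P m -> (m <= n)%N.
Proof.
move=> [b [_ bP]] [b' [ib' b'P]]; rewrite leqNgt; apply/negP => lt_nm.
have Pb' j : P (b' j).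
  apply/b'P; exists (fun i => (i == j)%:R); rewrite (bigD1 j) //= eqxx scale1r.
  by rewrite big1 ?addr0 // => i /negPf->; rewrite scale0r.
have /(fin_all_exists)[M ME] j : exists c : 'I_n -> K, b' j = \sum_i c i *: b i.
  exact/bP.
pose A : 'M[K]_(m, n) := \matrix_(j, i) M j i.
have : kermx A != 0.
  rewrite kermx_eq0 /row_free; apply: contraTneq lt_nm => rA; rewrite -leqNgt.
  by rewrite -rA rank_leq_col.
case/rowV0Pn=> v /sub_kermxP vA /eqP; apply; apply/rowP => j; rewrite mxE.
apply: (ib' (fun j => v 0 j)).
under eq_bigr => i _ do rewrite ME scaler_sumr.
rewrite exchange_big big1 //= => i _.
under eq_bigr => l _ do rewrite scalerA.
rewrite -scaler_suml (_ : \sum_l _ = 0) ?scale0r //.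
move/rowP/(_ i): vA; rewrite !mxE => vAi; rewrite -[RHS]vAi;
  apply: eq_bigr => l _.
by rewrite mxE.
Qed.

Lemma has_dim_uniq (P : W -> Prop) n m : has_dim P n -> has_dim P m -> n = m.
Proof.
by move=> Pn Pm; apply/eqP; rewrite eqn_leq (has_dim_le Pm Pn)
  (has_dim_le Pn Pm).
Qed.

Lemma has_dim_ext (P Q : W -> Prop) n : (forall x, P x <-> Q x) ->
  has_dim P n -> has_dim Q n.
Proof. by move=> PQ [b [ib Pb]]; exists b; split=> // x; rewrite -PQ. Qed.

(** Vectors which depend on the later ones are discarded one at a time. *)
Lemma sub_basis (X : eqType) (S : seq X) (F : X -> W) : uniq S ->
  exists S', [/\ subseq S' S, independent S' F
    & forall x, lspan (family S F) x <-> lspan (family S' F) x].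
Proof.
elim: S => [|s S IH] /=; first by move=> _; exists [::]; split=> // c _ s.
case/andP=> sS /IH[S' [sub iS eqS]].
have mono (T : seq X) t x : lspan (family T F) x -> lspan (family (t :: T) F) x.
  apply: lspan_min; first exact: lspan_subspace.
  by move=> y [u uT ->]; apply: lspan_gen; exists u; rewrite // inE uT orbT.
have [dep|indep] := classic (lspan (family S' F) (F s)).
  exists S'; split=> //.
    exact: (subseq_trans sub (subseq_cons S s)).
  move=> x; split=> [|Sx]; last by apply: mono; apply/eqS.
  apply: lspan_min; first exact: lspan_subspace.
  move=> y [u]; rewrite inE => /predU1P[-> ->|uS ->] //.
  by apply/eqS; apply: lspan_gen; exists u.
exists (s :: S'); split=> [|c|x]; first by rewrite /= eqxx.
  have uS' : s \notin S' by apply: contra sS; apply: mem_subseq.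
  rewrite big_cons => c0.
  have cs0 : c s = 0.
    apply: contra_not_eq indep => cs.
    rewrite -[F s]scale1r -(mulVf cs) -scalerA (canRL (addrK _) c0) sub0r.
    apply: subspaceZ; first exact: lspan_subspace.
    apply: subspaceN; first exact: lspan_subspace.
    apply: subspace_sum_seq; first exact: lspan_subspace.
    move=> t tS; apply: subspaceZ; first exact: lspan_subspace.
    by apply: lspan_gen; exists t.
  move: c0; rewrite cs0 scale0r add0r => /iS c0 t; rewrite inE.
  by case/predU1P=> [->|] //; apply: c0.
split; apply: lspan_min; try exact: lspan_subspace; move=> y [u].
  rewrite inE => /predU1P[-> ->|uS ->]; first by apply: lspan_gen; exists s;
    rewrite ?mem_head.
  by apply: mono; apply/eqS; apply: lspan_gen; exists u.
rewrite inE => /predU1P[-> ->|uS ->]; first by apply: lspan_gen; exists s;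
  rewrite ?mem_head.
by apply: mono; apply/eqS; apply: lspan_gen; exists u.
Qed.

End Span.

(** * The free associative algebra *)

(** The algebra of noncommutative polynomials in the letters I, known only
    through the basis of words. *)
Record free_algebra (K : fieldType) (I : finType) := FreeAlgebra {
  fa_sort :> algType K;
  word : seq I -> fa_sort;
  wlin : forall W : lmodType K, (seq I -> W) -> {linear fa_sort -> W};
  word_nil : word [::] = 1;
  word_cat : forall u w, word (u ++ w) = word u * word w;
  wlin_word : forall (W : lmodType K) (F : seq I -> W) w, wlin F (word w) = F w;
  word_span : forall x, lspan (fun y => exists w, y = word w) x;
  wlin_inj : forall x,
    (forall w, wlin (W := K^o) (fun v => (v == w)%:R) x = 0) -> x = 0 }.

Arguments word {K I} f w.
Arguments wlin {K I} f {W} F.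

Section Construction.

Variables (K : fieldType) (I : finType).

Local Notation T := {malg K[{fmonom I}]}.

Definition mword (w : seq I) : T := mkmalgU (FMonom w) 1.

Lemma mword_cat v w : mword (v ++ w) = mword v * mword w.
Proof.
by rewrite /mword -[RHS]/(_ * _) malgM_def fgmulUU mulr1 /mmul /= fmmulE.
Qed.

Lemma mword_nil : mword [::] = 1.
Proof. by rewrite /mword -fmoneE. Qed.

Lemma freealgE (x : T) : x = \sum_(m <- msupp x) mcoeff m x *: mword m.
Proof.
rewrite {1}[x]monalgE; apply: eq_bigr => m _; apply/malgP => v.
by rewrite mcoeffZ /mword !mcoeffU fmK; case: (m == v); rewrite ?mulr1 ?mulr0.
Qed.

Lemma scale_mword a w : a *: mword w = mkmalgU (FMonom w) a :> T.
Proof.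
apply/malgP => v; rewrite mcoeffZ /mword !mcoeffU.
by case: (_ == v); rewrite ?mulr1 ?mulr0.
Qed.

Lemma scale_freealgAr (a : K) (x y : T) : a *: (x * y) = x * (a *: y).
Proof.
have Hw v w b : b *: (mword v * mword w) = mword v * (b *: mword w) :> T.
  rewrite -mword_cat !scale_mword /mword.
  by rewrite -[RHS]/(_ * _) malgM_def fgmulUU mul1r /mmul /= fmmulE.
have Hy v : a *: (mword v * y) = mword v * (a *: y).
  rewrite [y]freealgE mulr_sumr !scaler_sumr mulr_sumr; apply: eq_bigr => w _.
  by rewrite -(Hw v w) !scalerA Hw.
rewrite [x]freealgE !mulr_suml scaler_sumr; apply: eq_bigr => v _.
by rewrite -!scalerAl -Hy !scalerA mulrC.
Qed.

Definition freealg := T.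

HB.instance Definition _ := GRing.Lalgebra.on freealg.
HB.instance Definition _ :=
  GRing.Lalgebra_isAlgebra.Build K freealg scale_freealgAr.

Section LinearExtension.
Variables (W : lmodType K) (F : seq I -> W).

Definition mwlin (x : T) : W := \sum_(m <- msupp x) mcoeff m x *: F m.

Lemma mwlin_is_linear : linear mwlin.
Proof.
move=> a x y; pose d := (msupp x `|` msupp y)%fset.
have wlinE z : (msupp z `<=` d)%fset -> mwlin z =
  \sum_(m <- d) mcoeff m z *: F m.
  move=> le; rewrite /mwlin (big_fset_incl _ le) // => m _ /mcoeff_outdom ->.
  by rewrite scale0r.
rewrite !wlinE ?fsubsetUl ?fsubsetUr //.
  rewrite scaler_sumr -big_split; apply: eq_bigr => m _ /=.
  by rewrite mcoeffD mcoeffZ scalerDl scalerA.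
apply: (fsubset_trans (msuppD_le _ _)); apply: fsetUSS => //; exact: msuppZ_le.
Qed.

HB.instance Definition _ := GRing.isLinear.Build K T W _ mwlin mwlin_is_linear.

Lemma mwlin_word w : mwlin (mword w) = F w.
Proof. by rewrite /mwlin msuppU oner_eq0 big_seq_fset1 mcoeffUU scale1r. Qed.

End LinearExtension.


Lemma mword_span (x : T) : lspan (fun y => exists w, y = mword w) x.
Proof.
rewrite [x]freealgE; apply: subspace_sum => [|m]; first exact: lspan_subspace.
apply: subspaceZ; first exact: lspan_subspace.
by apply: lspan_gen; exists m.
Qed.

Lemma mwlin_inj (x : T) :
  (forall w, mwlin (W := K^o) (fun v => (v == w)%:R) x = 0) -> x = 0.
Proof.
move=> x0; apply/malgP => m; rewrite mcoeff0 -[RHS](x0 m) /mwlin.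
case: (msuppP x m) => [m_x|m_x].
  rewrite (bigD1_seq m) ?fset_uniq //= eqxx [X in _ + X]big1 => [|v nv].
    by rewrite addr0 -[RHS]/(_ * 1) mulr1.
  by rewrite -[LHS]/(_ * _) -fmP (negPf nv) mulr0.
rewrite big_seq big1 // => v vx; rewrite -[LHS]/(_ * _) -fmP.
by case: eqP => [vm|_]; rewrite ?mulr0 //; rewrite -vm vx in m_x.
Qed.

Definition free_algebra_of : free_algebra K I :=
  FreeAlgebra (fa_sort := freealg) (wlin := fun W F => mwlin F)
    mword_nil mword_cat mwlin_word mword_span mwlin_inj.

End Construction.

(** * The Lie superalgebra of a free associative algebra *)

Section Superbracket.
Variables (K : fieldType) (I : finType) (par : I ->
  bool) (T : free_algebra K I).
Local Notation wpar := (wpar par).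
Local Notation word := (word T).

Definition wcoef (w : seq I) : {linear T -> K^o} :=
  wlin T (W := K^o) (fun v => (v == w)%:R).

Lemma wcoef_word w v : wcoef w (word v) = (v == w)%:R.
Proof. exact: wlin_word. Qed.

Lemma freealg_ind (Q : T -> Prop) : is_subspace Q -> (forall w, Q (word w)) ->
  forall x, Q x.
Proof.
move=> Qs Qw x; have := word_span (f := T) x.
by apply: lspan_min => // y [w ->].
Qed.

Lemma freealgP (x y : T) : (forall w, wcoef w x = wcoef w y) -> x = y.
Proof.
move=> xy; apply/eqP; rewrite -subr_eq0; apply/eqP;
  apply: (wlin_inj (f := T)) => w.
by rewrite -/(wcoef w) linearB /= xy subrr.
Qed.

Definition tpar (p : bool) (x : T) : Prop :=
  forall w, wpar w != p -> wcoef w x = 0.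

Definition tproj (p : bool) : {linear T -> T} :=
  wlin T (fun w => if wpar w == p then word w else 0).

Lemma tproj_word p w : tproj p (word w) = if wpar w == p then word w else 0.
Proof. exact: wlin_word. Qed.

Lemma wcoef_tproj p x w : wcoef w (tproj p x) =
  if wpar w == p then wcoef w x else 0.
Proof.
move: x; apply: freealg_ind => [|v].
  split=> [|a x y IHx IHy]; first by rewrite !linear0 if_same.
  rewrite !linearP IHx IHy /=; case: ifP => // _; by rewrite scaler0 addr0.
rewrite tproj_word wcoef_word; case: (eqVneq v w) => [->|ne].
  by case: ifP; rewrite ?wcoef_word ?eqxx // linear0.
rewrite if_same; case: ifP; rewrite ?linear0 // wcoef_word.
by rewrite (negPf ne).
Qed.

Lemma tpar_subspace p : is_subspace (tpar p).
Proof.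
split=> [w _|a x y px py w pw]; first by rewrite linear0.
by rewrite linearP px ?py //= scaler0 addr0.
Qed.

Lemma tpar_word w : tpar (wpar w) (word w).
Proof.
by move=> v; rewrite wcoef_word; case: (eqVneq w v) => [->|//]; rewrite eqxx.
Qed.

Lemma tpar_tproj p x : tpar p (tproj p x).
Proof. by move=> w /negPf pw; rewrite wcoef_tproj pw. Qed.

Lemma tproj_id p x : tpar p x -> tproj p x = x.
Proof.
move=> px; apply: freealgP => w; rewrite wcoef_tproj; case: ifP => // /negbT pw.
by rewrite px.
Qed.

Lemma tproj_0 p x : tpar (~~ p) x -> tproj p x = 0.
Proof.
move=> px; apply: freealgP => w; rewrite wcoef_tproj linear0.
by case: ifP => // /eqP pw; rewrite px // pw; case: (p).
Qed.

Lemma tprojD x : x = tproj false x + tproj true x.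
Proof.
apply: freealgP => w; rewrite linearD /= !wcoef_tproj.
by case: (wpar w); rewrite ?addr0 ?add0r.
Qed.

Lemma freealg_superspace : is_superspace tpar.
Proof.
split=> [p|x|x x0 x1]; first exact: tpar_subspace.
  by exists (tproj false x), (tproj true x); split; rewrite -?tprojD //;
    apply: tpar_tproj.
by rewrite [x]tprojD (tproj_0 (p := false) x1) (tproj_0 (p := true) x0) addr0.
Qed.

Lemma tparM p q x y : tpar p x -> tpar q y -> tpar (p (+) q) (x * y).
Proof.
move=> /tproj_id <- /tproj_id <-; move: x y.
apply: freealg_ind => [|v].
  split=> [y|a x z IHx IHz y]; first by rewrite linear0 mul0r;
    case: (tpar_subspace (p (+) q)).
  rewrite linearP mulrDl -scalerAl; case: (tpar_subspace (p (+) q)) => _; apply;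
    [exact: IHx|exact: IHz].
have zero r : tpar r 0 by case: (tpar_subspace r).
apply: freealg_ind => [|w].
  split=> [|a x z IHx IHz]; first by rewrite linear0 mulr0.
  rewrite linearP mulrDr -scalerAr; case: (tpar_subspace (p (+) q)) => _; apply;
    [exact: IHx|exact: IHz].
rewrite !tproj_word; case: eqP => [<-|_]; rewrite ?mul0r //.
case: eqP => [<-|_]; last by rewrite mulr0.
by rewrite -word_cat -wpar_cat; apply: tpar_word.
Qed.

Definition ssign (p q : bool) : K := (-1) ^+ (p && q).

(** The bilinear operation which is the supercommutator x y - (-1)^(pq) y x
    on homogeneous elements: only the odd parts of x and y change sign. *)
Definition tbr (x y : T) : T := x * y - y * x + (tproj true y * tproj true x)
  *+ 2.

Lemma tbrE p q x y : tpar p x -> tpar q y -> tbr x y =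
  x * y - ssign p q *: (y * x).
Proof.
rewrite /tbr /ssign => px qy; case: p q px qy => [] [] px qy /=.
- by rewrite !tproj_id // expr1 scaleN1r opprK mulr2n addrA subrK.
- by rewrite (tproj_0 (p := true) qy) mul0r mul0rn addr0 expr0 scale1r.
- by rewrite (tproj_0 (p := true) px) mulr0 mul0rn addr0 expr0 scale1r.
- by rewrite (tproj_0 (p := true) px) mulr0 mul0rn addr0 expr0 scale1r.
Qed.

Lemma tbr_linearl (a : K) x y z : tbr (a *: x + y) z = a *: tbr x z + tbr y z.
Proof.
rewrite /tbr linearP mulrDl [z * (_ + _)]mulrDr [tproj true z * _]mulrDr
  mulrnDl.
rewrite -!scalerAl -!scalerAr scalerMnr opprD !scalerDr scalerN.
by rewrite [X in X + _ = _]addrACA [LHS]addrACA.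
Qed.

Lemma tbr_linearr (a : K) x y z : tbr z (a *: x + y) = a *: tbr z x + tbr z y.
Proof.
rewrite /tbr linearP mulrDr [(_ + _) * z]mulrDl [_ * tproj true z]mulrDl
  mulrnDl.
rewrite -!scalerAl -!scalerAr scalerMnr opprD !scalerDr scalerN.
by rewrite [X in X + _ = _]addrACA [LHS]addrACA.
Qed.

Lemma ssignK p q : ssign p q * ssign p q = 1.
Proof. by rewrite -expr2 sqrr_sign. Qed.

Lemma ssignC p q : ssign p q = ssign q p.
Proof. by rewrite /ssign andbC. Qed.

Lemma ssignD p q r : ssign p (q (+) r) = ssign p q * ssign p r.
Proof. by rewrite /ssign andb_addr signr_addb. Qed.

Lemma tbr_par p q x y : tpar p x -> tpar q y -> tpar (p (+) q) (tbr x y).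
Proof.
move=> px qy; rewrite (tbrE px qy) addrC -scaleNr;
  apply: (proj2 (tpar_subspace _)).
  by rewrite addbC; apply: tparM.
exact: tparM.
Qed.

Lemma tbr_skew p q x y : tpar p x -> tpar q y ->
  tbr x y = - (ssign p q *: tbr y x).
Proof.
move=> px qy; rewrite (tbrE px qy) (tbrE qy px) scalerBr scalerA.
by rewrite (ssignC q) ssignK scale1r opprB.
Qed.

(** A homogeneous x acts on products as a skew derivation. *)
Lemma tbr_mul p q r x y z : tpar p x -> tpar q y -> tpar r z ->
  tbr x (y * z) = tbr x y * z + ssign p q *: (y * tbr x z).
Proof.
move=> px qy rz; rewrite (tbrE px (tparM qy rz)) (tbrE px qy) (tbrE px rz).
rewrite mulrBl mulrBr scalerBr -!scalerAl -!scalerAr scalerA -ssignD !mulrA.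
by rewrite addrA subrK.
Qed.

(** The bracket [y, z] is a combination of the products y z and z y, on which x
    acts as a skew derivation. *)
Lemma tbr_jacobi p q x y z : tpar p x -> tpar q y ->
  tbr x (tbr y z) = tbr (tbr x y) z + ssign p q *: tbr y (tbr x z).
Proof.
move=> px qy; rewrite [z]tprojD; move: (tproj false z) (tproj true z)
  (@tpar_tproj false z) (@tpar_tproj true z).
have tbrD a b c : tbr a (b + c) = tbr a b + tbr a c.
  by have := tbr_linearr 1 b c a; rewrite !scale1r.
have Hr r t : tpar r t ->
    tbr x (tbr y t) = tbr (tbr x y) t + ssign p q *: tbr y (tbr x t).
  move=> rt; rewrite (tbrE qy rt).
  have := tbr_linearr (- ssign q r) (t * y) (y * t) x.
  rewrite scaleNr addrC => ->.
  rewrite (tbr_mul px rt qy) (tbr_mul px qy rt).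
  rewrite (tbrE (tbr_par px qy) rt) (tbrE qy (tbr_par px rt)).
  have -> : ssign (p (+) q) r = ssign q r * ssign p r.
    by rewrite ssignC ssignD !(ssignC r) mulrC.
  have sE : ssign p q * ssign q (p (+) r) = ssign q r.
    by rewrite ssignD mulrA (ssignC q p) ssignK mul1r.
  rewrite scalerBr scalerA sE scaleNr scalerDr scalerA opprD.
  by rewrite addrC [X in _ + X = _]addrC addrACA.
move=> t u t0 u1; rewrite (tbrD y t) (tbrD x t) (tbrD (tbr x y) t).
rewrite (tbrD x (tbr y t)) (tbrD y (tbr x t)) (Hr _ _ t0) (Hr _ _ u1).
by rewrite [X in _ = _ + X]scalerDr addrACA.
Qed.

Definition freealg_lie : lieSuperalgebra K :=
  LieSuperalgebra (lie_sort := T) freealg_superspace tbr_linearl tbr_linearr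
    tbr_par tbr_skew tbr_jacobi.

End Superbracket.

(** * Right-normed brackets *)

Section LieBasics.
Variables (K : fieldType) (L : lieSuperalgebra K).
Local Notation br := (@lie_br K L).

Lemma lie_br0l x : br 0 x = 0.
Proof.
have := lie_linearl (-1) 0 0 x; rewrite scaler0 addr0 scaleN1r.
by rewrite addNr.
Qed.

Lemma lie_br0r x : br x 0 = 0.
Proof.
have := lie_linearr (-1) 0 0 x; rewrite scaler0 addr0 scaleN1r.
by rewrite addNr.
Qed.

Lemma lie_brDl x y z : br (x + y) z = br x z + br y z.
Proof. by have := lie_linearl 1 x y z; rewrite !scale1r. Qed.

Lemma lie_brDr x y z : br z (x + y) = br z x + br z y.
Proof. by have := lie_linearr 1 x y z; rewrite !scale1r. Qed.

Lemma lie_brZr a x z : br z (a *: x) = a *: br z x.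
Proof. by have := lie_linearr a x 0 z; rewrite lie_br0r !addr0. Qed.

Lemma lie_par_subspace p : is_subspace (@lie_par K L p).
Proof. by case: (@lie_superspace K L). Qed.

Lemma subspace_brl (Q : L -> Prop) y : is_subspace Q -> is_subspace (fun x =>
  Q (br x y)).
Proof.
case=> Q0 Qlin; split=> [|a x z Qx Qz]; first by rewrite lie_br0l.
by rewrite lie_linearl; apply: Qlin.
Qed.

Lemma subspace_brr (Q : L -> Prop) y : is_subspace Q -> is_subspace (fun x =>
  Q (br y x)).
Proof.
case=> Q0 Qlin; split=> [|a x z Qx Qz]; first by rewrite lie_br0r.
by rewrite lie_linearr; apply: Qlin.
Qed.

End LieBasics.

Section RightNormed.
Variables (K : fieldType) (I : finType) (deg : I -> nat) (par : I -> bool).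
Variables (L : lieSuperalgebra K) (E : I -> L).
Hypothesis deg_gt0 : forall a, (0 < deg a)%N.
Hypothesis E_par : forall a, lie_par (par a) (E a).
Local Notation br := (@lie_br K L).
Local Notation wdeg := (wdeg deg).
Local Notation wpar := (wpar par).
Local Notation pwords := (pwords deg par).

(** The gradation induced by the degrees of the generators E a. *)
Inductive gen_deg : nat -> L -> Prop :=
  | gen_deg_gen a : gen_deg (deg a) (E a)
  | gen_deg_0 N : gen_deg N 0
  | gen_deg_lin N (c : K) x y : gen_deg N x -> gen_deg N y ->
    gen_deg N (c *: x + y)
  | gen_deg_br M N x y : gen_deg M x -> gen_deg N y -> gen_deg (M + N) (br x y).

(** The bracket [E a1, [E a2, ... [E a(n-1), E an]]]. *)
Fixpoint rbr (w : seq I) : L :=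
  if w is a :: u then if u is _ :: _ then br (E a) (rbr u) else E a else 0.

Lemma rbr_cons a b u : rbr (a :: b :: u) = br (E a) (rbr (b :: u)).
Proof. by []. Qed.

Definition rspan (N : nat) (p : bool) : L -> Prop :=
  lspan (family (pwords N p) rbr).

Lemma rspan_subspace N p : is_subspace (rspan N p).
Proof. exact: lspan_subspace. Qed.

Lemma rspan_rbr w : rspan (wdeg w) (wpar w) (rbr w).
Proof. by apply: lspan_gen; exists w; rewrite // mem_pwords // !eqxx. Qed.

Lemma rbr_par w : lie_par (wpar w) (rbr w).
Proof.
elim: w => [|a [|b u] IH]; first by case: (lie_par_subspace L (wpar [::])).
  by rewrite wpar_cons wpar_nil addbF.
by rewrite rbr_cons wpar_cons; apply: lie_br_par.
Qed.

Lemma rbr_deg w : gen_deg (wdeg w) (rbr w).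
Proof.
elim: w => [|a [|b u] IH]; first exact: gen_deg_0.
  by rewrite wdeg_cons wdeg_nil addn0; apply: gen_deg_gen.
by rewrite rbr_cons wdeg_cons; apply: gen_deg_br => //; apply: gen_deg_gen.
Qed.

Lemma rspan_par N p x : rspan N p x -> lie_par p x.
Proof.
apply: lspan_min; first exact: lie_par_subspace.
by move=> y [w]; rewrite mem_pwords // => /andP[_ /eqP <-] ->; apply: rbr_par.
Qed.

Lemma rspan_deg N p x : rspan N p x -> gen_deg N x.
Proof.
apply: lspan_min; first by split=> [|a y z]; [apply: gen_deg_0 | apply:
  gen_deg_lin].
by move=> y [w]; rewrite mem_pwords // => /andP[/eqP <- _] ->; apply: rbr_deg.
Qed.

Lemma rspan_br_gen a N p y :
  rspan N p y -> rspan (deg a + N) (par a (+) p) (br (E a) y).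
Proof.
move: y; apply: lspan_min; first exact/subspace_brr/rspan_subspace.
move=> z [[|b u]]; rewrite mem_pwords // => /andP[/eqP <- /eqP <-] ->.
  by rewrite lie_br0r; case: (rspan_subspace (deg a + wdeg [::]) (par a (+)
    wpar [::])).
by rewrite -rbr_cons -wdeg_cons -wpar_cons; apply: rspan_rbr.
Qed.

(** Brackets of right-normed brackets are combinations of right-normed
    brackets, by the Jacobi identity. *)
Lemma rspan_br M p N q x y :
  rspan M p x -> rspan N q y -> rspan (M + N) (p (+) q) (br x y).
Proof.
move=> Mx Ny; move: x Mx; apply: lspan_min; first
  exact/subspace_brl/rspan_subspace.
move=> x [u]; rewrite mem_pwords // => /andP[/eqP <- /eqP <-] -> {x}.
elim: u N q y Ny => [|a [|b u] IH] N q y Ny.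
- by rewrite lie_br0l; case: (rspan_subspace (wdeg [::] + N) (wpar [::] (+) q)).
- by rewrite wdeg_cons wpar_cons wdeg_nil wpar_nil addn0 addbF;
  apply: rspan_br_gen.
rewrite rbr_cons; set v := b :: u in IH *.
have := lie_jacobi y (E_par a) (rbr_par v).
move/(canLR (addrK _)) => <-; rewrite wdeg_cons wpar_cons -addnA -addbA.
have Rs := rspan_subspace (deg a + (wdeg v + N)) (par a (+) (wpar v (+) q)).
apply: subspaceD => //; first by apply: rspan_br_gen; apply: IH.
apply: subspaceN => //; apply: subspaceZ => //.
rewrite (addnCA (deg a)) (addbCA (par a)).
by apply: IH; apply: rspan_br_gen.
Qed.

Lemma gen_deg_split N x : gen_deg N x ->
  exists x0 x1, [/\ rspan N false x0, rspan N true x1 & x = x0 + x1].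
Proof.
elim=> {N x} [a|N|N c x y _ [x0 [x1 [X0 X1 ->]]] _ [y0 [y1 [Y0 Y1 ->]]]
  |M N x y _ [x0 [x1 [X0 X1 ->]]] _ [y0 [y1 [Y0 Y1 ->]]]].
- have := rspan_rbr [:: a]; rewrite wdeg_cons wpar_cons wdeg_nil wpar_nil addn0
  addbF /=.
  case: (par a) => Ra; [exists 0, (E a) | exists (E a), 0].
    by rewrite add0r; split=> //; case: (rspan_subspace (deg a) false).
  by rewrite addr0; split=> //; case: (rspan_subspace (deg a) true).
- by exists 0, 0; rewrite addr0; split=> //; case: (rspan_subspace N false);
    case: (rspan_subspace N true).
- exists (c *: x0 + y0), (c *: x1 + y1); split.
  + exact: (proj2 (rspan_subspace _ _)).
  + exact: (proj2 (rspan_subspace _ _)).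
  by rewrite scalerDr addrACA.
exists (br x0 y0 + br x1 y1), (br x0 y1 + br x1 y0); split.
- apply: subspaceD; first exact: rspan_subspace.
    exact: (rspan_br X0 Y0).
  exact: (rspan_br X1 Y1).
- apply: subspaceD; first exact: rspan_subspace.
    exact: (rspan_br X0 Y1).
  exact: (rspan_br X1 Y0).
by rewrite !lie_brDl !lie_brDr [br x1 y0 + _]addrC addrACA.
Qed.

Lemma lie_par_unique p x y x' y' :
  lie_par p x -> lie_par (~~ p) y -> lie_par p x' -> lie_par (~~ p) y' ->
  x + y = x' + y' :> L -> x = x'.
Proof.
move=> px py px' py' xy.
have dE : x - x' = y' - y by rewrite -[x](addrK y) xy (addrC x') addrAC addrK.
have [_ _ H] := @lie_superspace K L; apply/eqP; rewrite -subr_eq0; apply/eqP.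
have p1 : lie_par p (x - x').
  apply: subspaceD => //; first exact: lie_par_subspace.
  by apply: subspaceN => //; apply: lie_par_subspace.
have p2 : lie_par (~~ p) (x - x').
  rewrite dE; apply: subspaceD => //; first exact: lie_par_subspace.
  by apply: subspaceN => //; apply: lie_par_subspace.
by case: p p1 p2 {px py px' py'} => p1 p2; apply: H.
Qed.

(** The decomposition into an even and an odd part is unique, so the parity of x
    selects one summand of its splitting. *)
Lemma gen_deg_par N p x : (gen_deg N x /\ lie_par p x) <-> rspan N p x.
Proof.
split=> [[/gen_deg_split[x0 [x1 [X0 X1 xE]]] px]|Rx]; last first.
  by split; [apply: rspan_deg Rx | apply: rspan_par Rx].
have P0 := rspan_par X0; have P1 := rspan_par X1.
have Z q : lie_par q (0 : L) by case: (lie_par_subspace L q).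
case: p px => px.
  have -> // : x = x1.
  by apply: (@lie_par_unique true _ 0 _ x0) => //; rewrite addr0 addrC.
have -> // : x = x0.
by apply: (@lie_par_unique false _ 0 _ x1) => //; rewrite addr0.
Qed.

End RightNormed.

(** * Dynkin's operator *)

Section Dynkin.
Variables (K : fieldType) (charK : [pchar K] =i pred0).
Variables (I : finType) (deg : I -> nat) (par : I -> bool).
Variables (L : lieSuperalgebra K) (E : I -> L) (T : free_algebra K I).
Variable g : {linear L -> freealg_lie par T}.
Hypothesis deg_gt0 : forall a, (0 < deg a)%N.
Hypothesis E_par : forall a, lie_par (par a) (E a).
Hypothesis g_hom : lie_hom g.
Hypothesis gE : forall a, g (E a) = word T [:: a].
Local Notation br := (@lie_br K L).
Local Notation wdeg := (wdeg deg).
Local Notation wpar := (wpar par).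
Local Notation rbr := (rbr E).

Lemma g_rbr_cons a b u (x := g (rbr (b :: u)) : T) :
  g (rbr (a :: b :: u)) = word T [:: a] * x - ssign K (par a) (wpar (b :: u))
    *: (x * word T [:: a]) :> T.
Proof.
rewrite rbr_cons (proj2 g_hom) gE; apply: tbrE.
  by have := @tpar_word _ _ par T [:: a]; rewrite wpar_cons wpar_nil addbF.
exact: (proj1 g_hom) (rbr_par E_par _).
Qed.

Definition ad (w : seq I) (y : L) : L := foldr (fun a z => br (E a) z) y w.

Definition adT (y : L) : {linear T -> L} := wlin T (fun w => ad w y).

Lemma adT_consl a y x : adT y (word T [:: a] * x) = br (E a) (adT y x).
Proof.
move: x; apply: freealg_ind => [|w]; last by rewrite -word_cat /adT !wlin_word.
split=> [|c x z Hx Hz]; first by rewrite mulr0 !linear0 lie_br0r.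
by rewrite mulrDr -scalerAr !linearP Hx Hz lie_linearr.
Qed.

Lemma adT_consr a y x : adT y (x * word T [:: a]) = adT (br (E a) y) x.
Proof.
move: x; apply: freealg_ind => [|w].
  split=> [|c x z Hx Hz]; first by rewrite mul0r !linear0.
  by rewrite mulrDl -scalerAl !linearP Hx Hz.
by rewrite -word_cat /adT !wlin_word /ad foldr_cat.
Qed.

(** Through g, a Lie element acts on L by its own adjoint action. *)
Lemma adT_rbr w y : adT y (g (rbr w)) = br (rbr w) y.
Proof.
elim: w y => [|a [|b u] IH] y; first by rewrite !linear0 lie_br0l.
  by rewrite /= gE /adT wlin_word.
rewrite g_rbr_cons linearB linearZ /= adT_consl adT_consr !IH.
rewrite (lie_jacobi y (E_par a) (rbr_par E_par (b :: u))) /ssign.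
by rewrite addrK.
Qed.

(** Dynkin's operator, with the weight deg a of the innermost letter in place
    of the usual 1: a word w a goes to deg a ad(w)(E a).  On Lie elements it is
    a derivation of degree 0 which multiplies each generator E a by deg a, hence
    it multiplies homogeneous Lie elements by their degree. *)
Fixpoint dynkin_word (w : seq I) : L :=
  if w is a :: u then
    if u is _ :: _ then br (E a) (dynkin_word u) else (deg a)%:R *: E a
  else 0.

Definition dynkin : {linear T -> L} := wlin T dynkin_word.

Lemma dynkin_consr a x : dynkin (x * word T [:: a]) = (deg a)%:R *: adT (E a) x.
Proof.
move: x; apply: freealg_ind => [|w].
  split=> [|c x z Hx Hz]; first by rewrite mul0r !linear0 ?scaler0.
  by rewrite mulrDl -scalerAl [LHS]linearP [adT _ _]linearP Hx Hz scalerDr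
    !scalerA mulrC.
rewrite -word_cat /dynkin /adT !wlin_word; elim: w => [|b w IH] //.
have -> : dynkin_word ((b :: w) ++ [:: a]) = br (E b)
  (dynkin_word (w ++ [:: a])).
  by case: w {IH}.
by rewrite IH lie_brZr.
Qed.

Lemma dynkin_consl a x : wcoef T [::] x = 0 ->
  dynkin (word T [:: a] * x) = br (E a) (dynkin x).
Proof.
suff -> : dynkin (word T [:: a] * x) =
    br (E a) (dynkin x) + wcoef T [::] x *: ((deg a)%:R *: E a).
  by move=> ->; rewrite scale0r addr0.
move: x; apply: freealg_ind => [|w].
  split=> [|c x z Hx Hz]; first by rewrite mulr0 !linear0 scale0r lie_br0r
    addr0.
  rewrite mulrDr -scalerAr !linearP Hx Hz lie_linearr scalerDl scalerDr.
  by rewrite scalerA addrACA.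
rewrite -word_cat wcoef_word /dynkin !wlin_word; case: w => [|b w] /=.
  by rewrite lie_br0r add0r scale1r.
by rewrite scale0r addr0.
Qed.

Lemma wcoef_nil_mul x y : wcoef T [::] (x * y) =
  wcoef T [::] x * wcoef T [::] y.
Proof.
move: x; apply: freealg_ind => [|v].
  split=> [|c x z Hx Hz]; first by rewrite mul0r linear0 mul0r.
  by rewrite mulrDl -scalerAl !linearP Hx Hz mulrDl -scalerAl.
move: y; apply: freealg_ind => [|w].
  split=> [|c x z Hx Hz]; first by rewrite mulr0 linear0 mulr0.
  by rewrite mulrDr -scalerAr !linearP Hx Hz mulrDr -scalerAr.
rewrite -word_cat !wcoef_word -natrM mulnb.
by case: v => //=; case: w.
Qed.

Lemma wcoef_nil_rbr w : wcoef T [::] (g (rbr w)) = 0.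
Proof.
case: w => [|a [|b u]]; first by rewrite !linear0.
  by rewrite /= gE wcoef_word.
rewrite g_rbr_cons linearB linearZ /= !wcoef_nil_mul !wcoef_word /=.
by rewrite mul0r mulr0 scaler0 subr0.
Qed.

Lemma dynkin_rbr w : dynkin (g (rbr w)) = (wdeg w)%:R *: rbr w.
Proof.
elim: w => [|a [|b u] IH]; first by rewrite !linear0 ?scaler0.
  by rewrite /= gE /dynkin wlin_word wdeg_cons wdeg_nil addn0.
rewrite g_rbr_cons linearB linearZZ dynkin_consl ?wcoef_nil_rbr //.
rewrite dynkin_consr IH adT_rbr lie_brZr.
rewrite (lie_skew (rbr_par E_par (b :: u)) (E_par a)).
rewrite [wdeg (a :: _)]wdeg_cons natrD scalerDl [RHS]addrC; congr (_ + _).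
rewrite !scalerN opprK /ssign andbC !scalerA mulrAC -expr2 sqrr_sign.
by rewrite mul1r.
Qed.

(** In characteristic 0, Dynkin's operator divided by N is a left inverse of
    g in degree N. *)
Lemma g_inj N p x : (0 < N)%N -> rspan deg par E N p x -> g x = 0 -> x = 0.
Proof.
move=> N0 Rx gx0; have : dynkin (g x) = N%:R *: x.
  move: x Rx {gx0}; apply: lspan_min => [|y [w]].
    split=> [|c x y Hx Hy]; first by rewrite !linear0 ?scaler0.
    by rewrite [g _]linearP [LHS]linearP Hx Hy scalerDr !scalerA mulrC.
  by rewrite mem_pwords // => /andP[/eqP <- _] ->; apply: dynkin_rbr.
rewrite gx0 linear0 => /esym/eqP; rewrite scaler_eq0 => /orP[|/eqP //].
by move/pcharf0P: charK => ->; rewrite gtn_eqF.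
Qed.

End Dynkin.

(** * Skew derivations *)

Section SkewDerivations.
Variables (K : fieldType) (I : finType) (par : I ->
  bool) (T : free_algebra K I).
Local Notation word := (word T).
Local Notation wpar := (wpar par).
Local Notation ssign := (ssign K).

Definition ev (f : seq I -> K) : {linear T -> K^o} := wlin T (W := K^o) f.

Lemma ev_word f w : ev f (word w) = f w.
Proof. exact: wlin_word. Qed.

Definition ltr (f : seq I -> K) (x : T) : seq I -> K :=
  fun w => ev f (x * word w).

Lemma ev_ltr f x y : ev (ltr f x) y = ev f (x * y).
Proof.
move: y; apply: freealg_ind => [|w]; last by rewrite ev_word.
split=> [|c y z Hy Hz]; first by rewrite mulr0 !linear0.
by rewrite mulrDr -scalerAr !linearP Hy Hz.
Qed.

Lemma ltrM f x y : ltr (ltr f x) y = ltr f (x * y).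
Proof.
by apply: functional_extensionality => w; rewrite /ltr ev_ltr mulrA.
Qed.

Lemma ltr_linear f c x y : ltr f (c *: x + y) = fun w =>
  c * ltr f x w + ltr f y w.
Proof.
apply: functional_extensionality => w.
by rewrite /ltr mulrDl -scalerAl linearP.
Qed.

(** When f is a linear form of parity p, this is (f \otimes id) composed with
    the coproduct of T for which the letters are primitive. *)
Fixpoint der_word (p : bool) (f : seq I -> K) (w : seq I) : T :=
  if w is a :: u then
    der_word (par a (+) p) (fun v => f (a :: v)) u
      + ssign (par a) p *: (word [:: a] * der_word p f u)
  else f [::] *: 1.

Definition der p f : {linear T -> T} := wlin T (der_word p f).

Lemma der_linearf p c f1 f2 x :
  der p (fun w => c * f1 w + f2 w) x = c *: der p f1 x + der p f2 x.
Proof.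
move: x; apply: freealg_ind => [|w].
  split=> [|d x z Hx Hz]; first by rewrite !linear0 ?scaler0 addr0.
  rewrite [LHS]linearP [der p f1 _]linearP [der p f2 _]linearP Hx Hz.
  by rewrite !scalerDr !scalerA mulrC addrACA.
rewrite /der !wlin_word; elim: w p f1 f2 => [|a w IH] p f1 f2 /=.
  by rewrite scalerDl scalerA.
rewrite (IH (par a (+) p) (fun v => f1 (a :: v)) (fun v => f2 (a :: v))) (IH p).
by rewrite mulrDr -scalerAr !scalerDr !scalerA mulrC addrACA.
Qed.

Lemma der0 p x : der p (fun=> 0) x = 0.
Proof.
move: x; apply: freealg_ind => [|w].
  split=> [|c x z Hx Hz]; first by rewrite linear0.
  by rewrite linearP Hx Hz scaler0 addr0.
rewrite /der wlin_word; elim: w p => [|a w IH] p /=; first by rewrite scale0r.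
by rewrite !IH mulr0 scaler0 addr0.
Qed.

(** The rule satisfied by der p f when x is a primitive element of parity q. *)
Definition primitive (q : bool) (x : T) : Prop := forall p f y,
  der p f (x * y) = der (q (+) p) (ltr f x) y + ssign q p *: (x * der p f y).

Lemma primitive_letter a : primitive (par a) (word [:: a]).
Proof.
move=> p f; apply: freealg_ind => [|w].
  split=> [|c y z Hy Hz]; first by rewrite mulr0 !linear0 mulr0 scaler0 addr0.
  rewrite mulrDr -scalerAr [LHS]linearP [der p f (_ + _)]linearP.
  rewrite [der (_ (+) _) _ _]linearP Hy Hz mulrDr -scalerAr !scalerDr !scalerA.
  by rewrite mulrC addrACA.
rewrite -word_cat /der !wlin_word /=; congr (_ + _).
congr der_word; apply: functional_extensionality => v.
by rewrite /ltr -word_cat ev_word.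
Qed.

Lemma primitive_subspace q : is_subspace (primitive q).
Proof.
split=> [p f y|c x z Hx Hz p f y].
  rewrite !mul0r scaler0 addr0 linear0 (_ : ltr f 0 = fun=> 0) ?der0 //.
  by apply: functional_extensionality => w; rewrite /ltr mul0r linear0.
rewrite ltr_linear der_linearf mulrDl -scalerAl linearP Hx Hz mulrDl -scalerAl.
by rewrite !scalerDr !scalerA mulrC addrACA.
Qed.

(** The terms in which f absorbs exactly one of x and y cancel between x (y z)
    and y (x z). *)
Lemma primitive_comm q r x y : primitive q x -> primitive r y ->
  primitive (q (+) r) (x * y - ssign q r *: (y * x)).
Proof.
move=> Hx Hy p f z; rewrite addrC -scaleNr ltr_linear der_linearf.
rewrite mulrDl -scalerAl [LHS]linearP -!mulrA. rewrite (Hx p f (y * z))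
  (Hy p f (x * z)) (Hy (q (+) p) (ltr f x) z).
rewrite (Hx (r (+) p) (ltr f y) z) (Hx p f z) (Hy p f z) !ltrM.
rewrite (addbCA r) [q (+) (r (+) p)]addbA mulrDl -scalerAl -!mulrA.
rewrite (ssignC _ (q (+) r)) !ssignD (ssignC _ r q) (ssignC _ p q)
  (ssignC _ p r).
have := ssignK K q r; move: (ssign q r) (ssign q p) (ssign r p) => a b c aa.
rewrite [y * (_ + _)]mulrDr [x * (_ + _)]mulrDr -!scalerAr.
rewrite !scalerDr !scalerA addrACA [X in X + _ = _]addrACA.
rewrite [X in _ + X = _]addrACA -[LHS]addrA; congr (_ + _).
have -> : - a * (a * b) = - b by rewrite mulrA mulNr aa mulN1r.
rewrite addrA [X in X + _ = _]addrACA mulNr !scaleNr.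
have -> : b * c * - a = - (a * c) * b by ring.
have opp (u v : T) : - u - v + (v + u) = 0 by rewrite addrA subrK addNr.
by rewrite opp add0r.
Qed.

End SkewDerivations.

(** * Ordered monomials in homogeneous Lie elements *)

Lemma sum_fibers (K : fieldType) (W : lmodType K) (A B : eqType)
    (S : seq B) (M : seq A) (h : A -> B) (a : A -> K) (F : B -> W) :
  uniq S -> (forall t, t \in M -> h t \in S) ->
  \sum_(u <- S) (\sum_(t <- M | h t == u) a t) *: F u =
    \sum_(t <- M) a t *: F (h t).
Proof.
move=> uS hS.
under eq_bigr => u _ do rewrite scaler_suml big_mkcond /=.
rewrite exchange_big /= big_seq [RHS]big_seq; apply: eq_bigr => t tM.
rewrite (bigD1_seq (h t)) ?hS //= eqxx big1 ?addr0 // => u.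
by rewrite eq_sym => /negPf->.
Qed.

Section HomogeneousSpans.
Variables (K : fieldType) (I : finType) (deg : I -> nat) (par : I -> bool).
Variable T : free_algebra K I.
Hypothesis deg_gt0 : forall a, (0 < deg a)%N.
Local Notation word := (word T).
Local Notation pwords := (pwords deg par).

Definition tspan (n : nat) (p : bool) : T -> Prop :=
  lspan (family (pwords n p) word).

Lemma tspan_subspace n p : is_subspace (tspan n p).
Proof. exact: lspan_subspace. Qed.

Lemma tspan_word w : tspan (wdeg deg w) (wpar par w) (word w).
Proof. by apply: lspan_gen; exists w; rewrite // mem_pwords // !eqxx. Qed.

Lemma tspan_par n p x : tspan n p x -> tpar par p x.
Proof.
apply: lspan_min; first exact: tpar_subspace.
by move=> y [w]; rewrite mem_pwords // => /andP[_ /eqP <-] ->; apply: tpar_word.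
Qed.

Lemma tspanM m p n q x y :
  tspan m p x -> tspan n q y -> tspan (m + n) (p (+) q) (x * y).
Proof.
move=> Hx Hy; have [Q0 Qlin] := tspan_subspace (m + n) (p (+) q).
move: x Hx; apply: lspan_min => [|x [v]].
  split=> [|c x z Hx Hz]; first by rewrite mul0r.
  by rewrite mulrDl -scalerAl; apply: Qlin.
rewrite mem_pwords // => /andP[/eqP vm /eqP vp] ->; move: y Hy.
apply: lspan_min => [|y [w]].
  split=> [|c y z Hy Hz]; first by rewrite mulr0.
  by rewrite mulrDr -scalerAr; apply: Qlin.
rewrite mem_pwords // => /andP[/eqP wn /eqP wq] ->; rewrite -word_cat.
by have := tspan_word (v ++ w); rewrite wdeg_cat wpar_cat vm vp wn wq.
Qed.

Lemma sum_wcoef_words (W : seq (seq I)) (c : seq I -> K) w : uniq W ->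
  wcoef T w (\sum_(v <- W) c v *: word v) = if w \in W then c w else 0.
Proof.
move=> uW; rewrite linear_sum /=; case: ifP => [wW|wW].
  rewrite (bigD1_seq w) //= linearZ /= wcoef_word eqxx big1 => [|v nv].
    by rewrite addr0 -[LHS]/(_ * _) mulr1.
  by rewrite linearZ /= wcoef_word (negPf nv) scaler0.
rewrite big_seq big1 // => v vW; rewrite linearZ /= wcoef_word.
by case: eqP => [vw|_]; rewrite ?scaler0 //; rewrite -vw vW in wW.
Qed.

Lemma independent_words (W : seq (seq I)) : uniq W -> independent W word.
Proof.
move=> uW c c0 w wW; have := sum_wcoef_words c w uW.
by rewrite c0 linear0 wW.
Qed.

Lemma tspan_dim n p : has_dim (tspan n p) (size (pwords n p)).
Proof.
have un := uniq_pwords deg par n p.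
exact: has_dim_family un (independent_words un) (fun x => iff_refl _).
Qed.

Lemma tspanE n p x : tspan n p x ->
  x = \sum_(w <- pwords n p) wcoef T w x *: word w.
Proof.
case/(lspan_familyP _ _ (uniq_pwords _ _ n p)) => c xE.
rewrite {1}xE big_seq [RHS]big_seq; apply: eq_bigr => w wn.
by rewrite xE sum_wcoef_words ?wn // uniq_pwords.
Qed.

Definition supported n p (f : seq I -> K) := forall w, w \notin pwords n p ->
  f w = 0.

Lemma ev_supported n p f n' p' x : supported n p f -> tspan n' p' x ->
  (n', p') != (n, p) -> ev T f x = 0.
Proof.
move=> fS Hx ne; move: x Hx; apply: lspan_min => [|x [w]].
  split=> [|c x z Hx Hz]; first by rewrite linear0.
  by rewrite linearP Hx Hz scaler0 addr0.
rewrite mem_pwords // => /andP[/eqP wn /eqP wp] ->; rewrite ev_word fS //.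
by rewrite mem_pwords // wn wp.
Qed.

(** The matrix of the coefficients of the F s on words is row free; a column
    of a right inverse gives the required values of f on words. *)
Lemma dual_form (X : eqType) (S : seq X) (F : X -> T) n p s0 :
  uniq S -> independent S F -> (forall s, s \in S -> tspan n p (F s)) ->
    s0 \in S ->
  exists2 f, supported n p f & forall s, s \in S -> ev T f (F s) = (s == s0)%:R.
Proof.
move=> uS iS FS s0S; set W := pwords n p.
have uW : uniq W by apply: uniq_pwords.
pose tS i := tnth (in_tuple S) i; pose tW j := tnth (in_tuple W) j.
pose M : 'M[K]_(size S, size W) := \matrix_(i, j) wcoef T (tW j) (F (tS i)).
have tSS i : tS i \in S by apply: mem_tnth.
have : row_free M.
  rewrite -kermx_eq0; apply/rowV0P => v /sub_kermxP vM; apply/rowP => i;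
    rewrite mxE.
  pose c s := \sum_(i | tS i == s) v 0 i.
  have cE j : c (tS j) = v 0 j.
    rewrite /c (big_pred1 j) // => l; rewrite eqtype.inj_eq //.
    by have /tuple_uniqP : uniq (in_tuple S) by [].
  rewrite -cE; apply: iS => //; apply: freealgP => w; rewrite linear0.
  rewrite big_tnth linear_sum /=.
  case: (boolP (w \in W)) => [wW|wW]; last first.
    rewrite big1 // => j _; rewrite linearZ /= (tspanE (FS _ (tSS j))).
    by rewrite sum_wcoef_words // (negPf wW) scaler0.
  have /tnthP[k wE] : w \in in_tuple W by [].
  move/rowP/(_ k): vM; rewrite !mxE => vMk; rewrite -[RHS]vMk.
  by apply: eq_bigr => j _; rewrite linearZ /= -[tnth _ _]/(tS j)
    cE mxE /tW -wE.
case/row_freeP => B MB; have /tnthP[i0 s0E] : s0 \in in_tuple S by [].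
pose f w := \sum_(j | tW j == w) B j i0.
have fE j : f (tW j) = B j i0.
  rewrite /f (big_pred1 j) // => l; rewrite eqtype.inj_eq //.
  by have /tuple_uniqP : uniq (in_tuple W) by [].
exists f => [w wW|s sS].
  by rewrite /f big1 // => j /eqP tw; rewrite -tw mem_tnth in wW.
have /tnthP[i sE] : s \in in_tuple S by [].
rewrite {1}(tspanE (FS _ sS)) linear_sum big_tnth /=.
have /matrixP/(_ i i0) := MB; rewrite !mxE => MBi.
transitivity ((i == i0)%:R : K); last first.
  rewrite sE s0E eqtype.inj_eq //.
  by have /tuple_uniqP : uniq (in_tuple S) by [].
rewrite -MBi; apply: eq_bigr => j _.
by rewrite linearZ /= ev_word -[tnth _ _]/(tW j) fE mxE /tS -sE.
Qed.

End HomogeneousSpans.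

Section OrderedMonomials.
Variables (K : fieldType) (charK : [pchar K] =i pred0).
Variables (I : finType) (deg : I -> nat) (par : I ->
  bool) (T : free_algebra K I).
Hypothesis deg_gt0 : forall a, (0 < deg a)%N.
Variables (N r : nat) (X : 'I_r -> T) (dg : 'I_r -> nat) (q : 'I_r -> bool).
Local Notation tspan := (@tspan K I deg par T).
Local Notation word := (word T).

Definition gens n p := [seq i <- enum 'I_r | (dg i == n) && (q i == p)].

Hypothesis dg_gt0 : forall i, (0 < dg i)%N.
Hypothesis X_span : forall i, tspan (dg i) (q i) (X i).
Hypothesis X_primitive : forall i, primitive par (q i) (X i).
Hypothesis X_indep : forall n p, (n <= N)%N -> independent (gens n p) X.
Hypothesis X_br : forall i j, (dg i + dg j <= N)%N ->
  lspan (family (gens (dg i + dg j) (q i (+) q j)) X) (tbr par (X i) (X j)).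
Hypothesis X_letter : forall a, (deg a <= N)%N ->
  lspan (family (gens (deg a) (par a)) X) (word [:: a]).

Definition mono (s : seq 'I_r) : T := \prod_(i <- s) X i.

Lemma mono_cons i s : mono (i :: s) = X i * mono s.
Proof. exact: big_cons. Qed.

Lemma mono_nil : mono [::] = 1.
Proof. exact: big_nil. Qed.

(** Ordered monomials: the indices decrease, and an odd generator occurs at
    most once. *)
Definition precedes : rel 'I_r := fun i j => (j < i)%N || ((i == j) && ~~ q i).

Definition monomials n p := [seq s <- pwords dg q n p | sorted precedes s].

Lemma precedes_trans : transitive precedes.
Proof.
move=> j i k /orP[ji|/andP[/eqP -> qj]] // /orP[kj|/andP[/eqP <- _]].
  by rewrite /precedes (ltn_trans kj ji).
by rewrite /precedes ji.
Qed.

Lemma mem_monomials n p s :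
  (s \in monomials n p) = [&& sorted precedes s, wdeg dg s == n & wpar q s ==
    p].
Proof. by rewrite mem_filter mem_pwords. Qed.

Lemma uniq_monomials n p : uniq (monomials n p).
Proof. exact/filter_uniq/uniq_pwords. Qed.

Lemma mono_span s : tspan (wdeg dg s) (wpar q s) (mono s).
Proof.
elim: s => [|i s IH].
  rewrite mono_nil -(word_nil T) !wdeg_nil !wpar_nil.
  by have := tspan_word par T deg_gt0 [::]; rewrite wdeg_nil wpar_nil.
by rewrite mono_cons wdeg_cons wpar_cons; apply: tspanM.
Qed.

(** ** Independence *)

(** The coproduct of a product of primitive elements runs over its subwords t
    with their complements; here h vanishes on all of them except the empty
    one. *)
Lemma der_mono_const p h c s :
  (forall t, subseq t s -> ev T h (mono t) = (t == [::])%:R * c) ->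
  der par T p h (mono s) = (ssign K (wpar q s) p * c) *: mono s.
Proof.
elim: s p h c => [|j s IH] p h c Hh.
  have := Hh [::] isT; rewrite mono_nil -(word_nil T) ev_word eqxx mul1r => hc.
  by rewrite /der wlin_word /= hc wpar_nil /ssign expr0 mul1r word_nil.
rewrite mono_cons X_primitive.
rewrite (IH _ _ 0) => [|t ts]; last first.
  by rewrite ev_ltr -mono_cons mulr0 Hh ?mul0r //= eqxx.
rewrite (IH p h c) => [|t ts]; last first.
  by apply: Hh; apply: subseq_trans ts (subseq_cons _ _).
rewrite mulr0 scale0r add0r -scalerAr scalerA wpar_cons mulrA.
by rewrite (ssignC _ (_ (+) _)) ssignD !(ssignC _ p).
Qed.

(** The multiplicity of i in s, up to the signs coming from the odd
    generators. *)
Fixpoint der_coef (i : 'I_r) (s : seq 'I_r) : K :=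
  if s is j :: s' then
    if j == i then 1 + ssign K (q i) (q i) * der_coef i s'
    else ssign K (q j) (q i) * der_coef i s'
  else 0.

Lemma der_coef_notin i s : i \notin s -> der_coef i s = 0.
Proof.
elim: s => //= j s IH; rewrite inE eq_sym negb_or => /andP[/negPf-> /IH ->].
by rewrite mulr0.
Qed.

Lemma der_coef_neq0 i s : sorted precedes s -> i \in s -> der_coef i s != 0.
Proof.
move=> srt si; case qi: (q i).
  elim: s srt si => //= j s IH srt; rewrite inE eq_sym.
  have srt' : sorted precedes s by apply: path_sorted srt.
  case: eqP => [ji _|_ /= si]; last by rewrite mulf_neq0 ?signr_eq0 ?IH.
  rewrite ji in srt; rewrite der_coef_notin ?mulr0 ?addr0 ?oner_eq0 //.
  apply/negP => si; have := order_path_min precedes_trans srt.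
  by move/allP/(_ _ si); rewrite /precedes ltnn eqxx qi.
have -> : der_coef i s = (count_mem i s)%:R.
  elim: s {srt si} => //= j s ->; rewrite /ssign qi !andbF expr0 !mul1r.
  by case: eqP; rewrite ?natrD // add0n.
by move/pcharf0P: charK => ->; rewrite -lt0n -has_count has_pred1.
Qed.

(** A form dual to the generator i differentiates ordered monomials with
    respect to i. *)
Lemma der_mono i f s : sorted precedes s ->
  (forall t, subseq t s -> ev T f (mono t) = (t == [:: i])%:R) ->
  der par T (q i) f (mono s) = der_coef i s *: mono (rem i s).
Proof.
elim: s f => [|j s IH] f srt Hf.
  rewrite mono_nil -(word_nil T) /der wlin_word /= scale0r -[f [::]](ev_word T).
  by rewrite (word_nil T) -mono_nil Hf // scale0r.
have srt' : sorted precedes s by apply: path_sorted srt.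
have Hs : der par T (q i) f (mono s) = der_coef i s *: mono (rem i s).
  by apply: IH => // t ts; apply: Hf; apply: subseq_trans ts (subseq_cons _ _).
rewrite mono_cons X_primitive Hs -scalerAr scalerA /=.
case: (eqVneq j i) => [ji|ne]; last first.
  rewrite (der_mono_const _ (c := 0)) => [|t ts]; last first.
    rewrite ev_ltr -mono_cons mulr0 Hf /= ?eqxx // eqseq_cons.
    by rewrite (negPf ne).
  by rewrite mulr0 scale0r add0r mono_cons.
rewrite ji (der_mono_const _ (c := 1)) => [|t ts]; last first.
  by rewrite ev_ltr -ji -mono_cons Hf /= ?eqxx // eqseq_cons ji eqxx mulr1.
rewrite addbb /ssign andbF expr0 mulr1 scale1r scalerDl scale1r; congr (_ + _).
case: (boolP (i \in s)) => [si|/der_coef_notin ->];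
  last by rewrite mulr0 !scale0r.
congr (_ *: _); rewrite -mono_cons; congr mono.
case: s srt si {IH Hf srt' Hs} => //= k s /andP[jk pth].
rewrite inE eq_sym; case: eqP => [-> //|nki /= si].
have := order_path_min precedes_trans pth => /allP/(_ _ si).
move: jk; rewrite ji /precedes => /orP[lt_ki|/andP[/eqP ik _]];
  last by case: nki.
by rewrite ltnNge (ltnW lt_ki) /= => /andP[/eqP ki]; rewrite ki ltnn in lt_ki.
Qed.

Lemma perm_sorted_eq s t : sorted precedes s -> sorted precedes t ->
  perm_eq s t -> s = t.
Proof.
pose geq_ord : rel 'I_r := fun i j => (j <= i)%N.
have sub : subrel precedes geq_ord.
  by move=> i j /orP[/ltnW //|/andP[/eqP -> _]]; rewrite /geq_ord.
move=> /(sub_sorted sub) ss /(sub_sorted sub) st.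
apply: (sorted_eq _ _ ss st) => [j i k ij jk|i j]; first exact: leq_trans jk ij.
by rewrite /geq_ord andbC -eqn_leq => /eqP/val_inj.
Qed.

Lemma wdeg_rem i s : i \in s -> wdeg dg s = (dg i + wdeg dg (rem i s))%N.
Proof. by move=> si; rewrite /wdeg (perm_big _ (perm_to_rem si)) big_cons. Qed.

Lemma wpar_rem i s : i \in s -> wpar q s = q i (+) wpar q (rem i s).
Proof. by move=> si; rewrite /wpar (perm_big _ (perm_to_rem si)) big_cons. Qed.

(** By induction on n.  For a generator i of degree less than n, the ordered
    monomials of degree dg i are independent, hence there is a form dual to i
    which vanishes on the other ones.  The corresponding skew derivation turns a
    relation in degree n into one in degree n - dg i, which forces c s = 0 for
    every monomial s containing i.  The other monomials of degree n are single
    generators, or empty if n = 0, and the generators are independent. *)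
Lemma independent_monomials n p : (n <= N)%N ->
  independent (monomials n p) mono.
Proof.
elim/ltn_ind: n p => n IH p le_nN c c0.
(* A monomial containing a generator of smaller degree has coefficient 0. *)
have small i s : (dg i < n)%N -> s \in monomials n p -> i \in s -> c s = 0.
  move=> lt_in sn si; have le_iN := leq_trans (ltnW lt_in) le_nN.
  have uS := uniq_monomials (dg i) (q i).
  have iS : [:: i] \in monomials (dg i) (q i).
    by rewrite mem_monomials /= wdeg_cons wpar_cons wdeg_nil wpar_nil addn0
      addbF !eqxx.
  have spanS t : t \in monomials (dg i) (q i) -> tspan (dg i) (q i) (mono t).
    by rewrite mem_monomials => /and3P[_ /eqP <- /eqP <-]; apply: mono_span.
  have [f fsupp fdual] := dual_form uS (IH _ lt_in (q i) le_iN) spanS iS.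
  have fE t : sorted precedes t -> ev T f (mono t) = (t == [:: i])%:R.
    move=> srt; case: (boolP ((wdeg dg t, wpar q t) == (dg i, q i))) =>
      [/eqP[td tp]|ne].
      by apply: fdual; rewrite mem_monomials srt td tp !eqxx.
    rewrite (ev_supported deg_gt0 fsupp (mono_span t) ne); case: eqP => // ti.
    by move: ne; rewrite ti wdeg_cons wpar_cons wdeg_nil wpar_nil addn0 addbF
      eqxx.
  have dE t : t \in monomials n p ->
      der par T (q i) f (mono t) = der_coef i t *: mono (rem i t).
    rewrite mem_monomials => /and3P[srt _ _]; apply: der_mono => // u ut.
    by apply: fE; apply: subseq_sorted ut srt; apply: precedes_trans.
  have rem_in t : t \in monomials n p -> i \in t ->
      rem i t \in monomials (n - dg i) (q i (+) p).
    rewrite !mem_monomials => /and3P[srt /eqP <- /eqP <-] it.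
    rewrite (subseq_sorted precedes_trans (rem_subseq i t) srt) (wdeg_rem it)
      addKn.
    by rewrite (wpar_rem it) addKb !eqxx.
  pose M := [seq t <- monomials n p | i \in t].
  have := congr1 (der par T (q i) f) c0; rewrite linear0 linear_sum /=.
  rewrite big_seq (eq_bigr (fun t => (c t * der_coef i t) *: mono (rem i t)));
    last first.
    by move=> t tn; rewrite linearZ /= dE // scalerA.
  rewrite -big_seq (bigID (fun t => i \in t)) /= [X in _ + X]big1 ?addr0;
    last first.
    by move=> t /der_coef_notin ->; rewrite mulr0 scale0r.
  rewrite -big_filter -/M => cM.
  (* On ordered monomials containing i, the map rem i is injective, so that
     c' (rem i s) has the single term c s * der_coef i s. *)
  pose c' u := \sum_(t <- M | rem i t == u) c t * der_coef i t.
  have c'0 : \sum_(u <- monomials (n - dg i) (q i (+) p)) c' u *: mono u = 0.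
    rewrite -[RHS]cM; apply: sum_fibers; first exact: uniq_monomials.
    by move=> t; rewrite mem_filter => /andP[it tn]; apply: rem_in.
  have := IH (n - dg i)%N _ (q i (+) p) _ c' c'0 (rem i s) (rem_in s sn si).
  rewrite ltn_subrL dg_gt0 (leq_ltn_trans _ lt_in) // => /(_ isT).
  rewrite (leq_trans (leq_subr _ _) le_nN) => /(_ isT).
  have sM : s \in M by rewrite mem_filter si.
  rewrite /c' (big_rem s sM) /= eqxx big1_seq ?addr0 => [|t].
    have srt : sorted precedes s by move: sn; rewrite mem_monomials => /and3P[].
    move/eqP; rewrite mulf_eq0 => /orP[/eqP //|/eqP k0].
    by have := der_coef_neq0 srt si; rewrite k0 eqxx.
  have uM : uniq M by apply/filter_uniq/uniq_monomials.
  rewrite mem_rem_uniq // inE mem_filter => /andP[/eqP remE /and3P[ts it tn]].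
  case/eqP: ts; apply: perm_sorted_eq.
  - by move: tn; rewrite mem_monomials => /and3P[].
  - by move: sn; rewrite mem_monomials => /and3P[].
  rewrite (perm_trans (perm_to_rem it)) // remE perm_sym.
  exact: perm_to_rem.
have big s : s \in monomials n p ->
    c s = 0 \/ (exists2 i, s = [:: i] & i \in gens n p) \/ (s = [::] /\ n =
      0%N).
  move=> sn; have := sn; rewrite mem_monomials => /and3P[_ /eqP sd /eqP sp].
  case: s sn sd sp => [|i s] sn sd sp.
    by right; right; rewrite -sd wdeg_nil.
  case: (ltnP (dg i) n) => [lt_in|le_ni].
    by left; apply: (small i); rewrite ?mem_head.
  right; left; exists i.
    case: s sn sd sp => // j s _; rewrite !wdeg_cons => sd _.
    have := dg_gt0 j; rewrite -(ltn_add2l (dg i)) addn0 => lt_i.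
    suff : (n < n)%N by rewrite ltnn.
    rewrite -{2}sd; apply: leq_ltn_trans le_ni _; apply: leq_trans lt_i _.
    by rewrite addnA leq_addr.
  rewrite mem_filter mem_enum andbT.
  have dn : dg i == n by rewrite eqn_leq le_ni andbT -sd wdeg_cons leq_addr.
  rewrite dn /= -sp; case: s sd {sp sn} => [|j s].
    by rewrite wpar_cons wpar_nil addbF.
  rewrite !wdeg_cons (eqP dn) -[X in _ = X]addn0 => /addnI/eqP.
  by rewrite addn_eq0 eqn0Ngt dg_gt0.
case: (posnP n) => [n0|n0] s sn.
  have [//|[[i sE]|[sE _]]] := big s sn.
    by rewrite mem_filter n0 eqn0Ngt dg_gt0.
  have s1 : monomials n p = [:: [::]].
    move: sn; rewrite sE /monomials /pwords n0 words0 //= wpar_nil.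
    by case: eqP.
  move: c0; rewrite s1 big_seq1 mono_nil sE => /eqP.
  by rewrite scaler_eq0 oner_eq0 orbF => /eqP.
have [//|[[i sE ig]|[_ nE]]] := big s sn; last by rewrite nE in n0.
have ci : \sum_(j <- gens n p) c [:: j] *: X j = 0.
  have gm j : j \in gens n p -> [:: j] \in monomials n p.
    rewrite mem_filter => /andP[/andP[/eqP jd /eqP jp] _].
    by rewrite mem_monomials /= wdeg_cons wpar_cons wdeg_nil wpar_nil addn0
      addbF jd jp !eqxx.
  rewrite -[RHS]c0 (bigID (fun t => t \in [seq [:: j] | j <- gens n p])) /=.
  rewrite [X in _ + X]big1_seq ?addr0 => [|t /andP[tg tn]]; last first.
    have [->|[[j tE jg]|[_ nE]]] := big t tn; first by rewrite scale0r.
      by case/mapP: tg; exists j.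
    by rewrite nE in n0.
  rewrite -[RHS]big_filter [RHS](perm_big [seq [:: j] | j <- gens n p]) /=.
    by rewrite big_map; apply: eq_bigr => j _; rewrite mono_cons mono_nil mulr1.
  apply: uniq_perm.
  - exact/filter_uniq/uniq_monomials.
  - rewrite map_inj_uniq; first exact/filter_uniq/enum_uniq.
    by move=> j k [].
  move=> t; rewrite mem_filter andb_idr // => /mapP[j jg ->].
  exact: gm.
by rewrite sE; exact: (@X_indep n p le_nN (fun j => c [:: j]) ci i ig).
Qed.

(** ** Spanning *)

Definition short_monomials m n p := [seq s <- monomials n p | (size s <= m)%N].

Definition filtration m n p : T -> Prop := lspan (family (short_monomials m n p)
  mono).

Lemma filtration_sorted s : sorted precedes s ->
  filtration (size s) (wdeg dg s) (wpar q s) (mono s).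
Proof.
move=> srt; apply: lspan_gen; exists s => //.
by rewrite mem_filter leqnn mem_monomials srt !eqxx.
Qed.

Lemma filtration_le m m' n p x : (m <= m')%N ->
  filtration m n p x -> filtration m' n p x.
Proof.
move=> le_mm; apply: lspan_min; first exact: lspan_subspace.
move=> y [s]; rewrite mem_filter => /andP[sm sn] ->; apply: lspan_gen.
by exists s; rewrite // mem_filter sn (leq_trans sm).
Qed.

Definition straightens m := forall t, (size t <= m)%N -> (wdeg dg t <= N)%N ->
  filtration m (wdeg dg t) (wpar q t) (mono t).

Lemma bracket_mul_filtration j k s : straightens (size s).+1 ->
  (dg j + (dg k + wdeg dg s) <= N)%N ->
  filtration (size s).+1 (dg j + (dg k + wdeg dg s)) (q j (+) (q k (+)
    wpar q s))
    (tbr par (X j) (X k) * mono s).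
Proof.
move=> st le_N; have [F0 Flin] := lspan_subspace (family
  (short_monomials (size s).+1 (dg j + (dg k + wdeg dg s)) (q j (+) (q k (+)
    wpar q s))) mono).
have le_jk : (dg j + dg k <= N)%N.
  by apply: leq_trans le_N; rewrite addnA leq_addr.
move: (tbr _ _ _) (X_br le_jk); apply: lspan_min => [|y [l]].
  split=> [|c x y Hx Hy]; first by rewrite mul0r.
  by rewrite mulrDl -scalerAl; apply: Flin.
rewrite mem_filter => /andP[/andP[/eqP ld /eqP lp] _] ->; rewrite -mono_cons.
have := st (l :: s); rewrite wdeg_cons wpar_cons ld lp -addnA -addbA.
by apply.
Qed.

(** Multiplying an ordered monomial by a generator: moving the generator to its
    place produces brackets, which shorten the monomial. *)
Lemma mul_monomial j s : (forall m, (m <= size s)%N -> straightens m) ->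
  sorted precedes s -> (dg j + wdeg dg s <= N)%N ->
  lspan (family [seq u <- monomials (dg j + wdeg dg s) (q j (+) wpar q s)
      | (size u <= size s)%N || (size u <= (size s).+1)%N && all (mem (j :: s))
        u] mono)
    (X j * mono s).
Proof.
elim: s => [|k s IH] st srt le_N.
  rewrite -mono_cons -wdeg_cons -wpar_cons; apply: lspan_gen;
    exists [:: j] => //.
  by rewrite mem_filter mem_monomials !eqxx /= inE eqxx.
have srt' : sorted precedes s by apply: path_sorted srt.
have jk_deg : (dg j + (dg k + wdeg dg s) <= N)%N by move: le_N;
  rewrite wdeg_cons.
case: (boolP (precedes j k)) => [jk|njk].
  rewrite -mono_cons -wdeg_cons -wpar_cons; apply: lspan_gen;
    exists [:: j, k & s] => //.
  rewrite mem_filter mem_monomials !eqxx /= jk (srt :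
    path precedes k s) leqnn /= !inE !eqxx !orbT /=.
  rewrite ltnn andbT /=; apply/allP => i si.
  by rewrite !inE si !orbT.
set Q := lspan _.
have Qs : is_subspace Q by apply: lspan_subspace.
have filQ x : filtration (size (k :: s)) (dg j + wdeg dg (k :: s)) (q j (+)
  wpar q (k :: s)) x -> Q x.
  apply: lspan_min => // y [u]; rewrite mem_filter => /andP[us un] ->.
  by apply: lspan_gen; exists u; rewrite // mem_filter us un.
have brQ : Q (tbr par (X j) (X k) * mono s).
  apply: filQ; rewrite wdeg_cons wpar_cons; apply: bracket_mul_filtration => //.
  exact: st.
have Xpar i : tpar par (q i) (X i) by apply: tspan_par (X_span i).
have brE : X j * X k = tbr par (X j) (X k) + ssign K (q j) (q k) *: (X k * X j).
  by rewrite (tbrE (Xpar j) (Xpar k)) subrK.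
(* The square of an odd generator is half its bracket with itself. *)
case: (eqVneq j k) => [jk|ne].
  have qk : q k by move: njk; rewrite jk /precedes ltnn eqxx /= negbK.
  rewrite mono_cons mulrA (_ : X j * X k = 2^-1 *: tbr par (X j) (X k)).
    by rewrite -scalerAl; apply: subspaceZ.
  rewrite (tbrE (Xpar j) (Xpar k)) jk /ssign qk expr1 scaleN1r opprK -mulr2n.
  rewrite -scaler_nat scalerA mulVf ?scale1r //.
  by move/pcharf0P: charK => ->.
have lt_jk : (j < k)%N.
  by move: njk; rewrite /precedes (negPf ne) orbF -leqNgt ltn_neqAle ne.
(* After the exchange of j and k, the monomials in which k comes first are
   ordered, because all their letters are j or come from s. *)
rewrite mono_cons mulrA brE mulrDl -scalerAl -mulrA.
apply: subspaceD => //; apply: subspaceZ => //.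
have le_js : (dg j + wdeg dg s <= N)%N.
  by apply: leq_trans jk_deg; rewrite leq_add2l leq_addl.
have st' m : (m <= size s)%N -> straightens m by move=> ms; apply: st;
  apply: leqW.
move: (X j * mono s) (IH st' srt' le_js); apply: lspan_min => [|y [u]].
  split=> [|c x y Hx Hy]; first by rewrite mulr0; case: Qs.
  by rewrite mulrDr -scalerAr; apply: (proj2 Qs).
rewrite mem_filter => /andP[us]; rewrite mem_monomials =>
  /and3P[su /eqP ud /eqP up] ->.
rewrite -mono_cons.
have kud : wdeg dg (k :: u) = (dg j + wdeg dg (k :: s))%N.
  by rewrite !wdeg_cons ud addnCA.
have kup : wpar q (k :: u) = q j (+) wpar q (k :: s).
  by rewrite !wpar_cons up addbCA.
case/orP: us => [us|/andP[us ua]].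
  apply: filQ; rewrite -kud -kup; apply: st => //.
  by rewrite kud wdeg_cons.
apply: lspan_gen; exists (k :: u) => //.
rewrite mem_filter mem_monomials kud kup !eqxx !andbT /=.
have ksrt : path precedes k u.
  rewrite path_min_sorted //; apply/allP => i iu; have := allP ua _ iu.
  rewrite /= inE => /predU1P[->|si]; first by rewrite /precedes lt_jk.
  by have := order_path_min precedes_trans srt => /allP/(_ _ si).
rewrite ksrt andbT; apply/orP; right; rewrite ltnS us !inE eqxx orbT /=.
apply/allP => i iu; have := allP ua _ iu.
by rewrite /= !inE => /predU1P[->|->]; rewrite ?eqxx ?orbT.
Qed.

(** By induction on the length; an unordered product is straightened from the
    right. *)
Lemma straighten m : straightens m.
Proof.
elim/ltn_ind: m => -[|m] IH [|j t] //=.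
- by move=> _ _; apply: filtration_sorted.
- by move=> _ _; apply: filtration_le (filtration_sorted (s := [::]) isT).
rewrite ltnS wdeg_cons wpar_cons => tm le_N.
have tN : (wdeg dg t <= N)%N by apply: leq_trans le_N; rewrite leq_addl.
rewrite mono_cons.
move: (mono t) (IH m (ltnSn m) t tm tN); apply: lspan_min => [|y [s]].
  have [F0 Flin] := lspan_subspace (family
    (short_monomials m.+1 (dg j + wdeg dg t) (q j (+) wpar q t)) mono).
  split=> [|c x y Hx Hy]; first by rewrite mulr0.
  by rewrite mulrDr -scalerAr; apply: Flin.
rewrite mem_filter => /andP[sm]; rewrite mem_monomials =>
  /and3P[srt /eqP sd /eqP sp] ->.
rewrite -sd -sp.
have le_js : (dg j + wdeg dg s <= N)%N by rewrite sd.
have st l : (l <= size s)%N -> straightens l.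
  by move=> ls; apply: IH; rewrite ltnS (leq_trans ls).
move: (mul_monomial st srt le_js); apply: lspan_min;
  first exact: lspan_subspace.
move=> z [u]; rewrite mem_filter => /andP[us un] ->; apply: lspan_gen;
  exists u => //.
rewrite mem_filter un andbT; case/orP: us => [us|/andP[us _]].
  by apply: (leq_trans us); apply: (leq_trans sm).
by apply: (leq_trans us); rewrite ltnS.
Qed.

Lemma span_monomials n p x : (n <= N)%N ->
  tspan n p x <-> lspan (family (monomials n p) mono) x.
Proof.
move=> le_nN; split; apply: lspan_min; try exact: lspan_subspace; move=> y [w].
  rewrite mem_pwords // => /andP[/eqP wn /eqP wp] ->; rewrite -wp -wn.
  have {n p wn wp le_nN} : (wdeg deg w <= N)%N by rewrite wn.
  elim: w => [|a w IH] le_wN.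
    rewrite (word_nil T) -mono_nil !wdeg_nil !wpar_nil; apply: lspan_gen.
    by exists [::]; rewrite // mem_monomials wdeg_nil wpar_nil.
  rewrite wdeg_cons wpar_cons in le_wN *; rewrite -[a :: w]cat1s word_cat.
  have aN : (deg a <= N)%N by apply: leq_trans le_wN; rewrite leq_addr.
  have wN : (wdeg deg w <= N)%N by apply: leq_trans le_wN; rewrite leq_addl.
  have [F0 Flin] := lspan_subspace (family
    (monomials (deg a + wdeg deg w) (par a (+) wpar par w)) mono).
  move: (word w) (IH wN); apply: lspan_min => [|y' [s]].
    split=> [|c x' z Hx Hz]; first by rewrite mulr0.
    by rewrite mulrDr -scalerAr; apply: Flin.
  rewrite mem_monomials => /and3P[_ /eqP sd /eqP sp] ->.
  move: (word [:: a]) (X_letter aN); apply: lspan_min => [|y'' [l]].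
    split=> [|c x' z Hx Hz]; first by rewrite mul0r.
    by rewrite mulrDl -scalerAl; apply: Flin.
  rewrite mem_filter => /andP[/andP[/eqP ld /eqP lp] _] ->; rewrite -mono_cons.
  have := @straighten (size (l :: s)) (l :: s) (leqnn _).
  rewrite wdeg_cons wpar_cons ld lp sd sp => /(_ le_wN).
  apply: lspan_min; first by split.
  move=> z [u]; rewrite mem_filter => /andP[_ un] ->.
  by apply: lspan_gen; exists u.
by rewrite mem_monomials => /and3P[_ /eqP <- /eqP <-] ->; apply: mono_span.
Qed.

(** The Poincare-Birkhoff-Witt theorem, as an equality of dimensions. *)
Lemma size_monomials n p : (n <= N)%N ->
  size (monomials n p) = size (pwords deg par n p).
Proof.
move=> le_nN; apply: has_dim_uniq (tspan_dim deg par T n p).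
apply: has_dim_family; first exact: uniq_monomials.
  exact: independent_monomials.
by move=> x; apply: span_monomials.
Qed.

End OrderedMonomials.

(** * Counting ordered monomials *)

Lemma one_minus_pow1 d n : (0 < d)%N ->
  one_minus_pow d 1 n = (n == 0%N)%:R - (n == d)%:R.
Proof.
move=> d0; rewrite /one_minus_pow; case: ifP => [/dvdnP[m ->]|ndn]; last first.
  have -> : (n == 0%N) = false by apply: contraFF ndn => /eqP->; apply: dvdn0.
  have -> : (n == d) = false by apply: contraFF ndn => /eqP->.
  by rewrite subr0.
rewrite mulnK // muln_eq0 [d == 0%N]gtn_eqF // orbF.
rewrite -{2}[d]mul1n eqn_pmul2r //; case: m => [|[|m]].
- by rewrite expr0 mul1r /gen_binomial big_ord0 fact0 divr1 subr0.
- by rewrite expr1 /gen_binomial big_ord1 subr0 divr1.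
by rewrite /gen_binomial 2!big_ord_recl /= subrr mul0r mulr0 mul0r mulr0 subr0.
Qed.

Lemma fps_mul_one_minus d f n : (0 < d)%N ->
  fps_mul (one_minus_pow d 1) f n = f n - (if (d <= n)%N then f (n - d)%N else
    0).
Proof.
move=> d0; rewrite /fps_mul.
under eq_bigr => i _ do rewrite one_minus_pow1 // mulrBl.
rewrite sumrB; congr (_ - _).
  rewrite big_ord_recl /= mul1r subn0 big1 ?addr0 // => i _.
  by rewrite mul0r.
case: leqP => [le_dn|lt_nd]; last first.
  rewrite big1 // => i _; rewrite ltn_eqF ?mul0r //.
  by apply: leq_ltn_trans lt_nd; rewrite -ltnS.
have lt_d : (d < n.+1)%N by rewrite ltnS.
rewrite (bigD1 (Ordinal lt_d)) //= eqxx mul1r big1 ?addr0 // => i.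
by rewrite -val_eqE /= => /negPf->; rewrite mul0r.
Qed.

Section MonomialCount.
Variables (r : nat) (dg : 'I_r -> nat) (q : 'I_r -> bool).
Hypothesis dg_gt0 : forall i, (0 < dg i)%N.
Local Notation sgn s := ((-1) ^+ wpar q s : rat).

Definition below (i : nat) (s : seq 'I_r) : bool :=
  sorted (precedes q) s && all (fun j : 'I_r => (j < i)%N) s.

Definition monomial_series (i : nat) : fps :=
  fun n => \sum_(s <- words dg n) (below i s)%:R * sgn s.

Lemma all_below (i a : 'I_r) w m : sorted (precedes q) (a :: w) -> (a < m)%N ->
  all (fun j : 'I_r => (j < m)%N) w.
Proof.
move=> srt am; have := order_path_min (@precedes_trans r q) srt.
apply: sub_all => j /orP[ja|/andP[/eqP <- _]] //; exact: ltn_trans ja am.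
Qed.

(** Indices decrease along an ordered monomial, so that only an initial segment
    of it can have the largest index allowed. *)
Lemma below_cons (i a : 'I_r) w : (below i.+1 (a :: w))%:R =
  (below i (a :: w))%:R + (if a == i then (below (if q i then i :
    nat else i.+1) w)%:R else 0) :> rat.
Proof.
rewrite /below; case: eqP => [->|ne]; last first.
  rewrite addr0; congr (_%:R); case srt: (sorted _ _) => //=.
  have ai : (a < i.+1)%N = (a < i)%N.
    by rewrite ltnS leq_eqVlt -[_ == _ :> nat]/(a == i) (introF eqP ne).
  rewrite ai; case: ltnP => // lt_ai; rewrite !(all_below i srt) //.
  exact: ltnW.
rewrite /= ltnn andbF add0r ltnS leqnn /=; congr (nat_of_bool _)%:R.
case: (boolP (q i)) => qi; last first.
  case srt': (sorted _ w); last by rewrite (negbTE (contraFN (@path_sorted _ _ _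
    _) srt')).
  case al: (all _ w); rewrite ?andbF // !andbT path_min_sorted ?srt' //.
  apply/allP => j jw; have := allP al _ jw; rewrite ltnS leq_eqVlt /precedes.
  by case/orP=> [/eqP/val_inj ->|->] //; rewrite eqxx qi orbT.
apply/andP/andP => [[srt _]|[srt al]].
  split; first exact: path_sorted srt.
  apply/allP => j jw; have := order_path_min (@precedes_trans r q) srt.
  by move/allP/(_ _ jw); rewrite /precedes qi andbF orbF.
split; last by apply: sub_all al => j; apply: ltnW.
rewrite path_min_sorted //; apply/allP => j jw.
by rewrite /precedes (allP al _ jw).
Qed.

Lemma monomial_series_rec (i : 'I_r) n : monomial_series i.+1 n =
  monomial_series i n + (if (dg i <= n)%N then
     (-1) ^+ q i * monomial_series (if q i then i :
       nat else i.+1) (n - dg i)%N else 0).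
Proof.
case: (posnP n) => [->|n0].
  rewrite /monomial_series words0 // !big_seq1 /below /=.
  by rewrite leqNgt dg_gt0 addr0.
rewrite {1 2}/monomial_series sum_words_rec // [X in _ = X + _]sum_words_rec //.
have -> : \sum_(a | (dg a <= n)%N) \sum_(w <- words dg (n - dg a))
    (below i.+1 (a :: w))%:R * sgn (a :: w) =
  \sum_(a | (dg a <= n)%N) \sum_(w <- words dg (n - dg a))
    (below i (a :: w))%:R * sgn (a :: w) +
  \sum_(a | (dg a <= n)%N) if a == i then \sum_(w <- words dg (n - dg a))
    (below (if q i then i : nat else i.+1) w)%:R * sgn (a :: w) else 0.
  rewrite -big_split; apply: eq_bigr => a _ /=.
  under eq_bigr => w _ do rewrite below_cons mulrDl.
  rewrite big_split /=; congr (_ + _); case: (a == i) => //.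
  by rewrite big1 // => w _; rewrite mul0r.
congr (_ + _); rewrite -big_mkcondr /=.
case: (leqP (dg i) n) => [le_in|lt_in]; last first.
  by rewrite big1 // => a /andP[le_an /eqP ai]; move: lt_in;
    rewrite -ai ltnNge le_an.
rewrite (big_pred1 i) => [|a]; last first.
  by rewrite /= andb_idl // => /eqP->.
rewrite mulr_sumr; apply: eq_bigr => w _.
by rewrite wpar_cons signr_addb mulrCA.
Qed.

Local Notation factor p i :=
  (\big[fps_mul/fps_one]_(j < r | (j < i)%N && (q j == p)) one_minus_pow (dg j)
    1).

(** Adjoining the generator i, of degree d, multiplies the signed count of the
    ordered monomials by 1 - z^d if i is odd, and divides it by 1 - z^d if i is
    even. *)
Lemma monomial_series_prod i : (i <= r)%N ->
  fps_mul (factor false i) (monomial_series i) = factor true i.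
Proof.
elim: i => [|i IH] le_ir.
  rewrite !big_pred0 // fps_mul1l; apply: functional_extensionality => n.
  rewrite /monomial_series; case: n => [|n].
    by rewrite words0 // big_seq1 wpar_nil /below /= mulr1.
  rewrite big_seq big1 // => -[|a s]; rewrite /below /=.
    by rewrite mem_words // wdeg_nil.
  by rewrite andbF mul0r.
pose j := Ordinal le_ir.
have step p : factor p i.+1 =
    (if q j == p then fps_mul (one_minus_pow (dg j) 1) (factor p i)
      else factor p i).
  case: ifP => qp.
    rewrite (bigD1 j) /= ?ltnS ?leqnn ?qp //; congr fps_mul;
      apply: eq_bigl => l.
    by rewrite ltnS leq_eqVlt -[_ == _ :> nat]/(l == j); case: eqP => [->|];
      rewrite ?ltnn ?andbF ?andbT.
  apply: eq_bigl => l; rewrite ltnS leq_eqVlt -[_ == _ :> nat]/(l == j).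
  by case: eqP => [->|] //; rewrite ltnn qp !andbF.
have {IH} := IH (ltnW le_ir); rewrite !step.
have rec := monomial_series_rec j; rewrite [j.+1]/= in rec.
case: (boolP (q j)) rec => qj rec /= <-.
  rewrite (_ : monomial_series i.+1 = fps_mul (one_minus_pow (dg j) 1)
    (monomial_series i)).
    by rewrite fps_mulA [RHS]fps_mulA (fps_mulC (factor false i)).
  apply: functional_extensionality => n; rewrite fps_mul_one_minus // rec.
  by case: ifP => _; rewrite ?subr0 ?addr0 // expr1 mulN1r.
rewrite (fps_mulC (one_minus_pow _ _)) -fps_mulA; congr fps_mul.
apply: functional_extensionality => n; rewrite fps_mul_one_minus // [X in X -
  _]rec.
by case: ifP => _; rewrite ?subr0 ?addr0 // expr0 mul1r addrK.
Qed.

Lemma monomial_seriesE n : monomial_series r n =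
  (size (monomials dg q n false))%:R - (size (monomials dg q n true))%:R.
Proof.
rewrite /monomial_series /monomials /pwords !size_filter !count_filter.
elim: (words dg n) => [|w s IH]; first by rewrite big_nil subr0.
have all_r : all (fun j : 'I_r => (j < r)%N) w by apply/allP => j _;
  apply: ltn_ord.
rewrite big_cons IH /= /below all_r andbT.
by case: (sorted _ w); case: (wpar q w); rewrite /= ?natrD ?expr1 ?expr0 /=;
  ring.
Qed.

(** If E and O denote the products of the 1 - z^d over the even and the odd
    generators, then E f agrees with O up to degree N.  The logarithmic
    derivative of 1 - z^d is - d (z^d + z^(2d) + ...). *)
Lemma log_der_monomials (f h : fps) N : f 0%N = 1 -> log_der h f ->
  (forall n, (n <= N)%N -> monomial_series r n = f n) ->
  forall n, (0 < n <= N)%N ->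
    h n = \sum_(j < r | (dg j %| n)%N) (-1) ^+ q j * (dg j)%:R.
Proof.
move=> f0 hf fE n /andP[n0 le_nN].
have F p : log_der (fun n => \sum_(j < r | (j < r)%N && (q j == p))
    geom (dg j) (- (1 * (dg j)%:R)) n) (factor p r).
  by apply: log_der_big => j _; apply: log_der_one_minus_pow.
have := log_der_inj (N := N) _ (log_der_mul (F false) hf) (F true).
have E0 : factor false r 0%N = 1.
  rewrite fps_bigmul0 big1 // => j _; rewrite one_minus_pow1 //.
  by rewrite [_ == dg j]ltn_eqF ?subr0.
rewrite {1}/fps_mul big_ord1 E0 mul1r f0 => /(_ erefl) H.
have {}H : \sum_(j < r | (j < r)%N && (q j == false)) geom (dg j)
  (- (1 * (dg j)%:R)) n + h n =
    \sum_(j < r | (j < r)%N && (q j == true)) geom (dg j) (- (1 * (dg j)%:R)) n.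
  apply: H le_nN => m le_mN; rewrite -(monomial_series_prod (leqnn r)).
  apply: eq_bigr => i _; rewrite fE //.
  by rewrite (leq_trans _ le_mN) // leq_subr.
move: H => /(canRL (addKr _)) ->.
rewrite [RHS]big_mkcond -sumrN [X in X + _]big_mkcond [X in _ + X]big_mkcond
  -big_split.
apply: eq_bigr => j _ /=; rewrite ltn_ord /geom n0 /= mul1r.
case: (dg j %| n)%N; case: (q j); rewrite ?expr1 ?expr0 ?mulN1r ?mul1r ?opprK
  ?oppr0 ?addr0 ?add0r //.
Qed.

End MonomialCount.

(** * The superdimension of the homogeneous components of L *)

Section LieDimension.
Variables (K : fieldType) (charK : [pchar K] =i pred0).
Variables (I : finType) (deg : I -> nat) (par : I -> bool).
Variables (L : lieSuperalgebra K) (E : I -> L) (T : free_algebra K I).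
Variable g : {linear L -> freealg_lie par T}.
Hypothesis deg_gt0 : forall a, (0 < deg a)%N.
Hypothesis E_par : forall a, lie_par (par a) (E a).
Hypothesis g_hom : lie_hom g.
Hypothesis gE : forall a, g (E a) = word T [:: a].
Local Notation wdeg := (wdeg deg).
Local Notation wpar := (wpar par).
Local Notation pwords := (pwords deg par).
Local Notation rbr := (rbr E).
Local Notation rspan := (rspan deg par E).

Lemma primitive_rbr w : primitive par (wpar w) (g (rbr w)).
Proof.
elim: w => [|a [|b u] IH].
- by rewrite linear0; case: (primitive_subspace par T (wpar [::])).
- by rewrite /= gE wpar_cons wpar_nil addbF; apply: primitive_letter.
rewrite (g_rbr_cons E_par g_hom gE) wpar_cons; apply: primitive_comm => //.
exact: primitive_letter.
Qed.

Lemma g_rspan n p x : rspan n p x -> tspan deg par n p (g x).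
Proof.
have [_ Tlin] := tspan_subspace deg par T n p.
have T0 := proj1 (tspan_subspace deg par T n p).
move: x; apply: lspan_min => [|x [w]].
  split=> [|c x y Hx Hy]; first by rewrite linear0.
  by rewrite linearP; apply: Tlin.
rewrite mem_pwords // => /andP[/eqP <- /eqP <-] -> {x n p Tlin T0}.
elim: w => [|a [|b u] IH].
- by rewrite linear0; case: (tspan_subspace deg par T (wdeg [::]) (wpar [::])).
- by rewrite /= gE; apply: tspan_word.
rewrite (g_rbr_cons E_par g_hom gE) addrC -scaleNr [wdeg _]wdeg_cons [wpar
  _]wpar_cons.
have Ta : tspan deg par (deg a) (par a) (word T [:: a]).
  by have := tspan_word par T deg_gt0 [:: a]; rewrite wdeg_cons wpar_cons
    wdeg_nil wpar_nil addn0 addbF.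
apply: (proj2 (tspan_subspace deg par T _ _)); last exact: tspanM.
by rewrite addnC addbC; apply: tspanM.
Qed.

Variable N : nat.

(** A basis of each component of degree at most N, chosen among the right-normed
    brackets of words, so that a basis element inherits its degree and its
    parity from its word. *)
Lemma exists_bases : exists G : seq (seq I), [/\ uniq G,
  forall w, w \in G -> (0 < wdeg w)%N,
  forall n p, (0 < n <= N)%N ->
    independent [seq w <- G | (wdeg w == n) && (wpar w == p)] rbr
  & forall n p x, (0 < n <= N)%N -> rspan n p x ->
    lspan (family [seq w <- G | (wdeg w == n) && (wpar w == p)] rbr) x].
Proof.
have /(fin_all_exists)[S HS] : forall np : 'I_N * bool, exists S,
    [/\ subseq S (pwords np.1.+1 np.2), independent S rbr
      & forall x, rspan np.1.+1 np.2 x <-> lspan (family S rbr) x].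
  by move=> [n p]; apply: sub_basis; apply: uniq_pwords.
pose G := undup (flatten (codom S)); exists G.
have memG w : w \in G -> exists np : 'I_N * bool,
    [/\ w \in S np, wdeg w = np.1.+1 & wpar w = np.2].
  rewrite mem_undup => /flattenP[s /codomP[np ->] wS]; exists np; split=> //.
    by have [sub _ _] := HS np; have := mem_subseq sub wS;
      rewrite mem_pwords // => /andP[/eqP].
  by have [sub _ _] := HS np; have := mem_subseq sub wS;
    rewrite mem_pwords // => /andP[_ /eqP].
have GE (np : 'I_N * bool) w : w \in [seq w <- G | (wdeg w == np.1.+1)
  && (wpar w == np.2)] = (w \in S np).
  rewrite mem_filter; apply/idP/idP => [/andP[/andP[/eqP wn /eqP wp]]|wS].
    move/memG=> [np' [wS wn' wp']]; rewrite (_ : np = np') //.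
    apply/eqP; rewrite -pair_eqE /= -val_eqE /= -eqSS -wn -wn' -wp -wp'.
    by rewrite !eqxx.
  have [sub _ _] := HS np; have := mem_subseq sub wS;
    rewrite mem_pwords // => ->.
  by rewrite mem_undup; apply/flattenP; exists (S np) => //; apply: codom_f.
have pm (np : 'I_N * bool) : perm_eq [seq w <- G | (wdeg w == np.1.+1)
  && (wpar w == np.2)] (S np).
  have [sub _ _] := HS np; apply: uniq_perm => //;
    first exact/filter_uniq/undup_uniq.
  by apply: subseq_uniq sub _; apply: uniq_pwords.
split; first exact: undup_uniq.
- by move=> w /memG[np [_ -> _]].
- move=> n p /andP[n0 nN] c.
  have lt_n : (n.-1 < N)%N by rewrite prednK.
  have := pm (Ordinal lt_n, p); have [_ iS _] := HS (Ordinal lt_n, p).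
  rewrite /= prednK // => pmn; rewrite (perm_big _ pmn) /= => /iS c0 w.
  by rewrite (perm_mem pmn) => /c0.
move=> n p x /andP[n0 nN] Rx.
have lt_n : (n.-1 < N)%N by rewrite prednK.
have := pm (Ordinal lt_n, p); have [_ _ sS] := HS (Ordinal lt_n, p).
rewrite /= prednK // in sS * => pmn; move/sS: Rx.
apply: lspan_min; first exact: lspan_subspace.
by move=> y [w wS ->]; apply: lspan_gen; exists w; rewrite // (perm_mem pmn).
Qed.

(** Both sides of the Poincare-Birkhoff-Witt theorem have a logarithmic
    derivative: on one side the words in the generators, on the other side the
    ordered monomials in a homogeneous basis of L. *)
Lemma lie_sdim_divisors (f h : fps) : f 0%N = 1 -> log_der h f ->
  (forall n, signed_count deg par n = f n) ->
  exists d : nat -> bool -> nat,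
    (forall n p, (0 < n <= N)%N -> has_dim (rspan n p) (d n p)) /\
    (forall n, (0 < n <= N)%N ->
       h n = \sum_(e <- divisors n) e%:R * ((d e false)%:R - (d e true)%:R)).
Proof.
move=> f0 hf fE; have [G [uG G0 iG sG]] := exists_bases.
pose w i := tnth (in_tuple G) i; pose X i : T := g (rbr (w i)).
pose dg i := wdeg (w i); pose q i := wpar (w i).
have wG i : w i \in G by apply: mem_tnth.
have w_inj i j : w i = w j -> i = j.
  by have /tuple_uniqP inj : uniq (in_tuple G) by []; apply: inj.
have dg0 i : (0 < dg i)%N by apply: G0.
have gensP n p v : v \in [seq w <- G | (wdeg w == n) && (wpar w == p)] ->
    exists2 i, v = w i & i \in gens dg q n p.
  rewrite mem_filter => /andP[vnp vG]; have /tnthP[i vE] :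
    v \in in_tuple G by [].
  by exists i; rewrite // mem_filter mem_enum andbT /dg /q /w -vE.
have gens_in n p i : i \in gens dg q n p ->
    w i \in [seq w <- G | (wdeg w == n) && (wpar w == p)].
  by rewrite !mem_filter => /andP[inp _]; rewrite wG andbT.
have uw n p : uniq [seq w <- G | (wdeg w == n)
  && (wpar w == p)] by apply: filter_uniq.
have ugens n p : uniq (gens dg q n p) by apply/filter_uniq/enum_uniq.
have i_rbr n p : (0 < n <= N)%N -> independent (gens dg q n p) (fun i =>
  rbr (w i)).
  move=> nN c c0 i ig; pose c' v := \sum_(j <- gens dg q n p | w j == v) c j.
  have c'0 : \sum_(v <- [seq w <- G | (wdeg w == n) && (wpar w == p)])
    c' v *: rbr v = 0.
    by rewrite -[RHS]c0; apply: sum_fibers => // j; apply: gens_in.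
  have := iG n p nN c' c'0 (w i) (gens_in _ _ _ ig); rewrite /c'.
  rewrite (big_rem i ig) /= eqxx big1_seq ?addr0 // => j /andP[/eqP ji].
  by rewrite mem_rem_uniq // inE (w_inj _ _ ji) eqxx.
have s_rbr n p x : (0 < n <= N)%N -> rspan n p x ->
    lspan (family (gens dg q n p) (fun i => rbr (w i))) x.
  move=> nN /(sG _ _ _ nN); apply: lspan_min; first exact: lspan_subspace.
  by move=> y [v /gensP[i -> ig] ->]; apply: lspan_gen; exists i.
have r_rbr n p x : lspan (family (gens dg q n p) (fun i =>
  rbr (w i))) x -> rspan n p x.
  apply: lspan_min; first exact: rspan_subspace.
  move=> y [i]; rewrite mem_filter => /andP[/andP[/eqP <- /eqP <-] _] ->.
  exact: rspan_rbr.
have s_X n p x : (0 < n <= N)%N -> rspan n p x ->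
    lspan (family (gens dg q n p) X) (g x).
  move=> nN /(s_rbr _ _ _ nN).
  have [F0 Flin] := lspan_subspace (family (gens dg q n p) X).
  move: x; apply: lspan_min => [|x [i ig ->]]; last by apply: lspan_gen;
    exists i.
  split=> [|c x y Hx Hy]; first by rewrite linear0.
  by rewrite linearP; apply: Flin.
have i_X n p : (n <= N)%N -> independent (gens dg q n p) X.
  move=> nN c c0 i ig.
  have n0 : (0 < n)%N.
    by move: ig; rewrite mem_filter => /andP[/andP[/eqP <- _] _].
  have nN' : (0 < n <= N)%N by rewrite n0.
  apply: (i_rbr n p nN' c) => //; apply: (g_inj charK deg_gt0 E_par g_hom gE n0
    (p := p)).
    apply: r_rbr; apply: subspace_sum_seq => [|j jg];
      first exact: lspan_subspace.
    apply: subspaceZ; first exact: lspan_subspace.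
    by apply: lspan_gen; exists j.
  by rewrite linear_sum -[RHS]c0; apply: eq_bigr => j _; rewrite linearZ.
have X_span i : tspan deg par (dg i) (q i) (X i).
  by apply: g_rspan; apply: rspan_rbr.
have X_prim i : primitive par (q i) (X i) by apply: primitive_rbr.
have X_br i j : (dg i + dg j <= N)%N ->
    lspan (family (gens dg q (dg i + dg j) (q i (+) q j)) X) (tbr par (X i)
      (X j)).
  move=> le_N; rewrite /X -[tbr _ _ _]/(lie_br (g (rbr (w i))) (g (rbr (w j)))).
  rewrite -(proj2 g_hom); apply: s_X; first by rewrite addn_gt0 dg0.
  by apply: rspan_br => //; apply: rspan_rbr.
have X_letter a : (deg a <= N)%N ->
    lspan (family (gens dg q (deg a) (par a)) X) (word T [:: a]).
  move=> le_N; rewrite -gE; apply: s_X; first by rewrite deg_gt0.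
  have := rspan_rbr par E deg_gt0 [:: a].
  by rewrite wdeg_cons wpar_cons wdeg_nil wpar_nil addn0 addbF.
have M_f n : (n <= N)%N -> monomial_series dg q (size G) n = f n.
  move=> nN; rewrite monomial_seriesE -fE signed_countE.
  have pbw := size_monomials charK deg_gt0 dg0 X_span X_prim i_X X_br X_letter _
    nN.
  by rewrite !pbw.
exists (fun n p => size (gens dg q n p)); split=> [n p nN|n nN].
  apply: (has_dim_family (ugens n p) (i_rbr n p nN)) => x; split;
    [exact: s_rbr|exact: r_rbr].
rewrite (log_der_monomials dg0 f0 hf M_f nN).
have n0 : (0 < n)%N by case/andP: nN.
have cnt e : (size (gens dg q e false))%:R - (size (gens dg q e true))%:R =
    \sum_(i < size G | dg i == e) (-1) ^+ q i :> rat.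
  transitivity (\sum_(i <- enum 'I_(size G) | dg i == e) (-1) ^+ q i : rat).
    2: by rewrite big_enum_cond.
  rewrite /gens !size_filter.
  elim: (enum _) => [|i s IH]; first by rewrite big_nil subr0.
  rewrite big_cons /= !natrD opprD addrACA IH.
  by case: (dg i == e) => /=; case: (q i); rewrite /= ?expr1 ?expr0 ?sub0r
    ?subr0 ?oppr0 ?add0r.
under [RHS]eq_bigr => e _ do rewrite cnt mulr_sumr big_mkcond /=.
rewrite [RHS]exchange_big /= [LHS]big_mkcond /=; apply: eq_bigr => i _.
case: ifP => [dn|ndn].
  rewrite (bigD1_seq (dg i)) ?divisors_uniq //= -?dvdn_divisors // eqxx.
  by rewrite big1 ?addr0 1?mulrC // => e; rewrite eq_sym => /negPf->.
rewrite big_seq big1 // => e; rewrite -dvdn_divisors // => en.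
by case: eqP => // de; rewrite de en in ndn.
Qed.

End LieDimension.

(** * Bases modulo a subspace of superdimension zero *)

Section Superbasis.
Variables (K : fieldType) (W : lmodType K) (par : bool -> W -> Prop).
Hypothesis parW : is_superspace par.

Lemma superspace_eq (p : bool) x y x' y' : par p x -> par (~~ p) y ->
  par p x' -> par (~~ p) y' -> x + y = x' + y' -> x = x' /\ y = y'.
Proof.
have [ps _ p0] := parW; move=> px py px' py' xy.
have dE : x - x' = y' - y by rewrite -[x](addrK y) xy (addrC x') addrAC addrK.
have subp q u v : par q u -> par q v -> par q (u - v).
  by move=> pu pv; apply: subspaceD => //; apply: subspaceN.
have x0 : x - x' = 0.
  have p1 := subp _ _ _ px px'; have p2 := subp _ _ _ py' py; rewrite -dE in p2.
  by case: p p1 p2 {px py px' py'} => p1 p2; apply: p0.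
split; apply/eqP; rewrite -subr_eq0 ?x0 //.
by rewrite -oppr_eq0 opprB -dE x0.
Qed.

(** If the even part of P is at least as large as the odd one, the excess is
    the size of a family of even vectors which is a basis of P modulo the span
    of the other even vectors of a basis and of the odd part. *)
Lemma exists_superbasis (P : W -> Prop) (J : finType) (A : {set J}) n1 :
  is_graded_subspace par P ->
  has_dim (fun x => P x /\ par false x) (#|A| + n1) ->
  has_dim (fun x => P x /\ par true x) n1 ->
  exists b : J -> W, is_superbasis par P A b.
Proof.
move=> [Ps Pgr] dim0 dim1; have [ps psum p0] := parW.
have [b0 [ib0 b0P]] := dim0.
have Pb0 i : P (b0 i) /\ par false (b0 i).
  apply/b0P; exists (fun l => (l == i)%:R); rewrite (bigD1 i) //= eqxx scale1r.
  by rewrite big1 ?addr0 // => l /negPf->; rewrite scale0r.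
pose b x := if [pick i : 'I_#|A| | enum_val i == x] is Some i then b0 (lshift n1
  i) else 0.
have bE (i : 'I_#|A|) : b (enum_val i) = b0 (lshift n1 i).
  rewrite /b; case: pickP => [l /eqP/enum_val_inj -> //|/(_ i)].
  by rewrite eqxx.
have bsum (c : J -> K) : \sum_(i in A) c i *: b i =
    \sum_(i < #|A|) c (enum_val i) *: b0 (lshift n1 i).
  by rewrite big_enum_val; apply: eq_bigr => i _; rewrite bE.
pose R (x : W) := exists c : 'I_n1 -> K, x = \sum_i c i *: b0 (rshift #|A| i).
have Rs : is_subspace R.
  split=> [|a x y [c ->] [d ->]].
    by exists (fun=> 0); rewrite big1 // => i _; rewrite scale0r.
  exists (fun i => a * c i + d i); rewrite scaler_sumr -big_split.
  by apply: eq_bigr => i _; rewrite scalerDl scalerA.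
have RP x : R x -> P x /\ par false x.
  case=> c ->; split; apply: subspace_sum => // i; apply: subspaceZ => //;
  by case: (Pb0 (rshift #|A| i)).
exists b; split=> [i iA|].
  have -> : i = enum_val (enum_rank_in iA i) by rewrite enum_rankK_in.
  by rewrite bE; apply: Pb0.
(* R is spanned by the n1 even basis vectors that are left over, and Z is the
   sum of R and of the odd part of P. *)
pose Z x := exists y z, [/\ R y, P z, par true z & x = y + z].
have Zs : is_subspace Z.
  split=> [|a x x' [y [z [Ry Pz pz ->]]] [y' [z' [Ry' Pz' pz' ->]]]].
    by exists 0, 0; rewrite addr0; split=> //; case: Rs; case: Ps;
      case: (ps true).
  exists (a *: y + y'), (a *: z + z'); split.
  - exact: (proj2 Rs).
  - exact: (proj2 Ps).
  - exact: (proj2 (ps true)).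
  by rewrite scalerDr addrACA.
have R0 : R 0 by case: Rs.
have P0 : P 0 by case: Ps.
have par0 p : par p 0 by case: (ps p).
have Zgr : is_graded_subspace par Z.
  split=> // x [y [z [Ry Pz pz ->]]]; exists y, z; split=> //; split=> //.
  - by exists y, 0; rewrite addr0.
  - by case: (RP y Ry).
  by exists 0, z; rewrite add0r.
have Z0 x : (Z x /\ par false x) <-> R x.
  split=> [[[y [z [Ry Pz pz ->]]] px]|Rx].
    have [_ pary] := RP _ Ry.
    have [-> _] : y + z = y /\ (0 : W) = z.
      by apply: (superspace_eq (p := false)); rewrite ?addr0.
    by [].
  by split; [exists x, 0; rewrite addr0 | case: (RP _ Rx)].
have Z1 x : (Z x /\ par true x) <-> (P x /\ par true x).
  split=> [[[y [z [Ry Pz pz ->]]] px]|[Px px]]; split=> //.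
    have [_ pary] := RP _ Ry.
    have [<- _] : z = y + z /\ y = (0 : W).
      by apply: (superspace_eq (p := true)); rewrite // addr0 addrC.
    by [].
  by exists 0, x; rewrite add0r.
exists Z; split=> //.
- exists n1, n1; split; last by rewrite subrr.
    apply: (@has_dim_ext _ _ R) => [x|]; first by rewrite Z0.
    exists (fun i => b0 (rshift #|A| i)); split=> [c c0 i|x //].
    pose d (l : 'I_(#|A| + n1)) := if split l is inr i then c i else 0.
    have dE : d (rshift #|A| i) = c i by rewrite /d (unsplitK (inr _ i)).
    rewrite -dE; apply: ib0; rewrite big_split_ord /= big1 ?add0r => [|l _].
      by rewrite -[RHS]c0; apply: eq_bigr => l _;
        rewrite /d (unsplitK (inr _ l)).
    by rewrite /d (unsplitK (inl _ l)) scale0r.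
  by apply: has_dim_ext dim1 => x; rewrite Z1.
- move=> x; split=> [/Pgr[x0 [x1 [H0 [Px1 px1] ->]]]|[c [z [[y [z' [Ry Pz' pz'
  ->]]] ->]]]].
    have /b0P[c ->] := H0.
    pose d x := if [pick i : 'I_#|A| | enum_val i == x] is Some i then c (lshift
      n1 i) else 0.
    have dE (i : 'I_#|A|) : d (enum_val i) = c (lshift n1 i).
      rewrite /d; case: pickP => [l /eqP/enum_val_inj -> //|/(_ i)].
      by rewrite eqxx.
    exists d, (\sum_i c (rshift #|A| i) *: b0 (rshift #|A| i) + x1); split.
      by exists (\sum_i c (rshift #|A| i) *: b0 (rshift #|A| i)), x1;
        split=> //;
        exists (fun i => c (rshift #|A| i)).
    rewrite big_split_ord addrA bsum; congr (_ + _ + _).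
    by apply: eq_bigr => i _; rewrite dE.
  apply: subspaceD => //; last by apply: subspaceD => //; case: (RP _ Ry).
  rewrite bsum; apply: subspace_sum => // i; apply: subspaceZ => //.
  by case: (Pb0 (lshift n1 i)).
move=> c z [y [z' [[d ->] Pz' pz' ->]]] c0 i iA.
have par0sum : par false (\sum_(i in A) c i *: b i + \sum_i d i *: b0 (rshift
  #|A| i)).
  rewrite bsum; apply: subspaceD => //; apply: subspace_sum => // l;
    apply: subspaceZ => //.
    by case: (Pb0 (lshift n1 l)).
  by case: (Pb0 (rshift #|A| l)).
have [s0 _] : \sum_(i in A) c i *: b i + \sum_i d i *: b0 (rshift #|A| i) =
  0 /\ z' = 0.
  by apply: (superspace_eq (p := false)); rewrite // addr0 -addrA.
pose e (l : 'I_(#|A| + n1)) := match split l with inl i =>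
  c (enum_val i) | inr i => d i end.
have := ib0 e _ (lshift n1 (enum_rank_in iA i)).
rewrite {2}/e (unsplitK (inl _ _)) enum_rankK_in //; apply.
rewrite big_split_ord /= -[RHS]s0 bsum; congr (_ + _); apply: eq_bigr => l _.
  by rewrite /e (unsplitK (inl _ l)).
by rewrite /e (unsplitK (inr _ l)).
Qed.

End Superbasis.

(** * Enveloping algebras *)

Section Enveloping.
Variables (K : fieldType) (I : finType) (deg : I -> nat) (par : I -> bool).
Variables (L : lieSuperalgebra K) (E : I -> L) (T : free_algebra K I).
Variable g : {linear L -> freealg_lie par T}.
Hypothesis deg_gt0 : forall a, (0 < deg a)%N.
Hypothesis E_par : forall a, lie_par (par a) (E a).
Hypothesis g_hom : lie_hom g.
Hypothesis gE : forall a, g (E a) = word T [:: a].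
Variables (U : algType K) (j : {linear L -> U}).
Hypothesis envU : is_enveloping j.
Local Notation pwords := (pwords deg par).
Local Notation rspan := (rspan deg par E).

Lemma g_enveloping : enveloping_map (A := T) g.
Proof.
move=> p q x y px qy; rewrite (proj2 g_hom).
by apply: tbrE; apply: (proj1 g_hom).
Qed.

Definition uword (w : seq I) : U := \prod_(a <- w) j (E a).

Lemma uword_cat v w : uword (v ++ w) = uword v * uword w.
Proof. exact: big_cat. Qed.

Definition uspan n p : U -> Prop := lspan (family (pwords n p) uword).

Lemma uspan_subspace n p : is_subspace (uspan n p).
Proof. exact: lspan_subspace. Qed.

Lemma uspan_word w : uspan (wdeg deg w) (wpar par w) (uword w).
Proof. by apply: lspan_gen; exists w; rewrite // mem_pwords // !eqxx. Qed.

Lemma uspanM m p n q x y :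
  uspan m p x -> uspan n q y -> uspan (m + n) (p (+) q) (x * y).
Proof.
move=> Hx Hy; have [Q0 Qlin] := uspan_subspace (m + n) (p (+) q).
move: x Hx; apply: lspan_min => [|x [v]].
  split=> [|c x z Hx Hz]; first by rewrite mul0r.
  by rewrite mulrDl -scalerAl; apply: Qlin.
rewrite mem_pwords // => /andP[/eqP vm /eqP vp] ->; move: y Hy.
apply: lspan_min => [|y [w]].
  split=> [|c y z Hy Hz]; first by rewrite mulr0.
  by rewrite mulrDr -scalerAr; apply: Qlin.
rewrite mem_pwords // => /andP[/eqP wn /eqP wq] ->; rewrite -uword_cat.
by have := uspan_word (v ++ w); rewrite wdeg_cat wpar_cat vm vp wn wq.
Qed.

Lemma uspan_rspan n p x : rspan n p x -> uspan n p (j x).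
Proof.
have [Q0 Qlin] := uspan_subspace n p.
move: x; apply: lspan_min => [|x [w]].
  split=> [|c x y Hx Hy]; first by rewrite linear0.
  by rewrite linearP; apply: Qlin.
rewrite mem_pwords // => /andP[/eqP <- /eqP <-] -> {n p Q0 Qlin x}.
have Ua a : uspan (deg a) (par a) (j (E a)).
  have := uspan_word [:: a].
  by rewrite wdeg_cons wpar_cons wdeg_nil wpar_nil addn0 addbF /uword big_seq1.
elim: w => [|a [|b u] IH].
- by rewrite linear0; case: (uspan_subspace (wdeg deg [::]) (wpar par [::])).
- by rewrite wdeg_cons wpar_cons wdeg_nil wpar_nil addn0 addbF.
rewrite rbr_cons (proj1 envU _ _ _ _ (E_par a) (rbr_par E_par (b :: u))).
rewrite addrC -scaleNr [wdeg deg (a :: _)]wdeg_cons [wpar par (a ::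
  _)]wpar_cons.
apply: (proj2 (uspan_subspace _ _)); last exact: uspanM.
by rewrite addnC addbC; apply: uspanM.
Qed.

Lemma env_deg_split N u : env_deg (gen_deg deg E) j N u ->
  exists u0 u1, [/\ uspan N false u0, uspan N true u1 & u = u0 + u1].
Proof.
elim=> {N u} [N x Nx||N|N c x y _ [x0 [x1 [X0 X1 ->]]] _ [y0 [y1 [Y0 Y1 ->]]]
  |M N x y _ [x0 [x1 [X0 X1 ->]]] _ [y0 [y1 [Y0 Y1 ->]]]].
- have [x0 [x1 [X0 X1 ->]]] := gen_deg_split deg_gt0 E_par Nx.
  by exists (j x0), (j x1); rewrite linearD; split=> //; apply: uspan_rspan.
- exists 1, 0; rewrite addr0; split=> //; last by case: (uspan_subspace 0 true).
  by have := uspan_word [::]; rewrite /uword big_nil wdeg_nil wpar_nil.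
- exists 0, 0; rewrite addr0; split=> //; first by case: (uspan_subspace N
  false).
  by case: (uspan_subspace N true).
- exists (c *: x0 + y0), (c *: x1 + y1); split.
  + exact: (proj2 (uspan_subspace _ _)).
  + exact: (proj2 (uspan_subspace _ _)).
  by rewrite scalerDr addrACA.
exists (x0 * y0 + x1 * y1), (x0 * y1 + x1 * y0); split.
- apply: subspaceD; first exact: uspan_subspace.
    exact: (uspanM X0 Y0).
  exact: (uspanM X1 Y1).
- apply: subspaceD; first exact: uspan_subspace.
    exact: (uspanM X0 Y1).
  exact: (uspanM X1 Y0).
by rewrite !mulrDl !mulrDr [x1 * y0 + _]addrC addrACA.
Qed.

Lemma uword_env_deg w : env_deg (gen_deg deg E) j (wdeg deg w) (uword w).
Proof.
rewrite /uword; elim: w => [|a w IH]; first by rewrite wdeg_nil big_nil;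
  apply: env_deg_1.
rewrite wdeg_cons big_cons; apply: env_deg_mul => //; apply: env_deg_gen.
exact: gen_deg_gen.
Qed.

Lemma uword_env_par w : env_par j (wpar par w) (uword w).
Proof.
rewrite /uword; elim: w => [|a w IH]; first by rewrite wpar_nil big_nil;
  apply: env_par_1.
by rewrite wpar_cons big_cons; apply: env_par_mul => //; apply: env_par_gen.
Qed.

Section ToFreeAlgebra.
Variable psi : {lrmorphism U -> T}.
Hypothesis psi_j : forall x, psi (j x) = g x.

Lemma psi_uword w : psi (uword w) = word T w.
Proof.
rewrite /uword; elim: w => [|a w IH]; first by rewrite big_nil rmorph1 word_nil.
by rewrite big_cons rmorphM /= IH psi_j gE -word_cat.
Qed.

Lemma psi_par p u : env_par j p u -> tpar par p (psi u).
Proof.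
elim=> {p u} [p x px||p|p c u v _ Hu _ Hv|p q u v _ Hu _ Hv].
- by rewrite psi_j; apply: (proj1 g_hom).
- by rewrite rmorph1 -(word_nil T); have := @tpar_word _ _ par T [::];
  rewrite wpar_nil.
- by rewrite linear0; case: (tpar_subspace par T p).
- by rewrite linearP; apply: (proj2 (tpar_subspace par T p)).
by rewrite rmorphM; apply: tparM.
Qed.

Lemma independent_uword n p : independent (pwords n p) uword.
Proof.
move=> c c0; apply: (independent_words (T := T) (uniq_pwords deg par n p)).
have := congr1 psi c0; rewrite linear0 linear_sum => psi0; rewrite -[RHS]psi0.
by apply: eq_bigr => w _; rewrite linearZ /= psi_uword.
Qed.

Lemma psi_uspan_inj n p u : uspan n p u -> psi u = 0 -> u = 0.
Proof.
case/(lspan_familyP _ _ (uniq_pwords deg par n p)) => c ->.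
rewrite linear_sum => c0; rewrite big_seq big1 // => w wn.
suff -> : c w = 0 by rewrite scale0r.
apply: (independent_words (T := T) (uniq_pwords deg par n p)) wn.
by rewrite -[RHS]c0; apply: eq_bigr => v _; rewrite linearZ /= psi_uword.
Qed.

(** An element of degree n is a combination of even and odd words; psi maps them
    to even and odd words of T, where the parities are visibly independent. *)
Lemma env_deg_par n p u :
  (env_deg (gen_deg deg E) j n u /\ env_par j p u) <-> uspan n p u.
Proof.
split=> [[/env_deg_split[u0 [u1 [U0 U1 ->]]] pu]|].
  have toPar q v : uspan n q v -> tpar par q (psi v).
    move=> Hv; apply: psi_par; move: v Hv; apply: lspan_min.
      by split=> [|c x y]; [apply: env_par_0 | apply: env_par_lin].
    move=> y [w]; rewrite mem_pwords // => /andP[_ /eqP <-] ->.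
    exact: uword_env_par.
  have P0 := toPar _ _ U0; have P1 := toPar _ _ U1; have := psi_par pu.
  have Ts := freealg_superspace par T; have Tz q : tpar par q (0 : T).
    by case: (tpar_subspace par T q).
  rewrite linearD; case: p {pu} => pu.
    have [] := superspace_eq (p := false) Ts P0 P1 (Tz false) pu.
      by rewrite add0r.
    by move=> /(psi_uspan_inj U0) -> _; rewrite add0r.
  have [] := superspace_eq (p := false) Ts P0 P1 pu (Tz true).
    by rewrite addr0.
  by move=> _ /(psi_uspan_inj U1) ->; rewrite addr0.
move=> Hu; split; move: u Hu; apply: lspan_min.
- by split=> [|c x y]; [apply: env_deg_0 | apply: env_deg_lin].
- by move=> y [w]; rewrite mem_pwords // => /andP[/eqP <- _] ->;
  apply: uword_env_deg.
- by split=> [|c x y]; [apply: env_par_0 | apply: env_par_lin].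
by move=> y [w]; rewrite mem_pwords // => /andP[_ /eqP <-] ->;
  apply: uword_env_par.
Qed.

Lemma env_dim n p :
  has_dim (fun u => env_deg (gen_deg deg E) j n u /\ env_par j p u)
    (size (pwords n p)).
Proof.
apply: (has_dim_family (uniq_pwords deg par n p) (@independent_uword n p)) => u.
exact: env_deg_par.
Qed.

End ToFreeAlgebra.

(** The words in the generators form a basis of U. *)
Lemma env_sdim n :
  has_sdim (env_par j) (env_deg (gen_deg deg E) j n) (signed_count deg par n).
Proof.
have [psi [psi_j _]] := proj2 envU T g g_enveloping.
exists (size (pwords n false)), (size (pwords n true)); split.
- exact: (env_dim psi_j).
- exact: (env_dim psi_j).
exact: signed_countE.
Qed.

End Enveloping.

(** * A homogeneous basis of the space of generators *)

Section Letters.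
Variables (K : fieldType) (V : vectType K) (D : nat).
Variable V_ : 'I_D -> bool -> {vspace V}.
Hypothesis gradV : is_graded_superspace V_.
Local Notation Vs := (fun np : 'I_D * bool => V_ np.1 np.2).

Definition letter : finType := {np : 'I_D * bool & 'I_(\dim (Vs np))}.

Definition letter_deg (a : letter) : nat := (tag a).1.+1.
Definition letter_par (a : letter) : bool := (tag a).2.
Definition letter_vec (a : letter) : V := tnth (vbasis (Vs (tag a))) (tagged a).

Lemma letter_vec_in a : letter_vec a \in V_ (tag a).1 (tag a).2.
Proof. by apply: vbasis_mem; apply: mem_tnth. Qed.

Definition letter_coord (a : letter) (v : V) : K :=
  coord (vbasis (Vs (tag a))) (tagged a) (sumv_pi (\sum_np Vs np)%VS (tag a) v).

Lemma letter_coord_linear a c u v :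
  letter_coord a (c *: u + v) = c * letter_coord a u + letter_coord a v.
Proof. by rewrite /letter_coord !linearP. Qed.

Lemma sumv_pi_id np v : v \in Vs np ->
  forall mq, sumv_pi (\sum_np Vs np)%VS mq v = if mq == np then v else 0.
Proof.
move=> vn; have [full dir] := gradV.
have /directv_sum_unique uniqV := dir.
have := uniqV (fun mq => sumv_pi (\sum_np Vs np)%VS mq v)
  (fun mq => if mq == np then v else 0).
rewrite sumv_pi_sum ?full ?memvf // -big_mkcond /= big_pred1_eq eqxx => H.
have {H} : true = _ := H (fun mq _ => memv_sum_pi _ _ _) _.
move=> H; have Hv mq : true -> (if mq == np then v else 0) \in V_ mq.1 mq.2.
  by move=> _; case: eqP => [->|_]; rewrite ?mem0v.
by move=> mq; have /esym/forall_inP/(_ mq isT)/eqP := H Hv.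
Qed.

Lemma letter_coord_vec a b : letter_coord a (letter_vec b) = (a == b)%:R.
Proof.
rewrite /letter_coord (sumv_pi_id (letter_vec_in b)).
case: a b => [np i] [mq l] /=; case: eqP => [e|ne].
  subst mq; rewrite /letter_vec /= (tnth_nth 0) coord_free;
    last exact/basis_free/vbasisP.
  by rewrite -tag_eqE /tag_eq /= eqxx tagged_asE eq_sym.
by rewrite linear0 -tag_eqE /tag_eq /= (introF eqP ne).
Qed.

Lemma letter_coord_sum v : v = \sum_a letter_coord a v *: letter_vec a.
Proof.
have [full _] := gradV.
have vE : \sum_np sumv_pi (\sum_np Vs np)%VS np v =
  v by rewrite sumv_pi_sum ?full ?memvf.
rewrite -{1}vE (eq_bigr (fun np => \sum_(i < \dim (Vs np))
    letter_coord (Tagged (fun np => 'I_(\dim (Vs np))) i) v *: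
    letter_vec (Tagged (fun np => 'I_(\dim (Vs np))) i))); last first.
  move=> np _; rewrite {1}(coord_vbasis (memv_sum_pi _ np v)).
  by apply: eq_bigr => i _; rewrite /letter_vec (tnth_nth 0).
by rewrite sig_big_dep /=; apply: eq_bigr => -[np i].
Qed.

Lemma letter_coord_supp n p v a : v \in V_ n p -> letter_coord a v != 0 ->
  tag a = (n, p).
Proof.
move=> vn; rewrite /letter_coord (sumv_pi_id (np := (n, p)) vn).
by case: (tag a =P (n, p)) => // _; rewrite linear0 eqxx.
Qed.

Lemma sum_letters (R : nmodType) (F : nat -> bool -> R) (P : pred nat) :
  \sum_(a : letter | P (letter_deg a)) F (letter_deg a) (letter_par a) =
  \sum_(n < D | P n.+1) (F n.+1 false *+ \dim (V_ n false)
    + F n.+1 true *+ \dim (V_ n true)).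
Proof.
transitivity (\sum_(np : 'I_D * bool | P np.1.+1)
  F np.1.+1 np.2 *+ \dim (Vs np)).
  under [RHS]eq_bigr => np _.
    rewrite -[\dim _]card_ord -sumr_const; over.
  by rewrite sig_big_dep /=; apply: eq_big => [[np i]|[np i] _] //=;
    rewrite andbT.
rewrite [RHS](eq_bigr (fun n : 'I_D => \sum_(p :
  bool) F n.+1 p *+ \dim (V_ n p))); last first.
  by move=> n _; rewrite big_bool addrC.
by rewrite pair_big_dep /=; apply: eq_bigl => np; rewrite andbT.
Qed.

End Letters.

(** * From the generators to the theorem *)

Section LetterMap.
Variables (K : fieldType) (V : vectType K) (D : nat).
Variable V_ : 'I_D -> bool -> {vspace V}.
Hypothesis gradV : is_graded_superspace V_.
Local Notation letter := (letter V_).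
Local Notation par := (@letter_par K V D V_).
Variable T : free_algebra K letter.

Definition letter_map (v : V) : freealg_lie par T :=
  \sum_a letter_coord a v *: word T [:: a].

Lemma letter_map_is_linear : linear letter_map.
Proof.
move=> c u v; rewrite /letter_map scaler_sumr -big_split; apply: eq_bigr => a _.
by rewrite letter_coord_linear scalerDl scalerA.
Qed.

HB.instance Definition _ :=
  GRing.isLinear.Build K V (freealg_lie par T)
    _ letter_map letter_map_is_linear.

Lemma letter_map_vec a : letter_map (letter_vec a) = word T [:: a].
Proof.
rewrite /letter_map (bigD1 a) //= letter_coord_vec // eqxx scale1r big1 ?addr0
  // => b.
by rewrite letter_coord_vec // => /negPf->; rewrite scale0r.
Qed.

Lemma letter_map_par : par_preserving V_ letter_map.
Proof.
move=> n p v vn; change (tpar par p (letter_map v)); rewrite /letter_map.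
apply: subspace_sum => [|a].
  exact: tpar_subspace.
case: (eqVneq (letter_coord a v) 0) => [->|ca].
  by rewrite scale0r; case: (tpar_subspace par T p).
apply: (subspaceZ (Q := tpar par p) _ (tpar_subspace par T p)).
have := @tpar_word _ _ par T [:: a]; rewrite wpar_cons wpar_nil addbF
  /letter_par.
by rewrite (letter_coord_supp gradV vn ca).
Qed.

Variables (L : lieSuperalgebra K) (iota : {linear V -> L}).

Lemma lie_deg_letters N x :
  lie_deg V_ iota N x <->
  gen_deg (@letter_deg K V D V_) (fun a => iota (letter_vec a)) N x.
Proof.
split.
  elim=> {N x} [n v vn|N|N a x y _ Hx _ Hy|M N x y _ Hx _ Hy].
  - have gs : is_subspace (gen_deg (@letter_deg K V D V_) (fun a =>
    iota (letter_vec a)) n.+1).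
      by split=> [|a x y]; [apply: gen_deg_0 | apply: gen_deg_lin].
    have Hp p u : u \in V_ n p ->
        gen_deg (@letter_deg K V D V_) (fun a =>
          iota (letter_vec a)) n.+1 (iota u).
      move=> un; rewrite [u](letter_coord_sum gradV) linear_sum.
      apply: subspace_sum => // a; rewrite linearZ /=.
      case: (eqVneq (letter_coord a u) 0) => [->|ca].
        by rewrite scale0r; apply: gen_deg_0.
      apply: subspaceZ => //; have tagE := letter_coord_supp gradV un ca.
      have -> : n.+1 = letter_deg a by rewrite /letter_deg tagE.
      exact: (gen_deg_gen (fun b : letter => letter_deg b)).
    case/memv_addP: vn => u un [w wn ->]; rewrite linearD.
    by apply: subspaceD => //; [apply: (Hp false) | apply: (Hp true)].
  - exact: gen_deg_0.
  - exact: gen_deg_lin.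
  exact: gen_deg_br.
elim=> {N x} [a|N|N a x y _ Hx _ Hy|M N x y _ Hx _ Hy].
- apply: lie_deg_gen; have := letter_vec_in a; case: (tag a).2 => va.
    by apply: (subvP (addvSr _ _)).
  by apply: (subvP (addvSl _ _)).
- exact: lie_deg_0.
- exact: lie_deg_lin.
exact: lie_deg_br.
Qed.

End LetterMap.

Lemma has_sdim_ext (K : fieldType) (W : lmodType K) par (P Q : W -> Prop) s :
  (forall x, P x <-> Q x) -> has_sdim par P s -> has_sdim par Q s.
Proof.
move=> PQ [n0 [n1 [d0 d1 ->]]]; exists n0, n1; split=> //.
  by apply: has_dim_ext d0 => x; rewrite PQ.
by apply: has_dim_ext d1 => x; rewrite PQ.
Qed.

Lemma env_deg_mono (K : fieldType) (L : lieSuperalgebra K) (U : algType K)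
    (j : {linear L -> U}) (deg1 deg2 : nat -> L -> Prop) N u :
  (forall n x, deg1 n x -> deg2 n x) -> env_deg deg1 j N u ->
    env_deg deg2 j N u.
Proof.
move=> deg12; elim=> {N u} [N x Nx||N|N a u v _ Hu _ Hv|M N u v _ Hu _ Hv].
- by apply: env_deg_gen; apply: deg12.
- exact: env_deg_1.
- exact: env_deg_0.
- exact: env_deg_lin.
exact: env_deg_mul.
Qed.

(** The words in a homogeneous basis of V satisfy the recursion of the
    coefficients of 1 / det (I - zA). *)
Lemma signed_count_letters (K : fieldType) (V : vectType K) (D : nat)
    (A : 'M[rat]_D) (V_ : 'I_D -> bool -> {vspace V}) :
  (forall n : 'I_D, (\dim (V_ n false))%:R - (\dim (V_ n true))%:R =
    d_plus A n.+1) ->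
  forall n, signed_count (@letter_deg K V D V_) (@letter_par K V D V_) n =
    zeta_fps A n.
Proof.
move=> sdimV; elim/ltn_ind=> n IH; case: (posnP n) => [->|n0].
  by rewrite /signed_count words0 // big_seq1 wpar_nil zeta_fps0.
rewrite /signed_count sum_words_rec // zeta_fps_rec //.
transitivity (\sum_(a : letter V_ | (letter_deg a <= n)%N)
    (-1) ^+ letter_par a * zeta_fps A (n - letter_deg a)%N).
  apply: eq_bigr => a le_an; rewrite -IH ?ltn_subrL ?n0 //.
  rewrite mulr_sumr; apply: eq_bigr => w _.
  by rewrite wpar_cons signr_addb.
rewrite (sum_letters V_ (fun m p => (-1) ^+ nat_of_bool p * zeta_fps A (n -
  m)%N)
  (fun m => (m <= n)%N)).
apply: eq_bigr => i _; rewrite -sdimV expr0 expr1 mul1r mulN1r mulNrn mulrBl.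
by rewrite !mulr_natl.
Qed.

Theorem mainTheorem4
    (K : fieldType) (charK : [pchar K] =i pred0)
    (k : matrix_kind) (G : multigraph) (hG : admissible k G)
    (V : vectType K)
    (V_ : 'I_(matrix_order k G) -> bool -> {vspace V})
    (gradV : is_graded_superspace V_)
    (dimV : forall n : 'I_(matrix_order k G),
      (\dim (V_ n false) + \dim (V_ n true))%:R
        = `|d_plus (graph_matrix k G) n.+1|)
    (sdimV : forall n : 'I_(matrix_order k G),
      (\dim (V_ n false))%:R - (\dim (V_ n true))%:R
        = d_plus (graph_matrix k G) n.+1)
    (L : lieSuperalgebra K) (iota : {linear V -> L})
    (freeL : is_free_lie V_ iota)
    (U : algType K) (j : {linear L -> U}) (envU : is_enveloping j) :
  (* the coefficients d_+ and d_- *)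
  (det_poly (graph_matrix k G)
     = 1 - \sum_(1 <= N < (matrix_order k G).+1)
             d_plus (graph_matrix k G) N *: 'X^N) /\
  (forall N : nat, zeta_fps (graph_matrix k G) N
     = if N == 0%N then 1 else d_minus (graph_matrix k G) N) /\
  (* (1) *)
  (forall N : nat, (0 < N)%N ->
     [/\ has_sdim (@lie_par K L) (lie_deg V_ iota N)
           (cycle_number (graph_matrix k G) N),
         #|cycle_classes k G N|%:R = cycle_number (graph_matrix k G) N
       & exists b : {set N.-tuple (oedge k G)} -> L,
           is_superbasis (@lie_par K L) (lie_deg V_ iota N)
             (cycle_classes k G N) b]) /\
  (* (2) *)
  fps_infprod
    (fun N => one_minus_pow N (cycle_number (graph_matrix k G) N))
    (fps_of_poly (det_poly (graph_matrix k G))) /\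
  (* (3) *)
  (forall N : nat,
     has_sdim (env_par j) (env_deg (lie_deg V_ iota) j N)
       (zeta_fps (graph_matrix k G) N)) /\
  (forall N : nat, (0 < N)%N ->
     has_sdim (env_par j) (env_deg (lie_deg V_ iota) j N)
       (d_minus (graph_matrix k G) N)).
Proof.
set D := matrix_order k G in V_ gradV dimV sdimV freeL *.
set A := graph_matrix k G in dimV sdimV *.
pose T := free_algebra_of K (letter V_).
pose deg := @letter_deg K V D V_; pose par := @letter_par K V D V_.
pose E (a : letter V_) : L := iota (letter_vec a).
have deg_gt0 a : (0 < deg a)%N by [].
have E_par a : lie_par (par a) (E a).
  exact: (proj1 freeL) (letter_vec_in a).
have [g [g_hom gf _]] := proj2 freeL _ (letter_map (V_ :=
  V_) T) (letter_map_par gradV T).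
have gE a : g (E a) = word T [:: a].
  by rewrite /E gf; exact: (letter_map_vec gradV).
have sc := signed_count_letters sdimV.
have envE N : has_sdim (env_par j) (env_deg (lie_deg V_ iota) j N)
  (zeta_fps A N).
  rewrite -sc; apply: has_sdim_ext (env_sdim deg_gt0 E_par g_hom gE envU N) =>
    u.
  by split; apply: env_deg_mono => n x /(lie_deg_letters gradV).
split; first exact: det_polyE.
split; first exact: zeta_fps_d_minus.
split; last first.
  split; first exact: generalized_witt_identity.
  split=> // N N0; have := envE N.
  by rewrite zeta_fps_d_minus gtn_eqF.
move=> N N0.
have [d [dimL dE]] := lie_sdim_divisors charK deg_gt0 E_par g_hom gE N
  (zeta_fps0 A) (log_der_zeta A) sc.
have NN : (0 < N <= N)%N by rewrite N0 leqnn.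
have sdimE : (d N false)%:R - (d N true)%:R = cycle_number A N :> rat.
  apply: (cycle_number_uniq (A := A) (c := fun n =>
    (d n false)%:R - (d n true)%:R) N0).
  move=> n nN; have n0 := dvdn_gt0 N0 nN.
  have nNN : (0 < n <= N)%N by rewrite n0 dvdn_leq.
  have := dE n nNN; rewrite /pos_part n0; exact: esym.
have dimP p : has_dim (fun x => lie_deg V_ iota N x /\ lie_par p x) (d N p).
  apply: has_dim_ext (dimL N p NN) => x.
  by rewrite -(gen_deg_par deg_gt0 E_par) (lie_deg_letters gradV).
split.
- by exists (d N false), (d N true); split.
- exact: card_cycle_classesE.
apply: (exists_superbasis (@lie_superspace K L) (n1 := d N true)) => //.
  split; first by split=> [|a x y]; [apply: lie_deg_0 | apply: lie_deg_lin].
  move=> x /(lie_deg_letters gradV)/(gen_deg_split deg_gt0 E_par)[x0 [x1 [X0 X1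
    ->]]].
  exists x0, x1; split=> //.
    split; last exact: rspan_par X0.
    by apply/(lie_deg_letters gradV); apply: rspan_deg X0.
  split; last exact: rspan_par X1.
  by apply/(lie_deg_letters gradV); apply: rspan_deg X1.
(* The superdimension of L_N is the number of classes of nonperiodic cycles. *)
have -> // : (#|cycle_classes k G N| + d N true)%N = d N false.
apply/eqP; rewrite -(eqr_nat rat) natrD card_cycle_classesE // -/A -sdimE.
by rewrite subrK.
Qed.
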